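(* The $(3,6)$-Ramsey graphs are $4$-extremal; in particular $s(4)=s_2(4)=17$. A graph is $4$-extremal and triangle-free if and only if it is a $(3,6)$-Ramsey graph. Every other $4$-extremal graph $G$ (if one exists) satisfies $\alpha(G)=4$ and $\theta(G)=8$.
   Context: All graphs are finite, simple and undirected. $\alpha(G)$ denotes the maximum size of a stable set, $\theta(G)$ the minimum number of cliques partitioning $V(G)$, and $\mathrm{gap}(G)=\theta(G)-\alpha(G)$. $s(t)$ (resp. $s_2(t)$) is the smallest number of vertices of a graph (resp. triangle-free graph) with gap $t$. A graph is $t$-extremal if it has gap $t$ and $s(t)$ vertices. A $(3,6)$-Ramsey graph is a graph of maximum order among graphs with no triangle and no stable set of size $6$; such graphs have $R(3,6)-1=17$ vertices. *)

(* Defs.v *)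
From mathcomp Require Import all_boot zify.
From mathcomp Require Import boolp.

Set Implicit Arguments.
Unset Strict Implicit.
Unset Printing Implicit Defensive.

Record sgraph := SGraph {
  vertex :> finType;
  edge : rel vertex;
  edge_sym : symmetric edge;
  edge_irr : irreflexive edge }.

Definition clique (G : sgraph) (A : {set G}) : bool :=
  [forall x in A, forall y in A, (x != y) ==> edge x y].

Definition stable (G : sgraph) (A : {set G}) : bool :=
  [forall x in A, forall y in A, ~~ edge x y].

Definition alpha (G : sgraph) : nat := \max_(A : {set G} | stable A) #|A|.

Definition clique_partition (G : sgraph) (P : {set {set G}}) : bool :=
  partition P [set: G] && [forall A in P, clique A].

Definition singletons (G : sgraph) : {set {set G}} :=
  [set [set x] | x in [set: G]].

(* [arg min] needs a witness of the constraint: the partition into singletons,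
   see [singletonsP]. *)
Definition theta (G : sgraph) : nat :=
  #|[arg min_(P < singletons G | clique_partition P) #|P|]|.

(* Truncated subtraction is harmless: a clique meets a stable set in at most one
   vertex, so alpha G <= theta G, see [alpha_le_theta]. *)
Definition gap (G : sgraph) : nat := theta G - alpha G.

Definition clique_free (k : nat) (G : sgraph) : Prop :=
  forall A : {set G}, clique A -> #|A| <> k.

Definition stable_free (l : nat) (G : sgraph) : Prop :=
  forall A : {set G}, stable A -> #|A| <> l.

Definition triangle_free (G : sgraph) : Prop := clique_free 3 G.

Definition ramsey_graph (k l : nat) (G : sgraph) : Prop :=
  [/\ clique_free k G, stable_free l G &
      forall H : sgraph, clique_free k H -> stable_free l H -> #|H| <= #|G|].

Lemma singletonsP (G : sgraph) : clique_partition (singletons G).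
Proof.
apply/andP; split; last first.
  apply/'forall_implyP => A /imsetP[x _ ->].
  apply/'forall_implyP => y /set1P ->; apply/'forall_implyP => z /set1P ->.
  by rewrite eqxx.
apply/and3P; split.
- rewrite eqEsubset subsetT; apply/subsetP => x _.
  by apply/bigcupP; exists [set x]; rewrite ?set11 // imset_f.
- apply/trivIsetP => A B /imsetP[x _ ->] /imsetP[y _ ->] nxy.
  by rewrite disjoints1 inE; apply: contraNneq nxy => ->.
- by apply/negP => /imsetP[x _ /setP/(_ x)]; rewrite !inE eqxx.
Qed.

Lemma theta_le (G : sgraph) (P : {set {set G}}) :
  clique_partition P -> theta G <= #|P|.
Proof.
by rewrite /theta; case: arg_minnP => [|Q _ h /h //]; apply: singletonsP.
Qed.

Lemma theta_attained (G : sgraph) :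
  exists2 P : {set {set G}}, clique_partition P & #|P| = theta G.
Proof.
rewrite /theta; case: arg_minnP; first exact: singletonsP.
by move=> Q hQ _; exists Q.
Qed.

Lemma alpha_le_theta (G : sgraph) : alpha G <= theta G.
Proof.
have [P /andP[/and3P[/eqP cP tP _] kP] <-] := theta_attained G.
apply/bigmax_leqP => A sA.
have PP x : pblock P x \in P by apply: pblock_mem; rewrite cP inE.
rewrite -(card_in_imset (f := pblock P) (D := A)); last first.
  move=> x y xA yA exy; apply/eqP/negPn/negP => nxy.
  have xB : x \in pblock P x by rewrite mem_pblock cP inE.
  have yB : y \in pblock P x by rewrite exy mem_pblock cP inE.
  move/'forall_implyP: kP => /(_ _ (PP x)).
  move=> /'forall_implyP/(_ _ xB)/'forall_implyP/(_ _ yB); rewrite nxy /=.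
  by move/'forall_implyP: sA => /(_ _ xA)/'forall_implyP/(_ _ yA)/negP.
by apply: subset_leq_card; apply/subsetP => _ /imsetP[x _ ->].
Qed.

(* The disjoint union of t pentagons is triangle-free and has gap t, so the
   minima s t and s2 t below range over nonempty sets. *)
Section Pentagons.
Variable t : nat.
Let V : finType := ('I_t * 'I_5)%type.

Definition pent : rel nat := fun a b => (b == a.+1 %% 5) || (a == b.+1 %% 5).

Definition pentagons_edge : rel V := fun u v => (u.1 == v.1) && pent u.2 v.2.

Lemma pentagons_sym : symmetric pentagons_edge.
Proof. by move=> u v; rewrite /pentagons_edge /pent eq_sym orbC. Qed.

Lemma pentagons_irr : irreflexive pentagons_edge.
Proof.
by move=> [i a]; rewrite /pentagons_edge eqxx /=; case: a => [] [|[|[|[|[]]]]].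
Qed.

Definition pentagons : sgraph := SGraph pentagons_sym pentagons_irr.

Let sumV (A : {set pentagons}) :
  #|A| = \sum_(i < t) \sum_(a < 5) ((i, a) \in A : nat).
Proof. by rewrite pair_big /= -sum1_card big_mkcond; apply: eq_bigr => -[i a] _; case: ifP. Qed.

Let stable5 (A : {set pentagons}) i :
  stable A -> \sum_(a < 5) ((i, a) \in A : nat) <= 2.
Proof.
move=> sA.
have h (a b : 'I_5) : pent a b -> ((i, a) \in A) && ((i, b) \in A) = false.
  move=> ab; apply/negP => /andP[aA bA].
  move/'forall_implyP: sA => /(_ _ aA)/'forall_implyP/(_ _ bA)/negP; apply.
  by rewrite /= /pentagons_edge eqxx.
rewrite !big_ord_recl big_ord0.
set a0 := ord0; set a1 := lift a0 _; set a2 := lift a0 _.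
set a3 := lift a0 _; set a4 := lift a0 _.
move: (h a0 a1 isT) (h a1 a2 isT) (h a2 a3 isT) (h a3 a4 isT) (h a4 a0 isT).
by do 5!case: (_ \in A).
Qed.

Let clique5 (A : {set pentagons}) i :
  clique A -> \sum_(a < 5) ((i, a) \in A : nat) <= 2.
Proof.
move=> kA.
have h (a b : 'I_5) :
    (a != b) && ~~ pent a b -> ((i, a) \in A) && ((i, b) \in A) = false.
  move=> /andP[nab ab]; apply/negP => /andP[aA bA].
  move/'forall_implyP: kA => /(_ _ aA)/'forall_implyP/(_ _ bA).
  by rewrite /= /pentagons_edge /= (negPf ab) andbF implybF xpair_eqE eqxx nab.
rewrite !big_ord_recl big_ord0.
set a0 := ord0; set a1 := lift a0 _; set a2 := lift a0 _.
set a3 := lift a0 _; set a4 := lift a0 _.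
move: (h a0 a2 isT) (h a1 a3 isT) (h a2 a4 isT) (h a3 a0 isT) (h a4 a1 isT).
by do 5!case: (_ \in A).
Qed.

Let clique_fiber (A : {set pentagons}) x y :
  clique A -> x \in A -> y \in A -> x.1 = y.1.
Proof.
move=> /'forall_implyP kA /kA/'forall_implyP {}kA /kA.
by case: eqVneq => [->|_ /andP[/eqP]].
Qed.

Lemma pentagons_triangle_free : triangle_free pentagons.
Proof.
move=> A kA A3.
have [x xA] : exists x, x \in A by apply/set0Pn; rewrite -card_gt0 A3.
suff: #|A| <= 2 by rewrite A3.
rewrite sumV (bigD1 x.1) //= [X in _ + X]big1 ?addn0 ?clique5 // => i /eqP nix.
rewrite big1 // => a _; apply/eqP; rewrite eqb0; apply/negP => iA.
by apply: nix; rewrite (clique_fiber kA xA iA).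
Qed.

Lemma pentagons_alpha : alpha pentagons = 2 * t.
Proof.
apply/eqP; rewrite eqn_leq; apply/andP; split.
  apply/bigmax_leqP => A sA; rewrite sumV.
  apply: (@leq_trans (\sum_(i < t) 2)); last by rewrite sum_nat_const card_ord mulnC.
  by apply: leq_sum => i _; apply: stable5.
pose A : {set pentagons} := [set u : V | (u.2 == 0 :> nat) || (u.2 == 2 :> nat)].
have sA : stable A.
  apply/'forall_implyP => -[i a]; rewrite inE /= => ha.
  apply/'forall_implyP => -[j b]; rewrite inE /= => hb.
  rewrite /pentagons_edge /= negb_and; apply/orP; right.
  by case/orP: ha => /eqP->; case/orP: hb => /eqP->.
apply: leq_trans (leq_bigmax_cond _ sA).
rewrite sumV (eq_bigr (fun _ => 2)); first by rewrite sum_nat_const card_ord mulnC.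
by move=> i _; rewrite !big_ord_recl big_ord0 !inE.
Qed.

Lemma pentagons_theta : theta pentagons = 3 * t.
Proof.
apply/eqP; rewrite eqn_leq; apply/andP; split.
  pose f (u : pentagons) : 'I_t * 'I_3 := (u.1, inord (u.2 : nat)./2).
  pose P := preim_partition f [set: pentagons].
  have PE A : A \in P -> exists k, A = f @^-1: [set k].
    case/imsetP => x _ ->; exists (f x).
    by apply/setP => y; rewrite !inE eq_sym.
  have hP : clique_partition P.
    rewrite /clique_partition preim_partitionP /=.
    apply/'forall_implyP => A /PE[k ->].
    apply/'forall_implyP => -[i a]; rewrite !inE => /eqP <-.
    apply/'forall_implyP => -[j b]; rewrite !inE /f /= => /eqP[-> /(congr1 val)].
    have lt3 (c : 'I_5) : c./2 < 3 by case: c => [] [|[|[|[|[]]]]].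
    rewrite /= !inordK // => hab; apply/implyP => nab.
    rewrite /pentagons_edge eqxx /=.
    have {}nab : a != b :> nat by apply: contraNneq nab => /val_inj->.
    move: hab nab; rewrite eq_sym.
    by case: a => [] [|[|[|[|[]]]]] //= _; case: b => [] [|[|[|[|[]]]]].
  apply: leq_trans (theta_le hP) _.
  apply: (@leq_trans #|[set f @^-1: [set k] | k in [set: 'I_t * 'I_3]]|).
    apply: subset_leq_card; apply/subsetP => A /PE[k ->]; exact: imset_f.
  by apply: leq_trans (leq_imset_card _ _) _; rewrite cardsT card_prod !card_ord mulnC.
have [P /andP[/and3P[/eqP cP tP _] /'forall_implyP kP] <-] := theta_attained pentagons.
pose hit (B : {set pentagons}) i := [exists x in B, x.1 == i].
have one B : B \in P -> \sum_(i < t) (hit B i : nat) <= 1.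
  move=> BP; case: (set_0Vmem B) => [->|[x xB]].
    by rewrite big1 // => i _; rewrite /hit; case: existsP => // -[x]; rewrite inE.
  rewrite (bigD1 x.1) //= big1 ?addn0 ?leq_b1 // => i nix.
  apply/eqP; rewrite eqb0; apply: contraNN nix => /existsP[y /andP[yB /eqP<-]].
  by apply/eqP; apply: (clique_fiber (kP _ BP)).
have five i : 3 <= \sum_(B in P) (hit B i : nat).
  suff: 5 <= 2 * \sum_(B in P) (hit B i : nat) by lia.
  have cov (x : pentagons) : 1 <= \sum_(B in P) (x \in B : nat).
    have xP : x \in cover P by rewrite cP inE.
    by rewrite (bigD1 (pblock P x)) ?pblock_mem //= mem_pblock xP.
  apply: (@leq_trans (\sum_(a < 5) \sum_(B in P) (((i, a) : pentagons) \in B : nat))).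
    apply: (@leq_trans (\sum_(a < 5) 1)); first by rewrite sum1_card card_ord.
    by apply: leq_sum => a _; apply: cov.
  rewrite exchange_big big_distrr /=; apply: leq_sum => B BP.
  case hB: (hit B i); first by rewrite muln1; apply: clique5 (kP _ BP).
  rewrite muln0 big1 // => a _; apply/eqP; rewrite eqb0; apply/negP => iB.
  by move/existsP: hB; apply; exists (i, a); rewrite iB eqxx.
apply: (@leq_trans (\sum_(i < t) \sum_(B in P) (hit B i : nat))).
  apply: (@leq_trans (\sum_(i < t) 3)); first by rewrite sum_nat_const card_ord mulnC.
  by apply: leq_sum => i _.
by rewrite exchange_big -sum1_card /=; apply: leq_sum => B /one.
Qed.

Lemma pentagons_gap : gap pentagons = t.
Proof. by rewrite /gap pentagons_theta pentagons_alpha -mulnBl mul1n. Qed.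

End Pentagons.

Definition gap_order (t : nat) : pred nat :=
  fun n => `[< exists G : sgraph, gap G = t /\ #|G| = n >].

Definition triangle_free_gap_order (t : nat) : pred nat :=
  fun n => `[< exists G : sgraph, [/\ triangle_free G, gap G = t & #|G| = n] >].

Lemma gap_order_exists (t : nat) : exists n, gap_order t n.
Proof.
exists #|pentagons t|; apply/asboolP; exists (pentagons t).
by rewrite pentagons_gap.
Qed.

Lemma triangle_free_gap_order_exists (t : nat) :
  exists n, triangle_free_gap_order t n.
Proof.
exists #|pentagons t|; apply/asboolP; exists (pentagons t).
by rewrite pentagons_gap; split => //; apply: pentagons_triangle_free.
Qed.

Definition s (t : nat) : nat := ex_minn (gap_order_exists t).

Definition s2 (t : nat) : nat := ex_minn (triangle_free_gap_order_exists t).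

Definition extremal (t : nat) (G : sgraph) : Prop := gap G = t /\ #|G| = s t.

(* Main.v *)
Require Import Defs.
From mathcomp Require Import all_boot zify.
From mathcomp Require Import boolp.

(** A minimal vertex set B with th B >= al B + t loses one clique in its minimum cover
    whenever a vertex is deleted; so, by Gallai, 2 th B <= |B| + 1 when B is connected,
    and otherwise its parts have positive gaps that add up to t. B has no vertex whose
    neighbourhood is a clique, and every vertex has at least th B - 1 non-neighbours.
    Removing triangles, which exist by R(3,4) = 9 and R(3,5) = 14, gives s(1) = 5,
    s(2) >= 10, s(3) >= 13 and s(4) >= 17 in turn, and leaves the pairs (al, th) = (4, 8)
    and (5, 9) on 17 vertices, the latter only without triangles.

    Gallai's bound: take a minimum cover with as few singletons as possible. If x and z
    are singletons and y is adjacent to x, compare with a minimum cover in which y is a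
    singleton: an alternating path moves the singleton from x to y while z stays. Walking
    towards z one reaches two adjacent singletons, which could be merged.

    The stability number 3 needs two more facts. A set of 10 vertices with al <= 3 has a
    cover by 4 cliques; this is a finite search. A K4-free set of 17 vertices with al <= 3
    is strongly regular, the neighbourhood of a vertex x has a perfect matching, and its
    edges extend to triangles by distinct non-neighbours of x; this yields 6 cliques.

    R(3,6) <= 18: a triangle-free graph on 18 vertices without stable set of size 6 is
    5-regular, and two non-adjacent vertices have one or two common neighbours. The
    pattern of these common neighbours around a vertex forces a stable set of size 6. *)

Set Implicit Arguments.
Unset Strict Implicit.
Unset Printing Implicit Defensive.

(** Deleting a clique lowers [th] by at most one and never raises [al], so it costs at most one unit
    of gap. Gallai's bound, in the form [2 * (al + t) <= n + 1], caps [al] from above; for [al = 2]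
    the non-neighbours of a vertex form a clique, which moves the problem to a neighbourhood. On 16
    vertices this leaves [al = 3] and [al = 4]. Stability number 3 is the obstacle: triangles lead
    from 16 to 13 to 10 vertices, where the general bound [al + 2] is too large by one, hence the
    search. On 17 vertices a clique of size 4 leads back to 13, so only K4-free sets need their own
    argument. The pair (4, 8) survives because 14 vertices with [al = 4] and [th = 7] may obey
    Gallai's bound, whereas removing a triangle from (5, 9) leaves [th >= 8] on 14 vertices, too
    much for a connected critical set. *)

Lemma exists_subset_card (T : finType) (A : {set T}) n :
  n <= #|A| -> exists2 B : {set T}, B \subset A & #|B| = n.
Proof.
move=> nA; exists [set x in take n (enum A)].
  by apply/subsetP => x; rewrite inE => /mem_take; rewrite mem_enum.
rewrite cardsE; have := take_uniq n (enum_uniq A) => /card_uniqP ->.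
by rewrite size_take -cardE; case: ltnP => // An; apply/eqP; rewrite eqn_leq nA An.
Qed.

(** * Clique covers of vertex sets *)

Section Basics.
Variable G : sgraph.
Implicit Types (x y z u v w : G) (A B C S K : {set G}).

Lemma edgeC x y : edge x y = edge y x. Proof. exact: edge_sym. Qed.

Lemma edge_neq x y : edge x y -> x != y.
Proof. by apply: contraTneq => ->; rewrite edge_irr. Qed.

Lemma cliqueP A :
  reflect {in A &, forall x y, x != y -> edge x y} (clique A).
Proof.
apply: (iffP 'forall_implyP) => h.
  by move=> x y /h/'forall_implyP hx /hx /implyP.
by move=> x xA; apply/'forall_implyP => y yA; apply/implyP; apply: h.
Qed.

Lemma stableP A : reflect {in A &, forall x y, ~~ edge x y} (stable A).
Proof.
apply: (iffP 'forall_implyP) => h.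
  by move=> x y /h/'forall_implyP hx /hx.
by move=> x xA; apply/'forall_implyP => y yA; apply: h.
Qed.

Lemma clique_sub A B : A \subset B -> clique B -> clique A.
Proof. by move=> /subsetP s /cliqueP h; apply/cliqueP => x y /s xB /s; apply: h. Qed.

Lemma stable_sub A B : A \subset B -> stable B -> stable A.
Proof. by move=> /subsetP s /stableP h; apply/stableP => x y /s xB /s; apply: h. Qed.

Lemma stable0 : stable (set0 : {set G}).
Proof. by apply/stableP => x y; rewrite inE. Qed.

Lemma clique1 x : clique [set x].
Proof. by apply/cliqueP => a b /set1P -> /set1P ->; rewrite eqxx. Qed.

Lemma stable1 x : stable [set x].
Proof. by apply/stableP => a b /set1P -> /set1P ->; rewrite edge_irr. Qed.

Lemma cliqueU1 x A : clique A -> {in A, forall y, edge x y} -> clique (x |: A).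
Proof.
move=> /cliqueP cA xA; apply/cliqueP => a b /setU1P[->|aA] /setU1P[->|bA].
- by rewrite eqxx.
- by move=> _; apply: xA.
- by move=> _; rewrite edgeC; apply: xA.
- exact: cA.
Qed.

Lemma stableU1 x A :
  stable A -> {in A, forall y, ~~ edge x y} -> stable (x |: A).
Proof.
move=> /stableP cA xA; apply/stableP => a b /setU1P[->|aA] /setU1P[->|bA].
- by rewrite edge_irr.
- exact: xA.
- by rewrite edgeC; apply: xA.
- exact: cA.
Qed.

Lemma clique2 x y : edge x y -> clique [set x; y].
Proof. by move=> e; apply: cliqueU1; [exact: clique1|move=> _ /set1P ->]. Qed.

Lemma stable2 x y : ~~ edge x y -> stable [set x; y].
Proof. by move=> e; apply: stableU1; [exact: stable1|move=> _ /set1P ->]. Qed.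

Lemma clique3 x y z : edge x y -> edge x z -> edge y z -> clique [set x; y; z].
Proof.
move=> xy xz yz; rewrite -setUA; apply: cliqueU1; first exact: clique2.
by move=> _ /set2P[] ->.
Qed.

(* Induced subgraphs are represented by their vertex sets: [al A] and [th A] are the
   stability number and the clique cover number of the subgraph induced by [A]. *)
Definition al A := \max_(S : {set G} | (S \subset A) && stable S) #|S|.

Lemma al_ge A S : S \subset A -> stable S -> #|S| <= al A.
Proof. by move=> SA sS; apply: leq_bigmax_cond; rewrite SA. Qed.

Lemma al_leP A k :
  reflect (forall S : {set G}, S \subset A -> stable S -> #|S| <= k) (al A <= k).
Proof.
rewrite /al; apply: (iffP (bigmax_leqP _ _ _)) => h S; first by move=> SA sS; apply: h; rewrite SA.
by case/andP; apply: h.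
Qed.

Lemma al_attained A : exists2 S : {set G}, S \subset A & stable S /\ #|S| = al A.
Proof.
have /(@eq_bigmax_cond _ _ (fun S : {set G} => #|S|)) :
    0 < #|[pred S : {set G} | (S \subset A) && stable S]|.
  by apply/card_gt0P; exists set0; rewrite inE sub0set stable0.
by case=> S /andP[SA sS] e; exists S.
Qed.

Lemma al_sub A B : A \subset B -> al A <= al B.
Proof.
by move=> AB; apply/al_leP => S SA sS; apply: al_ge => //; apply: subset_trans AB.
Qed.

Lemma al0 : al set0 = 0.
Proof.
by apply/eqP; rewrite -leqn0; apply/al_leP => S; rewrite subset0 => /eqP -> _; rewrite cards0.
Qed.

Lemma alphaE : alpha G = al setT.
Proof. by apply: eq_bigl => S; rewrite subsetT. Qed.

Lemma al_le1 A : al A <= 1 -> clique A.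
Proof.
move=> /al_leP h; apply/cliqueP => x y xA yA nxy; apply/negPn/negP => e.
have := h [set x; y]; rewrite cards2 nxy subUset !sub1set xA yA /=.
by move=> /(_ isT (stable2 e)).
Qed.

Definition noedge A B := {in A & B, forall x y, ~~ edge x y}.

Lemma stableU A B : stable A -> stable B -> noedge A B -> stable (A :|: B).
Proof.
move=> /stableP sA /stableP sB ne; apply/stableP => u v /setUP[] hu /setUP[] hv.
- exact: sA.
- exact: ne.
- by rewrite edgeC; apply: ne.
- exact: sB.
Qed.

Lemma al_noedge A B : [disjoint A & B] -> noedge A B -> al (A :|: B) = al A + al B.
Proof.
move=> dAB nAB; apply/eqP; rewrite eqn_leq; apply/andP; split.
  apply/al_leP => S SAB sS.
  have -> : S = (S :&: A) :|: (S :&: B) by rewrite -setIUr; apply/esym/setIidPl.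
  apply: leq_trans (leq_card_setU _ _) _.
  by apply: leq_add; apply: al_ge; rewrite ?subsetIr //; apply: stable_sub sS; rewrite subsetIl.
have [S SA [sS <-]] := al_attained A; have [S' SB [sS' <-]] := al_attained B.
have d : [disjoint S & S'] by apply: disjointWl SA _; apply: disjointWr SB _.
have -> : #|S| + #|S'| = #|S :|: S'| by apply/esym/eqP; rewrite (leq_card_setU S S').
apply: al_ge; first exact: setUSS.
apply: stableU => // x y /(subsetP SA) xA /(subsetP SB); exact: nAB.
Qed.

(* Clique covers are encoded by colourings whose classes in [A] are cliques. *)
Definition valid (T : eqType) (c : G -> T) A :=
  {in A &, forall x y, c x = c y -> x != y -> edge x y}.

Definition validb (c : {ffun G -> G}) A :=
  [forall x in A, forall y in A, (c x == c y) && (x != y) ==> edge x y].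

Lemma validbP (c : {ffun G -> G}) A : reflect (valid c A) (validb c A).
Proof.
apply: (iffP 'forall_implyP) => h.
  move=> x y /h/'forall_implyP hx /hx/implyP{}h cxy nxy.
  by apply: h; rewrite cxy eqxx.
move=> x xA; apply/'forall_implyP => y yA; apply/implyP => /andP[/eqP e n].
exact: h.
Qed.

Lemma validb_id A : validb [ffun x => x] A.
Proof. by apply/validbP => x y _ _; rewrite !ffunE => ->; rewrite eqxx. Qed.

Definition th A := #|[arg min_(c < [ffun x => x] | validb c A) #|c @: A|] @: A|.

Lemma th_attained A : exists2 c : {ffun G -> G}, valid c A & #|c @: A| = th A.
Proof.
rewrite /th; case: arg_minnP; first exact: validb_id.
by move=> c /validbP vc _; exists c.
Qed.

Lemma th_min (c : {ffun G -> G}) A : valid c A -> th A <= #|c @: A|.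
Proof.
move/validbP; rewrite /th; case: arg_minnP; first exact: validb_id.
by move=> d _ h /h.
Qed.

(** Colours may come from any finite type: each is replaced by a vertex of its class. *)
Lemma th_le (T : finType) (c : G -> T) A : valid c A -> th A <= #|c @: A|.
Proof.
move=> vc; have [->|[x0 x0A]] := set_0Vmem A.
  apply: (leq_trans (th_min (c := [ffun x => x]) _)); first by move=> x y; rewrite inE.
  by rewrite !imset0 cards0.
pose g (t : T) := odflt x0 [pick y in A | c y == t].
have gP x : x \in A -> c (g (c x)) = c x.
  rewrite /g => xA; case: pickP => [y /andP[_ /eqP]//|/(_ x)].
  by rewrite xA eqxx.
pose d := [ffun x => g (c x)].
apply: (leq_trans (th_min (c := d) _)).
  move=> x y xA yA; rewrite !ffunE => e; apply: vc => //.
  by rewrite -gP // e gP.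
apply: leq_trans (leq_imset_card g (c @: A)).
rewrite -imset_comp; apply: subset_leq_card; apply/subsetP => _ /imsetP[x xA ->].
by rewrite ffunE; apply: imset_f.
Qed.

Lemma th_sub A B : A \subset B -> th A <= th B.
Proof.
move=> AB; have [c vc <-] := th_attained B.
apply: (leq_trans (th_le (c := c) _)); last by apply: subset_leq_card; apply: imsetS.
by move: AB => /subsetP AB x y /AB xB /AB; apply: vc.
Qed.

Lemma thU A B : th (A :|: B) <= th A + th B.
Proof.
have [a va <-] := th_attained A; have [b vb <-] := th_attained B.
pose c x : G + G := if x \in A then inl (a x) else inr (b x).
apply: (leq_trans (th_le (c := c) _)).
  move=> x y; rewrite !inE /c.
  case xA: (x \in A); case yA: (y \in A) => //= xB yB [e]; first exact: va.
  exact: vb.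
have: c @: (A :|: B) \subset (inl @: (a @: A)) :|: (inr @: (b @: B)).
  apply/subsetP => _ /imsetP[x xAB ->]; move: xAB; rewrite /c !inE.
  case: ifP => /= [xA _|_ xB]; apply/orP; [left|right]; by do 2!apply: imset_f.
move/subset_leq_card => h; apply: leq_trans h _; apply: leq_trans (leq_card_setU _ _) _.
by apply: leq_add; apply: leq_imset_card.
Qed.

Lemma th0 : th set0 = 0.
Proof. by apply/eqP; rewrite -leqn0 /th imset0 cards0. Qed.

Lemma th_clique A : clique A -> th A <= 1.
Proof.
move=> /cliqueP h; apply: (leq_trans (th_le (c := fun _ : G => tt) _)).
  by move=> x y xA yA _; apply: h.
by apply: leq_trans (max_card _) _; rewrite card_unit.
Qed.

Lemma th_cover A B C : A \subset B :|: C -> th A <= th B + th C.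
Proof. by move=> h; apply: leq_trans (th_sub h) (thU _ _). Qed.

Lemma th_clique_cover A K B : clique K -> A \subset K :|: B -> th A <= (th B).+1.
Proof.
by move=> kK /th_cover h; apply: leq_trans h _; rewrite -add1n leq_add2r th_clique.
Qed.

Lemma th_D1 A x : th A <= (th (A :\ x)).+1.
Proof.
apply: (th_clique_cover (clique1 x)); apply/subsetP => y yA.
by rewrite !inE yA andbT; case: (y == x).
Qed.

Lemma th_D A K : clique K -> th A <= (th (A :\: K)).+1.
Proof.
move=> kK; apply: (th_clique_cover kK); apply/subsetP => y yA.
by rewrite !inE yA andbT; case: (y \in K).
Qed.

Lemma al_le_th A : al A <= th A.
Proof.
apply/al_leP => S /subsetP SA /stableP sS; have [c vc <-] := th_attained A.
rewrite -(card_in_imset (f := c) (D := S)).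
  by apply: subset_leq_card; apply: imsetS; apply/subsetP.
move=> x y xS yS e; apply/eqP/negPn/negP => n.
by have := vc _ _ (SA _ xS) (SA _ yS) e n; apply/negP; apply: sS.
Qed.

(** The second hypothesis makes [B] a union of colour classes, so no colour occurs on both sides. *)
Lemma card_imset_disj (T : finType) (c : G -> T) A B :
  B \subset A -> {in A & , forall x y, c x = c y -> x \in B -> y \in B} ->
  #|c @: B| + #|c @: (A :\: B)| <= #|c @: A|.
Proof.
move=> /subsetP BA h.
have d : [disjoint c @: B & c @: (A :\: B)].
  rewrite -setI_eq0; apply/eqP/setP => t; rewrite !inE; apply/negP.
  case/andP=> /imsetP[x xB ->] /imsetP[y]; rewrite inE => /andP[yB yA] e.
  by rewrite (h x y (BA _ xB) yA e xB) in yB.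
have <- : #|c @: B :|: c @: (A :\: B)| = #|c @: B| + #|c @: (A :\: B)|.
  by apply/eqP; rewrite (leq_card_setU _ _).
apply: subset_leq_card; rewrite subUset !imsetS //; first exact: subsetDl.
exact/subsetP.
Qed.

Lemma th_noedge A B : [disjoint A & B] -> noedge A B -> th (A :|: B) = th A + th B.
Proof.
move=> dAB nAB; apply/eqP; rewrite eqn_leq thU /=.
have [c vc <-] := th_attained (A :|: B).
have sub : A \subset A :|: B by rewrite subsetUl.
have DE : (A :|: B) :\: A = B.
  apply/setP => x; rewrite !inE; case xA: (x \in A) => //=.
  by rewrite (disjointFr dAB xA).
apply: leq_trans (card_imset_disj (c := c) sub _); last first.
  move=> x y xAB yAB e xA; have [->//|n] := eqVneq y x.
  have := vc _ _ xAB yAB e; rewrite eq_sym => /(_ n) exy.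
  move: yAB; rewrite inE => /orP[//|yB].
  by have := nAB _ _ xA yB; rewrite exy.
rewrite DE; apply: leq_add; apply: th_le => x y hx hy; apply: vc; rewrite inE ?hx ?hy ?orbT //.
Qed.

Lemma card_le_th A k :
  (forall K : {set G}, K \subset A -> clique K -> #|K| <= k) -> #|A| <= k * th A.
Proof.
move=> h; have [c vc <-] := th_attained A.
rewrite -sum1_card (partition_big_imset c) /= mulnC -sum_nat_const.
apply: leq_sum => t _; rewrite sum1_card -cardsE; apply: h.
  by apply/subsetP => x; rewrite inE => /andP[].
apply/cliqueP => x y; rewrite !inE => /andP[xA /eqP xt] /andP[yA /eqP yt].
by apply: vc => //; rewrite xt.
Qed.

Lemma thetaE : theta G = th setT.
Proof.
apply/eqP; rewrite eqn_leq; apply/andP; split.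
  have [c vc <-] := th_attained setT.
  pose P := preim_partition c [set: G].
  have hP : clique_partition P.
    rewrite /clique_partition preim_partitionP /=.
    apply/'forall_implyP => A /imsetP[x _ ->]; apply/cliqueP => y z.
    by rewrite !inE => /eqP ey /eqP ez; apply: vc; rewrite ?inE // -ey.
  apply: leq_trans (theta_le hP) _.
  apply: leq_trans (leq_imset_card (fun t => [set y | t == c y]) _).
  rewrite -imset_comp; apply: subset_leq_card; apply/subsetP => A /imsetP[x xT ->].
  by apply/imsetP; exists x => //; apply/setP => y; rewrite !inE.
have [P /andP[/and3P[/eqP cP tP _] /'forall_implyP kP] <-] := theta_attained G.
have PP x : pblock P x \in P by apply: pblock_mem; rewrite cP inE.
apply: (leq_trans (th_le (c := pblock P) _)).
  move=> x y _ _ e; have /cliqueP := kP _ (PP x); apply; first by rewrite mem_pblock cP inE.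
  by rewrite e mem_pblock cP inE.
by apply: subset_leq_card; apply/subsetP => _ /imsetP[x _ ->].
Qed.

End Basics.

Arguments th_le {G T} c [A].

(** * Gallai's bound on the clique cover number of critical sets *)

Section Gallai.
Variables (G : sgraph) (A : {set G}).
Hypothesis crA : forall v, v \in A -> th (A :\ v) < th A.
Hypothesis conA : forall C : {set G}, C \subset A -> C != set0 ->
  {in C & A, forall x y, edge x y -> y \in C} -> C = A.

Let sing (T : eqType) (c : G -> T) :=
  [set v in A | [forall u in A, (c u == c v) ==> (u == v)]].

Let singP (T : eqType) (c : G -> T) v :
  reflect (v \in A /\ forall u, u \in A -> c u = c v -> u = v) (v \in sing c).
Proof.
rewrite inE; apply: (iffP andP) => -[vA h]; split => //.
  move=> u uA e; move/'forall_implyP: h => /(_ _ uA)/implyP h.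
  by apply/eqP/h/eqP.
by apply/'forall_implyP => u uA; apply/implyP => /eqP e; apply/eqP/h.
Qed.

Let opt (c : G -> G) :=
  [/\ valid c A, #|c @: A| = th A &
      forall d : G -> G, valid d A -> #|d @: A| = th A -> #|sing c| <= #|sing d|].

Let opt_exists : exists c, opt c.
Proof.
pose Q m := `[< exists c : G -> G, [/\ valid c A, #|c @: A| = th A & #|sing c| = m] >].
have exQ : exists m, Q m.
  have [c vc ec] := th_attained A.
  by exists #|sing c|; apply/asboolP; exists c.
case: (ex_minnP exQ) => m /asboolP[c [vc ec <-]] h; exists c; split=> // d vd ed.
by apply: h; apply/asboolP; exists d.
Qed.

Let recolour (c : G -> G) u t := fun v => if v == u then t else c v.

(** Move [u] into the class of the singleton [x]. Were [u] alone in its class, a colour would be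
    saved; were the class larger than a pair, a singleton would be lost. So the class is [u], [w],
    and the singleton passes from [x] to [w] while the others stay. *)
Let shift c x u : opt c -> x \in sing c -> u \in A -> edge x u ->
  exists w, [/\ w \in A, w != u, c w = c u,
    forall t, t \in A -> c t = c u -> t = u \/ t = w &
    let d := recolour c u (c x) in
    [/\ opt d, w \in sing d & forall z, z \in sing c -> z != x -> z \in sing d]].
Proof.
move=> [vc ec mc] /singP[xA sx] uA exu.
have nux : u != x by rewrite eq_sym (edge_neq exu).
set d := recolour c u (c x).
have du : d u = c x by rewrite /d /recolour eqxx.
have dn v : v != u -> d v = c v by rewrite /d /recolour => /negPf ->.
have cux : c u != c x by apply: contraNneq nux => /(sx _ uA) ->.
have vd : valid d A.
  move=> a b aA bA; have [->|na] := eqVneq a u; have [->|nb] := eqVneq b u.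
  - by [].
  - by rewrite du dn // => /esym/(sx _ bA) -> _; rewrite edgeC.
  - by rewrite du dn // => /(sx _ aA) -> _.
  - by rewrite !dn //; apply: vc.
have dA : d @: A \subset c @: A.
  apply/subsetP => _ /imsetP[v vA ->]; have [->|n] := eqVneq v u.
    by rewrite du; apply: imset_f.
  by rewrite dn //; apply: imset_f.
have ed : #|d @: A| = th A.
  by apply/eqP; rewrite eqn_leq (th_le d) // andbT -ec subset_leq_card.
have [w [wA nwu cwu]] : exists w, [/\ w \in A, w != u & c w = c u].
  apply: contrapT => h.
  have: d @: A \subset (c @: A) :\ c u.
    apply/subsetP => t tdA; rewrite !inE (subsetP dA _ tdA) andbT.
    case/imsetP: tdA => v vA ->; have [->|n] := eqVneq v u; first by rewrite du eq_sym.
    by rewrite dn //; apply: contra_notN h => /eqP e; exists v.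
  move/subset_leq_card; rewrite ed -ec (cardsD1 (c u) (c @: A)) imset_f //.
  by rewrite ltnn.
have singd v : v \in sing c -> v != x -> v \in sing d.
  move=> /singP[vA sv] nvx; have nvu : v != u.
    by apply: contraNneq nwu => e; rewrite -e in cwu *; rewrite (sv w).
  apply/singP; split=> // t tA; rewrite (dn v) //; have [->|nt] := eqVneq t u.
    by rewrite du => /esym /(sx _ vA) e; rewrite e eqxx in nvx.
  by rewrite dn //; apply: sv.
have uw t : t \in A -> c t = c u -> t = u \/ t = w.
  move=> tA ctu; have [->|ntu] := eqVneq t u; first by left.
  have [->|ntw] := eqVneq t w; first by right.
  have: sing d \subset sing c :\ x.
    apply/subsetP => v /singP[vA sv].
    have nvu : v != u.
      apply: contraNneq nux => e; apply/eqP; rewrite -e; apply/esym/sv => //.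
      by rewrite e du dn // (edge_neq exu).
    have nvx : v != x.
      apply: contraNneq nux => e; apply/eqP; rewrite -e; apply: sv => //.
      by rewrite e du dn // (edge_neq exu).
    rewrite !inE nvx vA /=; apply/'forall_implyP => a aA; apply/implyP => /eqP e.
    have [eau|nau] := eqVneq a u; last by apply/eqP; apply: sv => //; rewrite !dn.
    case/negP: ntw; apply/eqP; transitivity v; [|apply/esym]; apply: sv => //.
      by rewrite !dn // ctu -eau.
    by rewrite !dn // cwu -eau.
  move/subset_leq_card; have := mc _ vd ed.
  rewrite (cardsD1 x (sing c)); have -> : x \in sing c by apply/singP.
  by rewrite add1n => h1 h2; have := leq_trans h1 h2; rewrite ltnn.
have wd : w \in sing d.
  apply/singP; split=> // t tA; rewrite (dn w) //; have [->|nt] := eqVneq t u.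
    by rewrite du cwu => e; rewrite e eqxx in cux.
  by rewrite dn // cwu => /uw -/(_ tA)[] // e; rewrite e eqxx in nt.
exists w; split=> //; split=> //; split=> // d' vd' ed'.
apply: leq_trans (mc _ vd' ed').
have: sing d \subset w |: (sing c :\ x).
  apply/subsetP => v /singP[vA sv]; rewrite in_setU1; case: eqVneq => //= nvw.
  have nvu : v != u.
    apply: contraNneq nux => e; apply/eqP; rewrite -e; apply/esym/sv => //.
    by rewrite e du dn // (edge_neq exu).
  have nvx : v != x.
    apply: contraNneq nux => e; apply/eqP; rewrite -e; apply: sv => //.
      by rewrite e du dn // (edge_neq exu).
  rewrite in_setD1 nvx /=; apply/singP; split=> // t tA e.
  have [etu|ntu] := eqVneq t u; last by apply: sv => //; rewrite !dn.
  have: c v = c u by rewrite -e etu.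
  by case/(uw _ vA) => e'; rewrite e' eqxx in nvu nvw.
move/subset_leq_card => h; apply: leq_trans h _.
rewrite cardsU1 (cardsD1 x (sing c)); have -> : x \in sing c by apply/singP.
by rewrite leq_add2r leq_b1.
Qed.

(** Alternating walks between the covers [q] and [c], recorded by the [q]-classes they visit: a step
    joins two of these through a common [c]-class. *)
Let step (T : finType) (q : G -> T) (c : G -> G) : rel T :=
  [rel s t | [exists u in A, exists w in A, [&& q u == s, q w == t & c u == c w]]].

(** The first step leaves the [q]-class of [x] at some [u], distinct from [x] and adjacent to it;
    [shift] moves the singleton to [w] in the next [q]-class. The rest of the path avoids the
    [q]-class of [u], so recolouring [u] does not break it. *)
Let walk (T : finType) (q : G -> T) z y (p : seq T) : valid q A -> y \in sing q ->
  forall c x, opt c -> x \in sing c -> z \in sing c -> z != x ->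
  path (step q c) (q x) p -> uniq (q x :: p) -> last (q x) p = q y ->
  exists c', [/\ opt c', y \in sing c', z \in sing c' & z != y].
Proof.
move=> vq /singP[yA sy]; elim: p => [|t p IH] c x oc xc zc nzx /=.
  move=> _ _ /sy <-; first by exists c.
  by case/singP: xc.
case/andP=> /existsP[u /andP[uA /existsP[w /and4P[wA /eqP quq /eqP qwt /eqP cuw]]]].
move=> pp /andP[nt /andP[ntp up]] lp.
have [xA sx] := singP _ _ xc.
have nxu : x != u.
  apply: contraNneq nt => e; have := sx w wA; rewrite e -cuw => /(_ erefl) <-.
  by rewrite qwt mem_head.
have exu : edge x u by apply: vq.
have [w' [w'A nw'u cw' uw [od w'd zd]]] := shift oc xc uA exu.
have nwu : w != u by apply: contraNneq nt => e; rewrite -qwt e quq mem_head.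
have ew : w = w' by have [e|//] := uw _ wA (esym cuw); rewrite e eqxx in nwu.
rewrite -ew in w'd.
have nzw : z != w.
  apply: contraTneq zc => ->; apply/negP => /singP[_ /(_ u uA cuw) e].
  by rewrite e eqxx in nwu.
apply: (IH _ w od w'd (zd _ zc nzx) nzw); rewrite ?qwt //; last by rewrite /= ntp.
apply: (sub_in_path (P := mem (t :: p)) _ (allss (t :: p)) pp) => a b ain bin.
case/existsP=> u2 /andP[u2A].
case/existsP=> w2 /and4P[w2A /eqP e1 /eqP e2 /eqP e3].
apply/existsP; exists u2; rewrite u2A; apply/existsP; exists w2.
rewrite w2A e1 e2 !eqxx /= /recolour.
have ->: (u2 == u) = false.
  by apply: contraNF nt => /eqP e; rewrite -quq -e e1.
have ->: (w2 == u) = false.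
  by apply: contraNF nt => /eqP e; rewrite -quq -e e2.
exact/eqP.
Qed.

(* Exchanging the two covers on a union of components of their incidence graph
   would make the adjacent vertices [x] and [y] both singletons. *)
Let linked (T : finType) (q : G -> T) (c : G -> G) x y :
  valid q A -> #|q @: A| <= th A -> y \in sing q -> opt c -> x \in sing c ->
  edge x y -> connect (step q c) (q x) (q y).
Proof.
move=> vq cq /singP[yA sy] [vc cc _] /singP[xA sx] exy; apply/negPn/negP => ncon.
pose C := [set v in A | ~~ connect (step q c) (q x) (q v)].
have CA : C \subset A by apply/subsetP => v; rewrite inE => /andP[].
have yC : y \in C by rewrite inE yA.
have xC : x \in A :\: C by rewrite !inE xA connect0.
have Cq : {in A &, forall a b, q a = q b -> a \in C -> b \in C}.
  by move=> a b aA bA e; rewrite !inE aA bA e.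
have Cc : {in A &, forall a b, c a = c b -> a \in C -> b \in C}.
  move=> a b aA bA e; rewrite !inE aA bA /=; apply: contra => h.
  apply: connect_trans h (connect1 _).
  apply/existsP; exists b; rewrite bA; apply/existsP; exists a.
  by rewrite aA !eqxx e eqxx.
have h1 := card_imset_disj CA Cq; have h2 := card_imset_disj CA Cc.
have vs (T' : eqType) (f : G -> T') (B : {set G}) : B \subset A -> valid f A -> valid f B.
  by move=> /subsetP BA vf a b /BA aA /BA; apply: vf.
(* The hybrid cover [c] on [C], [q] outside has at least [th A] colours, so the opposite hybrid has
   at most [th A]; in that one [x] and [y] are singletons joined by an edge. *)
have h3 : th A <= #|c @: C| + #|q @: (A :\: C)|.
  apply: (@leq_trans (th C + th (A :\: C))).
    by apply: th_cover; apply/subsetP => v vA; rewrite !inE vA; case: connect.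
  by apply: leq_add; apply: th_le; apply: vs => //; apply: subsetDl.
have h4 : (th (C :\ y)).+1 <= #|q @: C|.
  have: q @: (C :\ y) \subset (q @: C) :\ q y.
    apply/subsetP => _ /imsetP[v /setD1P[nv vC] ->]; rewrite !inE imset_f // andbT.
    by apply: contraNneq nv => /sy ->; rewrite ?(subsetP CA).
  move/subset_leq_card; rewrite [X in _ < X](cardsD1 (q y)) imset_f // add1n ltnS.
  apply: leq_trans; apply: th_le; apply: vs vq.
  by apply: subset_trans CA; apply: subsetDl.
have h5 : (th ((A :\: C) :\ x)).+1 <= #|c @: (A :\: C)|.
  have: c @: ((A :\: C) :\ x) \subset (c @: (A :\: C)) :\ c x.
    apply/subsetP => _ /imsetP[v /setD1P[nv vC] ->]; rewrite !inE imset_f // andbT.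
    by apply: contraNneq nv => /sx ->; case/setDP: vC.
  move/subset_leq_card; rewrite [X in _ < X](cardsD1 (c x)) imset_f // add1n ltnS.
  apply: leq_trans; apply: th_le; apply: vs vc.
  by apply: subset_trans (subsetDl A C); apply: subsetDl.
have h6 : th A <= (th (C :\ y) + th ((A :\: C) :\ x)).+1.
  apply: (@leq_trans (th ((C :\ y) :|: ((A :\: C) :\ x))).+1); last by rewrite ltnS thU.
  apply: (th_clique_cover (clique2 exy)); apply/subsetP => v vA.
  by rewrite !inE vA; case: (v == x); case: (v == y); case: connect.
lia.
Qed.

Theorem gallai : 2 * th A <= #|A|.+1.
Proof.
have [c oc] := opt_exists; have [vc cc _] := oc.
have s1 : #|sing c| <= 1.
  rewrite leqNgt; apply/negP => /card_gt1P[x [z [xc zc nxz]]].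
  (* [D] collects the vertices that can become singletons while [z] remains another one. It is
     closed under adjacency, so connectedness puts [z] itself into [D]. *)
  pose D := [set v in A | `[< exists c', [/\ opt c', v \in sing c', z \in sing c' & z != v] >]].
  have zA : z \in A by case/singP: zc.
  have DA : D = A.
    apply: conA.
    - by apply/subsetP => v; rewrite inE => /andP[].
    - apply/set0Pn; exists x; rewrite inE; apply/andP; split; first by case/singP: xc.
      by apply/asboolP; exists c; rewrite eq_sym.
    move=> a y; rewrite !inE => /andP[aA /asboolP[d [od ad zd nza]]] yA eay.
    rewrite yA; apply/asboolP.
    have [q0 vq0 eq0] := th_attained (A :\ y).
    (* Criticality makes this a minimum cover of [A]: one colour is saved on [A :\ y] and spent on
       [y]. *)
    pose q v := if v == y then None else Some (q0 v).
    have vq : valid q A.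
      move=> u w uA wA; rewrite /q; case: eqVneq => [->|nu]; case: eqVneq => [->|nw] //.
      by move=> [e]; apply: vq0; rewrite // in_setD1 ?nu ?nw.
    have cq : #|q @: A| <= th A.
      have: q @: A \subset None |: (Some @: (q0 @: (A :\ y))).
        apply/subsetP => _ /imsetP[v vA ->]; rewrite in_setU1 /q; case: (eqVneq v y) => //= nv.
        by do 2!apply: imset_f; rewrite in_setD1 nv.
      move/subset_leq_card => h; apply: leq_trans h _; rewrite cardsU1.
      apply: leq_trans (crA yA); rewrite -eq0.
      by apply: leq_add (leq_b1 _) (leq_imset_card _ _).
    have yq : y \in sing q.
      apply/singP; split=> // u uA; rewrite /q eqxx; case: eqVneq => //.
    have /connectP[p pp ep] := linked vq cq yq od ad eay.
    move: ep; case: (shortenP pp) => p' pp' up' _ ep.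
    exact: (walk vq yq od ad zd nza pp' up' (esym ep)).
  have: z \in D by rewrite DA.
  by rewrite inE => /andP[_ /asboolP[c' [_ _ _]]]; rewrite eqxx.
have e1 : #|A| = \sum_(t in c @: A) #|[set x in A | c x == t]|.
  rewrite -sum1_card (partition_big_imset c) /=; apply: eq_bigr => t _.
  by rewrite sum1_card -cardsE; apply: eq_card => x; rewrite !inE.
(* All classes but at most one have two or more vertices. *)
have : \sum_(t in c @: A) 2 <=
       \sum_(t in c @: A) (#|[set x in A | c x == t]| + (t \in c @: sing c)).
  apply: leq_sum => _ /imsetP[x xA ->].
  have [xs|/negP xs] := boolP (x \in sing c).
    rewrite (imset_f _ xs) addn1 ltnS; apply/card_gt0P; exists x.
    by rewrite inE xA eqxx.
  apply: leq_trans (leq_addr _ _); apply/card_gt1P.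
  have [u [uA cu nu]] : exists u, [/\ u \in A, c u = c x & u != x].
    apply: contrapT => h; apply: xs; apply/singP; split=> // u uA cu.
    by apply/eqP/negPn/negP => n; apply: h; exists u.
  by exists x, u; rewrite !inE xA uA cu !eqxx eq_sym.
rewrite sum_nat_const cc big_split /= -e1 mulnC.
move=> h; apply: leq_trans h _; rewrite -addn1 leq_add2l.
apply: leq_trans s1; apply: leq_trans (leq_imset_card c _).
rewrite -sum1_card big_mkcond [X in _ <= X]big_mkcond /=; apply: leq_sum => t _.
by case: (t \in c @: A); case: (t \in _).
Qed.

End Gallai.

(** * Gap-critical sets and small Ramsey numbers *)

Section Critical.
Variable G : sgraph.
Implicit Types (x y z u v w : G) (A B C S K T : {set G}) (t : nat).

Definition nb x := [set y | edge x y].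

Lemma in_nb x y : (y \in nb x) = edge x y.
Proof. by rewrite inE. Qed.

Definition hasK n A := exists2 K : {set G}, K \subset A & clique K /\ #|K| = n.

Lemma hasK_sub n A B : A \subset B -> hasK n A -> hasK n B.
Proof. by move=> AB [K KA h]; exists K => //; apply: subset_trans AB. Qed.

Lemma hasK3 A x y z : x \in A -> y \in A -> z \in A ->
  edge x y -> edge x z -> edge y z -> hasK 3 A.
Proof.
move=> xA yA zA xy xz yz; exists [set x; y; z].
  by rewrite !subUset !sub1set xA yA zA.
split; first exact: clique3.
by rewrite setUC cardsU1 cards2 !inE (edge_neq xy) eq_sym (negPf (edge_neq xz)) eq_sym
   (negPf (edge_neq yz)).
Qed.

Lemma hasK_nb n A x : x \in A -> hasK n (A :&: nb x) -> hasK n.+1 A.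
Proof.
move=> xA [K /subsetP KA [kK cK]]; exists (x |: K).
  by rewrite subUset sub1set xA; apply/subsetP => y /KA /setIP[].
have xK y : y \in K -> edge x y by move=> /KA; rewrite !inE => /andP[].
split; first exact: cliqueU1.
rewrite cardsU1 cK; case: (boolP (x \in K)) => // /xK; rewrite edge_irr //.
Qed.

Lemma clique_hasK n A K : K \subset A -> clique K -> n <= #|K| -> hasK n A.
Proof.
move=> KA kK /exists_subset_card[K' K'K cK']; exists K'; first exact: subset_trans KA.
by split=> //; apply: clique_sub kK.
Qed.

Lemma trifree_stable A x : ~ hasK 3 A -> x \in A -> stable (A :&: nb x).
Proof.
move=> ntr xA; apply/stableP => y z; rewrite !inE => /andP[yA xy] /andP[zA xz].
by apply/negP => yz; apply: ntr; apply: (hasK3 xA yA zA).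
Qed.

Lemma trifree_deg A x : ~ hasK 3 A -> x \in A -> #|A :&: nb x| <= al A.
Proof. by move=> ntr xA; apply: al_ge; rewrite ?subsetIl // trifree_stable. Qed.

Definition nn x A := A :\: (x |: nb x).

Lemma al_nn A x k : x \in A -> al A <= k.+1 -> al (nn x A) <= k.
Proof.
move=> xA aA; apply/al_leP => S /subsetP SA sS; rewrite -ltnS; apply: leq_trans aA.
have xS : x \notin S by apply/negP => /SA; rewrite !inE eqxx.
have -> : #|S|.+1 = #|x |: S| by rewrite cardsU1 xS.
apply: al_ge.
  by rewrite subUset sub1set xA; apply/subsetP => y /SA /setDP[].
by apply: stableU1 => // y /SA; rewrite !inE negb_or => /andP[/andP[]].
Qed.

Lemma card_nn A x : x \in A -> #|A| = (#|A :&: nb x| + #|nn x A|).+1.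
Proof.
move=> xA; rewrite -(cardsID (x |: nb x) A) -addSn; congr (_ + _).
have -> : A :&: (x |: nb x) = x |: (A :&: nb x).
  apply/setP => y; rewrite !inE; case: eqVneq => [->|//]; by rewrite xA.
by rewrite cardsU1 !inE edge_irr andbF.
Qed.

Lemma card_nb_split A x y : x \in A ->
  #|A :&: nb y| = edge x y + #|A :&: nb x :&: nb y| + #|nn x A :&: nb y|.
Proof.
move=> xA; rewrite -(cardsID (x |: nb x) (A :&: nb y)); congr (_ + _); last first.
  by apply: eq_card => z; rewrite !inE andbA.
rewrite (cardsD1 x) !inE eqxx xA edgeC andbT; congr (_ + _).
apply: eq_card => z; rewrite !inE; have [->|_] := eqVneq z x; first by rewrite edge_irr andbF.
by rewrite /= andbAC.
Qed.

Lemma al_gt0 A : A != set0 -> 0 < al A.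
Proof.
case/set0Pn=> x xA; have := al_ge (A := A) (S := [set x]).
by rewrite cards1 sub1set; apply; [|exact: stable1].
Qed.

Lemma handshake A : ~~ odd (\sum_(x in A) #|A :&: nb x|).
Proof.
have E B : \sum_(x in B) #|B :&: nb x| = \sum_(x in B) \sum_(y in B) (edge x y : nat).
  apply: eq_bigr => x _; rewrite -sum1_card big_mkcond [RHS]big_mkcond /=.
  by apply: eq_bigr => y _; rewrite !inE; case: (y \in B); case: edge.
rewrite E; have [n] := ubnP #|A|; elim: n A => // n IH A.
have [->|[a aA]] := set_0Vmem A; first by rewrite big_set0.
rewrite (cardsD1 a) aA add1n ltnS => /IH; set B := A :\ a => h.
have aB : a \notin B by rewrite !inE eqxx.
rewrite -(setD1K aA) -/B big_setU1 //= big_setU1 //= edge_irr add0n.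
rewrite [X in _ + X](eq_bigr (fun x => edge a x + \sum_(y in B) edge x y)); last first.
  by move=> x _; rewrite big_setU1 //= edgeC.
by rewrite big_split /= addnA addnn oddD odd_double.
Qed.

(** In a triangle-free set a vertex has at most two neighbours, hence at least three non-neighbours,
    and these form a clique. *)
Lemma ramsey33 A : al A <= 2 -> 6 <= #|A| -> hasK 3 A.
Proof.
move=> aA cA; have [x xA] : exists x, x \in A by apply/card_gt0P; lia.
apply: contrapT => ntr; have := trifree_deg ntr xA; have := card_nn xA => e d.
have kn : clique (nn x A) by apply: al_le1; apply: al_nn.
by apply: ntr; apply: (clique_hasK _ kn); [exact: subsetDl|lia].
Qed.

(** On exactly nine vertices without a triangle all degrees would equal 3, and the degree sum 27 is
    odd. *)
Lemma ramsey34 A : al A <= 3 -> 9 <= #|A| -> hasK 3 A.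
Proof.
move=> aA /exists_subset_card[B BA cB]; apply: (hasK_sub BA).
have aB : al B <= 3 by apply: leq_trans aA; apply: al_sub.
apply: contrapT => ntr.
have d x : x \in B -> #|B :&: nb x| = 3.
  move=> xB; have := trifree_deg ntr xB; have := card_nn xB => e d.
  have [h|h] := leqP 6 #|nn x B|; last lia.
  case: ntr; apply: hasK_sub (subsetDl _ _) _; apply: ramsey33 h; exact: al_nn.
have := handshake B; rewrite (eq_bigr _ d) sum_nat_const cB //.
Qed.

Lemma ramsey35 A : al A <= 4 -> 14 <= #|A| -> hasK 3 A.
Proof.
move=> aA cA; have [x xA] : exists x, x \in A by apply/card_gt0P; lia.
apply: contrapT => ntr; have := trifree_deg ntr xA; have := card_nn xA => e d.
case: ntr; apply: hasK_sub (subsetDl _ _) _; apply: (@ramsey34 (nn x A)); last lia.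
exact: al_nn.
Qed.

(** [x] joins any existing class, being adjacent to all of [N]. *)
Lemma th_cone (N : {set G}) x : N \subset nb x -> 0 < #|N| -> th (x |: N) <= th N.
Proof.
move=> /subsetP Nx /card_gt0P[y0 y0N]; have [c vc <-] := th_attained N.
have xN : x \notin N by apply/negP => /Nx; rewrite inE edge_irr.
pose d v := if v == x then c y0 else c v.
apply: (leq_trans (th_le d _)).
  move=> a b; rewrite !inE /d.
  case: (eqVneq a x) => [->|na]; case: (eqVneq b x) => [->|nb] //=.
  - by move=> _ /Nx; rewrite inE.
  - by move=> /Nx; rewrite inE edgeC.
  - by move=> aN bN; apply: vc.
apply: subset_leq_card; apply/subsetP => _ /imsetP[v vN ->]; rewrite /d.
move: vN; rewrite !inE; case: eqVneq => [_ _|_ /= vN]; exact: imset_f.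
Qed.

(** * Critical sets *)

Lemma peel n A : hasK n A -> exists K : {set G}, [/\ K \subset A, clique K, #|K| = n,
  #|A :\: K| = #|A| - n & th A <= (th (A :\: K)).+1 /\ al (A :\: K) <= al A].
Proof.
case=> K KA [kK cK]; exists K; split=> //; first by rewrite cardsDS // cK.
by split; [exact: th_D|apply: al_sub; apply: subsetDl].
Qed.

(** Asking only for gap at least [t] lets a minimal set be chosen at once; for positive [t],
    equality follows by deleting one vertex. *)
Definition crit t B :=
  al B + t <= th B /\ forall B', B' \proper B -> th B' < al B' + t.

Lemma crit_exists t A : al A + t <= th A -> exists2 B : {set G}, B \subset A & crit t B.
Proof.
move=> h; have [B /minsetP[hB mB] BA] :=
  minset_exists (P := fun B => al B + t <= th B) h.
exists B => //; split=> // B' /properP[B'B [x xB xB']]; rewrite ltnNge.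
by apply/negP => h'; rewrite (mB _ h' B'B) xB in xB'.
Qed.

Lemma crit_th t B : 0 < t -> crit t B ->
  th B = al B + t /\ forall v, v \in B -> th (B :\ v) < th B.
Proof.
move=> t0 [h m].
have h1 v : v \in B -> th (B :\ v) < al B + t.
  move=> vB; apply: leq_trans (m _ (properD1 vB)) _.
  by rewrite leq_add2r al_sub ?subsetDl.
split=> [|v vB]; last exact: leq_trans (h1 v vB) h.
have [e|[v vB]] := set_0Vmem B; first by move: h; rewrite e th0 al0; lia.
by have := h1 v vB; have := th_D1 B v; lia.
Qed.

Lemma crit_al t B : 0 < t -> crit t B -> 2 <= al B.
Proof.
move=> t0 cB; have [e _] := crit_th t0 cB; rewrite ltnNge; apply/negP => a1.
have := th_clique (al_le1 a1).
have [e0|/al_gt0] := eqVneq B set0; last lia.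
by move: e; rewrite e0 th0 al0; lia.
Qed.

(** If [B] is not connected, it splits into two proper parts without edges between them. By
    criticality both gaps are below [t], and they add up to [t], so both are positive. *)
Lemma crit_cases t B : 0 < t -> crit t B ->
  2 * th B <= #|B|.+1 \/
  exists (B1 B2 : {set G}) t1 t2,
    [/\ B = B1 :|: B2, [disjoint B1 & B2], noedge B1 B2 & t = t1 + t2] /\
    [/\ 0 < t1, 0 < t2, th B1 = al B1 + t1 & th B2 = al B2 + t2].
Proof.
move=> t0 cB; have [e dv] := crit_th t0 cB.
have [h|h] := EM (forall C : {set G}, C \subset B -> C != set0 ->
  {in C & B, forall x y, edge x y -> y \in C} -> C = B).
  by left; apply: gallai.
right; apply: contrapT => hn; apply: h => C CB C0 cl; apply: contrapT => nCB.
have pC : C \proper B by rewrite properEneq CB andbT; apply/eqP.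
have pD : B :\: C \proper B.
  rewrite properE subsetDl; apply/subsetPn; case/set0Pn: C0 => x xC.
  by exists x; rewrite ?inE ?xC // (subsetP CB).
have dis : [disjoint C & B :\: C].
  by rewrite -setI_eq0; apply/eqP/setP => x; rewrite !inE; case: (x \in C).
have ne : noedge C (B :\: C).
  move=> x y xC; rewrite inE => /andP[yC yB]; apply: contra yC; exact: cl.
have BE : B = C :|: (B :\: C).
  apply/setP => x; rewrite !inE; case: (boolP (x \in C)) => //= /(subsetP CB) //.
have := th_noedge dis ne; have := al_noedge dis ne; rewrite -BE => ea et.
have := al_le_th C; have := al_le_th (B :\: C) => l2 l1.
have := cB.2 _ pC; have := cB.2 _ pD => m2 m1.
apply: hn; exists C, (B :\: C), (th C - al C), (th (B :\: C) - al (B :\: C)).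
by split; split=> //; lia.
Qed.

(** Otherwise [v] and its neighbours form one clique. Removing it costs at most one in [th] and at
    least one in [al], so a proper subset would keep gap [t]. *)
Lemma crit_simplicial t B v : crit t B -> v \in B -> clique (B :&: nb v) -> False.
Proof.
move=> [h m] vB kN.
have p : nn v B \proper B.
  by rewrite properE subsetDl; apply/subsetPn; exists v; rewrite // !inE eqxx.
have := m _ p.
have : al (nn v B) < al B.
  case E: (al B) => [|a]; last by rewrite ltnS; apply: al_nn => //; rewrite E.
  by move: (al_gt0 (A := B)); rewrite E ltnn => /(_ _); apply; apply/set0Pn; exists v.
have : th B <= (th (nn v B)).+1.
  apply: (th_clique_cover (K := v |: (B :&: nb v))).
    by apply: cliqueU1 => // y; rewrite !inE => /andP[].
  by apply/subsetP => y yB; rewrite !inE yB; case: eqP => //=; case: edge.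
lia.
Qed.

(** Take a minimum cover of [B :\ v]. Every class contains a non-neighbour of [v], since otherwise
    [v] could join it and [th B] would not drop. *)
Lemma crit_nn t B v : 0 < t -> crit t B -> v \in B -> th B <= (#|nn v B|).+1.
Proof.
move=> t0 cB vB; have [_ /(_ v vB) lt] := crit_th t0 cB.
have [c vc cc] := th_attained (B :\ v).
have h s : s \in c @: (B :\ v) -> exists w, [/\ w \in nn v B & c w = s].
  move=> sc; apply: contrapT => nw.
  pose d u := if u == v then s else c u.
  have vd : valid d B.
    have ev w : w \in B -> w != v -> c w = s -> edge v w.
      move=> wB nwv cw; apply/negPn/negP => nvw; apply: nw; exists w.
      by rewrite !inE (negPf nwv) (negPf nvw).
    move=> a b aB bB; rewrite /d.
    case: (eqVneq a v) => [->|na]; case: (eqVneq b v) => [->|nb] //.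
    - by move=> e _; apply: ev.
    - by move=> e _; rewrite edgeC; apply: ev.
    - by apply: vc; rewrite !inE ?na ?nb.
  have := th_le d vd; rewrite leqNgt => /negP; apply.
  apply: leq_ltn_trans lt; rewrite -cc; apply: subset_leq_card.
  apply/subsetP => _ /imsetP[u uB ->]; rewrite /d; case: eqVneq => // nu.
  by apply: imset_f; rewrite !inE nu.
apply: leq_trans (th_D1 B v) _; rewrite ltnS -cc.
apply: (@leq_trans #|c @: nn v B|); last exact: leq_imset_card.
by apply: subset_leq_card; apply/subsetP => s /h[w [wn <-]]; apply: imset_f.
Qed.

(** A critical set of gap one has [al >= 2] and [th >= 3], so Gallai's bound asks for five
    vertices. *)
Lemma th_al4 A : #|A| <= 4 -> th A <= al A.
Proof.
move=> cA; rewrite leqNgt; apply/negP; rewrite -addn1 => /crit_exists[B BA cB].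
have [e _] := crit_th (ltn0Sn _) cB; have a2 := crit_al (ltn0Sn _) cB.
have := subset_leq_card BA => cBA.
case: (crit_cases (ltn0Sn _) cB) => [|[B1 [B2 [t1 [t2 [[_ _ _ e1] []]]]]]]; lia.
Qed.

Lemma gap1_card A t : 0 < t -> th A = al A + t -> 5 <= #|A|.
Proof. by move=> t0 e; rewrite leqNgt; apply/negP; rewrite ltnS => /th_al4; lia. Qed.

Lemma card_disjU A B : [disjoint A & B] -> #|A :|: B| = #|A| + #|B|.
Proof. by move=> d; apply/eqP; rewrite (leq_card_setU A B). Qed.

(* A vertex outside a critical set [C] that raises the cover number has no
   neighbour in [C], so all its neighbours lie in the clique [K]. *)
Lemma crit_leftover t B K C t' v : crit t B -> K \subset B -> clique K ->
  0 < t' -> crit t' C -> B :\: K = v |: C -> v \notin C -> th C < th (B :\: K) -> False.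
Proof.
move=> cB KB kK t0 cC E vC lt.
have vB : v \in B :\: K by rewrite E setU11.
apply: (@crit_simplicial t B v cB); first by case/setDP: vB.
apply: clique_sub kK; apply/subsetP => y; rewrite !inE => /andP[yB evy].
apply/negPn/negP => yK; have: y \in B :\: K by rewrite inE yK.
rewrite E => /setU1P[e|yC]; first by rewrite e edge_irr in evy.
have [_ /(_ y yC) h] := crit_th t0 cC.
suff: th (B :\: K) <= (th (C :\ y)).+1 by lia.
rewrite E; apply: (th_clique_cover (clique2 evy)).
by apply/subsetP => u; rewrite !inE; case: (u == v); case: (u == y).
Qed.

Lemma crit1_conn C : crit 1 C -> 2 * th C <= #|C|.+1.
Proof.
move=> cC; case: (crit_cases (ltn0Sn _) cC) => [//|[B1 [B2 [t1 [t2 [[_ _ _ e1] []]]]]]]; lia.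
Qed.

(* If [al B <= 2] the non-neighbours of a vertex form a clique. *)
Lemma th_al2 B x : al B <= 2 -> x \in B -> th B <= (maxn 1 (th (B :&: nb x))).+1.
Proof.
move=> aB xB.
have kn : clique (nn x B) by apply: al_le1; apply: al_nn.
apply: leq_trans (th_clique_cover (B := x |: (B :&: nb x)) kn _) _.
  by apply/subsetP => y yB; rewrite !inE yB; case: eqP => //=; case: edge.
rewrite ltnS; case: (posnP #|B :&: nb x|) => [/eqP|pos].
  rewrite cards_eq0 => /eqP ->; rewrite setU0.
  exact: leq_trans (th_clique (clique1 x)) (leq_maxl _ _).
by apply: leq_trans (th_cone (subsetIr _ _) pos) (leq_maxr _ _).
Qed.

End Critical.

(** * Complement graphs *)

Section Complement.
Variable G : sgraph.
Definition compl_edge : rel G := fun x y => (x != y) && ~~ edge x y.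
Lemma compl_sym : symmetric compl_edge.
Proof. by move=> x y; rewrite /compl_edge eq_sym edgeC. Qed.
Lemma compl_irr : irreflexive compl_edge.
Proof. by move=> x; rewrite /compl_edge eqxx. Qed.
(** The complement keeps the vertex type, so vertex sets are shared. It turns R(3,4) into R(4,3) and
    the handshake lemma into a parity statement on non-neighbours. *)
Definition compl : sgraph := SGraph compl_sym compl_irr.

Lemma compl_nb (x : G) (A : {set G}) : A :&: @nb compl x = nn x A.
Proof.
apply/setP => y; rewrite !inE /= /compl_edge negb_or eq_sym andbC; congr andb.
Qed.

Lemma compl_clique (A : {set G}) : @clique compl A = stable A.
Proof.
apply/(@cliqueP compl)/stableP => h x y xA yA.
  apply/negP => e; have := h _ _ xA yA (edge_neq e).
  by rewrite /= /compl_edge e andbF.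
by move=> n; rewrite /= /compl_edge n /= h.
Qed.

Lemma compl_stable (A : {set G}) : @stable compl A = clique A.
Proof.
apply/(@stableP compl)/cliqueP => h x y xA yA.
  by move=> n; have := h _ _ xA yA; rewrite /= /compl_edge n negbK.
by rewrite /= /compl_edge negb_and !negbK; case: eqVneq => //= n; apply: h.
Qed.

Lemma ramsey43 (A : {set G}) : al A <= 2 -> ~ hasK 4 A -> #|A| <= 8.
Proof.
move=> aA nK; rewrite leqNgt; apply/negP => cA.
suff [K KA [kK cK]] : @hasK compl 3 A.
  rewrite compl_clique in kK; have := @al_ge G A K KA kK; rewrite cK; lia.
apply: (@ramsey34 compl A _ cA); apply/(@al_leP compl) => S SA; rewrite compl_stable => kS.
by rewrite leqNgt; apply/negP => h; apply: nK; exact: (@clique_hasK G 4 A S SA kS h).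
Qed.

End Complement.

Lemma handshake_nn (G : sgraph) (A : {set G}) : ~~ odd (\sum_(x in A) #|nn x A|).
Proof.
suff <- : \sum_(x in A) #|A :&: @nb (compl G) x| = \sum_(x in A) #|nn x A|.
  exact: (@handshake (compl G) A).
apply: eq_bigr => x _; apply: (congr1 (fun B : {set G} => #|B|)); exact: compl_nb.
Qed.

(** * Gap two *)

Section GapTwo.
Variable G : sgraph.
Implicit Types (x y z u v w : G) (A B C S K T : {set G}) (t : nat).

Lemma proper_D K B : K \subset B -> 0 < #|K| -> B :\: K \proper B.
Proof.
move=> KB /card_gt0P[x xK]; rewrite properE subsetDl; apply/subsetPn; exists x.
  exact: (subsetP KB).
by rewrite inE xK.
Qed.

Lemma sub_card1 C A : C \subset A -> #|A| = #|C|.+1 ->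
  exists2 v : G, A = v |: C & v \notin C.
Proof.
move=> CA cA; have: #|A :\: C| == 1 by rewrite cardsDS // cA subSnn.
case/cards1P=> v e; exists v; last by have: v \in A :\: C by [rewrite e set11]; case/setDP.
rewrite -e setUC; apply/setP => x; rewrite !inE; case: (boolP (x \in C)) => //= xC.
by rewrite (subsetP CA).
Qed.

(** A critical subset of gap one in [B :\: K] has five or six vertices. Six contradict Gallai's
    bound because [th >= 4]; five have [th <= 3] and leave a single vertex, excluded by
    [crit_leftover]. *)
Lemma crit_six t B K : crit t B -> K \subset B -> clique K -> #|B :\: K| = 6 ->
  al (B :\: K) <= 3 -> 4 <= th (B :\: K) <= (al (B :\: K)).+1 -> False.
Proof.
move=> cB KB kK c6 a3 /andP[t4 lt].
have [|C CD cC] := @crit_exists G 1 (B :\: K); first lia.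
have [eC mC] := crit_th (ltn0Sn _) cC; have aC := crit_al (ltn0Sn _) cC.
have c5 := gap1_card (ltn0Sn _) eC; have cC2 := crit1_conn cC.
have cCD := subset_leq_card CD.
have [cC6|cC5] : #|C| = 6 \/ #|C| = 5 by lia.
  have EC : C = B :\: K by apply/eqP; rewrite eqEcard CD; lia.
  by move: eC cC2; rewrite EC; lia.
have [|v E vC] := sub_card1 CD; first lia.
by apply: (crit_leftover cB KB kK (ltn0Sn _) cC E vC); lia.
Qed.

(** A disconnected critical set of gap two needs 5 + 5 vertices. In the connected case Gallai's
    bound leaves [al = 3] on nine vertices, where a triangle leads to [crit_six], and [al = 2]. *)
Lemma th_al9 A : #|A| <= 9 -> th A <= (al A).+1.
Proof.
move=> cA; rewrite leqNgt; apply/negP => h.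
have [|B BA cB] := @crit_exists G 2 A; first lia.
have [e m] := crit_th (ltn0Sn _) cB; have a2 := crit_al (ltn0Sn _) cB.
have cBA := subset_leq_card BA.
case: (crit_cases (ltn0Sn _) cB) => [c|]; last first.
  case=> B1 [B2 [t1 [t2 [[E d _ e1] [t10 t20 h1 h2]]]]].
  by have := gap1_card t10 h1; have := gap1_card t20 h2; move: cBA; rewrite E card_disjU //; lia.
have [a3|a3] : al B = 3 \/ al B = 2 by lia.
  have [|T [TB kT cT cD [tD aD]]] := @peel G 3 B; first by apply: ramsey34; lia.
  have := cB.2 _ (proper_D TB _); rewrite cT => /(_ isT) lt.
  by apply: (crit_six cB TB kT); lia.
have dn x : x \in B -> #|nn x B| = 3 /\ #|B| = 9.
  move=> xB; have := crit_nn (ltn0Sn _) cB xB; have := card_nn xB.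
  have := @th_al2 G B x; rewrite a3 xB => /(_ isT isT) h2 h3 h4.
  have [h5|h5] := leqP #|B :&: nb x| 4; last lia.
  have := th_al4 h5; have := al_sub (subsetIl B (nb x)); lia.
have [x xB] : exists x, x \in B by apply/card_gt0P; lia.
(* Nine vertices with three non-neighbours each violate parity. *)
have := handshake_nn B; rewrite (eq_bigr (fun=> 3)); last by move=> y /dn[].
by rewrite sum_nat_const (dn x xB).2.
Qed.

Lemma gap2_card A t : 1 < t -> th A = al A + t -> 10 <= #|A|.
Proof. by move=> t0 e; rewrite leqNgt; apply/negP; rewrite ltnS => /th_al9; lia. Qed.

Lemma card3_ex T : #|T| = 3 ->
  exists a b c, [/\ a != b, a != c, b != c & T = [set a; b; c]].
Proof.
move=> c3; have [a aT] : exists a, a \in T by apply/card_gt0P; rewrite c3.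
have /cards2P[b [c [nbc E]]] : #|T :\ a| == 2 by move: c3; rewrite (cardsD1 a) aT add1n => -[->].
have : b \in T :\ a by rewrite E !inE eqxx.
have : c \in T :\ a by rewrite E !inE eqxx orbT.
rewrite !inE => /andP[nca _] /andP[nba _]; exists a, b, c; split=> //; try by rewrite eq_sym.
by rewrite -setUA -E setD1K.
Qed.

(** Such a set is a pentagon. By [crit_nn] every vertex has at least two non-neighbours, so a
    triangle through [x] would contain all its neighbours and make [x] simplicial. *)
Lemma crit1_5 C : crit 1 C -> #|C| = 5 -> [/\ al C = 2, th C = 3 & ~ hasK 3 C].
Proof.
move=> cC c5; have [e m] := crit_th (ltn0Sn _) cC; have := crit_al (ltn0Sn _) cC.
have := crit1_conn cC => h1 h2; split; try lia.
case=> K KC [/cliqueP kK cK].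
have [x xK] : exists x, x \in K by apply/card_gt0P; lia.
have xC := subsetP KC _ xK.
apply: (crit_simplicial cC xC); have := crit_nn (ltn0Sn _) cC xC; have := card_nn xC => h3 h4.
have sub : K :\ x \subset C :&: nb x.
  apply/subsetP => y /setD1P[n yK]; rewrite !inE (subsetP KC) // kK // eq_sym //.
have -> : C :&: nb x = K :\ x.
  apply/esym/eqP; rewrite eqEcard sub; have := cardsD1 x K; rewrite xK; lia.
by apply: clique_sub (subsetDl _ _) _; apply/cliqueP.
Qed.

Lemma crit_5 A : #|A| = 5 -> al A < th A -> crit 1 A.
Proof.
move=> c5 lt; have [|B BA cB] := @crit_exists G 1 A; first lia.
have [e _] := crit_th (ltn0Sn _) cB; have := gap1_card (ltn0Sn _) e => h.
by have -> : A = B by apply/esym/eqP; rewrite eqEcard BA c5.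
Qed.

(** Otherwise each vertex of [T] lies on a triangle meeting [T] only there. These three triangles
    meet pairwise, outside [T]. Two equal meeting points would be adjacent to all of [T] and give a
    K4; three distinct ones form a triangle disjoint from [T]. *)
Lemma triangles_meet B T : ~ hasK 4 B ->
  (forall T, T \subset B -> clique T -> #|T| = 3 -> ~ hasK 3 (B :\: T)) ->
  T \subset B -> clique T -> #|T| = 3 ->
  exists2 x, x \in T & ~ hasK 3 (B :\: (T :\ x)).
Proof.
move=> noK4 tf TB kT cT; have tfT := tf _ TB kT cT; apply: contrapT => nt'.
have nt x : x \in T -> hasK 3 (B :\: (T :\ x)).
  by move=> xT; apply: contrapT => h; apply: nt'; exists x.
have ex x : x \in T -> exists K : {set G}, [/\ K \subset B, clique K, #|K| = 3, x \in K &
    forall y, y \in K -> y != x -> y \in B :\: T].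
  move=> xT; have [K KD [kK cK]] := nt x xT.
  have out y : y \in K -> y != x -> y \in B :\: T.
    by move=> /(subsetP KD); rewrite !inE => /andP[h1 ->] n; move: h1; rewrite n andbT.
  exists K; split=> //; first by apply: subset_trans KD (subsetDl _ _).
  apply/negPn/negP => xK; apply: tfT; exists K => //; apply/subsetP => y yK.
  by apply: out => //; apply: contraNneq xK => <-.
have meet x y K K' : x \in T -> y \in T -> x != y ->
    [/\ K \subset B, clique K, #|K| = 3, x \in K &
      forall z, z \in K -> z != x -> z \in B :\: T] ->
    [/\ K' \subset B, clique K', #|K'| = 3, y \in K' &
      forall z, z \in K' -> z != y -> z \in B :\: T] ->
    exists u, [/\ u \in K, u \in K', u \in B :\: T, edge u x & edge u y].
  move=> xT yT nxy [KB kK cK xK hK] [KB' kK' cK' yK' hK'].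
  have [u /andP[uK uK']] : exists u, (u \in K) && (u \in K').
    apply: contrapT => nu; apply: (tf K KB kK cK); exists K' => //.
    apply/subsetP => u uK'; rewrite inE (subsetP KB') // andbT.
    by apply/negP => uK; apply: nu; exists u; rewrite uK.
  have nux : u != x.
    by apply/eqP => eu; have := hK' u uK'; rewrite eu nxy inE xT => /(_ isT).
  have nuy : u != y.
    by apply/eqP => eu; have := hK u uK; rewrite eu eq_sym nxy inE yT => /(_ isT).
  move/cliqueP: kK => kK; move/cliqueP: kK' => kK'.
  by exists u; split=> //; [exact: hK|exact: kK|exact: kK'].
have [x [y [z [nxy nxz nyz ET]]]] := card3_ex cT.
have xT : x \in T by rewrite ET !inE eqxx.
have yT : y \in T by rewrite ET !inE eqxx orbT.
have zT : z \in T by rewrite ET !inE eqxx orbT.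
have [K1 h1] := ex x xT; have [K2 h2] := ex y yT; have [K3 h3] := ex z zT.
have [u [u1 u2 uD ux uy]] := meet _ _ _ _ xT yT nxy h1 h2.
have [v [v1 v3 vD vx vz]] := meet _ _ _ _ xT zT nxz h1 h3.
have [w [w2 w3 wD wy wz]] := meet _ _ _ _ yT zT nyz h2 h3.
have four p : p \in B :\: T -> edge p x -> edge p y -> edge p z -> False.
  move=> pD px py pz; apply: noK4; apply: (@hasK_nb G 3 B p); first by case/setDP: pD.
  exists T => //; apply/subsetP => b bT; rewrite !inE (subsetP TB) //.
  by move: bT; rewrite ET !inE => /orP[/orP[]|] /eqP ->.
have nuv : u != v by apply/eqP => E; apply: (four u) => //; rewrite E.
have nuw : u != w by apply/eqP => E; apply: (four u) => //; rewrite E.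
have nvw : v != w by apply/eqP => E; apply: (four v) => //; rewrite E.
case: h1 => _ /cliqueP k1 _ _ _; case: h2 => _ /cliqueP k2 _ _ _; case: h3 => _ /cliqueP k3 _ _ _.
by apply: tfT; apply: (hasK3 uD vD wD); [apply: k1|apply: k2|apply: k3].
Qed.

End GapTwo.

(** * Ten vertices without stable set of size four *)

(* Refutation trees for partially known graphs on the labels [0, .., n - 1]:
   [Br i j s t] splits on the pair [ij] (edge in [s], non-edge in [t]); the leaves
   exhibit a clique of size 4, a stable set of size 4, a triangle among the labels
   above [m], a cover by 4 cliques, or a relabelling that increases the code. *)
Inductive tree :=
  | Br of nat & nat & tree & tree
  | Kl of seq nat
  | St of seq nat
  | Tr of seq nat
  | Cv of seq (seq nat)
  | Sy of seq nat.

(** A partial adjacency matrix: [None] marks an undecided pair and is also the default outside the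
    stored entries. *)
Definition known := seq (seq (option bool)).
Definition look (M : known) i j := nth None (nth [::] M i) j.
Definition put (M : known) i j b : known :=
  set_nth [::] M i (set_nth None (nth [::] M i) j (Some b)).
Definition put2 M i j b := put (put M i j b) j i b.
Definition says (M : known) (b : bool) i j :=
  if look M i j is Some c then (if b then c else ~~ c) else false.
Definition init (pos neg : seq (nat * nat)) : known :=
  foldr (fun p M => put2 M p.1 p.2 true)
    (foldr (fun p M => put2 M p.1 p.2 false) [::] neg) pos.

Lemma look_put M i j b i' j' :
  look (put M i j b) i' j' = if (i' == i) && (j' == j) then Some b else look M i' j'.
Proof.
rewrite /look /put nth_set_nth /=; case: (eqVneq i' i) => [->|//] /=.
by rewrite nth_set_nth /=.
Qed.

Lemma look_put2 M i j b i' j' c : look (put2 M i j b) i' j' = Some c ->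
  [\/ [/\ i' = i, j' = j & c = b], [/\ i' = j, j' = i & c = b] | look M i' j' = Some c].
Proof.
rewrite /put2 !look_put; case: andP => [[/eqP -> /eqP ->] [<-]|_]; first by constructor 2.
by case: andP => [[/eqP -> /eqP ->] [<-]|_ h]; [constructor 1|constructor 3].
Qed.

Lemma saysP M b i j : says M b i j -> look M i j = Some b.
Proof. by rewrite /says; case: look => [[]|]; case: b. Qed.

Section Search.
Variables (n m : nat) (flip : bool) (L : seq (nat * nat)) (M0 : known).

(** The pairs of [L] are read as binary digits, the first one most significant; [flip] decides
    whether edges or non-edges count as 1. *)
Fixpoint code (L : seq (nat * nat)) (e : nat -> nat -> bool) :=
  if L is (i, j) :: L' then (e i j (+) flip) * 2 ^ size L' + code L' e else 0.

(** Lexicographic comparison of the codes before and after relabelling by [p]. A pair that [p] maps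
    to itself has equal digits even while undecided. *)
Fixpoint increases (M : known) (p : seq nat) (L : seq (nat * nat)) :=
  if L is (i, j) :: L' then
    let i' := nth 0 p i in let j' := nth 0 p j in
    if (i' == i) && (j' == j) || (i' == j) && (j' == i) then increases M p L' else
    if says M true i j then
      if says M true i' j' then increases M p L' else flip && says M false i' j'
    else if says M false i j then
      if says M false i' j' then increases M p L' else ~~ flip && says M true i' j'
    else false
  else false.

(** Only the initial data [M0] and the labels from [m] on must be respected, not the choices made
    while branching: the best labelling is fixed before the tree is entered. *)
Definition symmetry (p : seq nat) :=
  [&& size p == n, uniq p, all (gtn n) p,
      all (fun i => (m <= i) ==> (m <= nth 0 p i)) (iota 0 n) &
      all (fun i => all (fun j =>
        if look M0 i j is Some b then says M0 b (nth 0 p i) (nth 0 p j) else true)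
        (iota 0 n)) (iota 0 n)].

(** Among the leaves exhibiting sets only [St] asks for distinct labels: a known edge separates its
    ends, a non-edge does not. *)
Fixpoint check (M : known) (t : tree) : bool :=
  match t with
  | Br i j t1 t0 => check (put2 M i j true) t1 && check (put2 M i j false) t0
  | Kl s => [&& size s == 4, all (gtn n) s & pairwise (says M true) s]
  | St s => [&& size s == 4, uniq s, all (gtn n) s & pairwise (says M false) s]
  | Tr s => [&& size s == 3, all (gtn n) s, all (leq m) s & pairwise (says M true) s]
  | Cv c => [&& size c <= 4, all (fun i => has (fun s => i \in s) c) (iota 0 n),
                all (all (gtn n)) c & all (pairwise (says M true)) c]
  | Sy p => symmetry p && increases M p L
  end.

Lemma code_ub L' e : code L' e < 2 ^ size L'.
Proof.
elim: L' => [|[i j] L' IH] //=; rewrite expnS.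
have : (e i j (+) flip : nat) <= 1 by case: (_ (+) _).
nia.
Qed.

Variables (G : sgraph) (B F : {set G}) (x0 : G).
Hypotheses (cB : #|B| = n) (aB : al B <= 3) (kB : ~ hasK 4 B) (tB : 4 < th B)
  (kF : ~ hasK 3 F) (Ln : all (fun ij => (ij.1 < n) && (ij.2 < n)) L).

Let ed (l : seq G) i j := edge (nth x0 l i) (nth x0 l j).

Definition labels l := [/\ size l = n, uniq l, {subset l <= B} & {subset drop m l <= F}].

Definition fits l (M : known) :=
  forall i j b, i < n -> j < n -> look M i j = Some b -> ed l i j = b.

Let sym_pairwise (T : eqType) (r : rel T) s : symmetric r -> pairwise r s ->
  {in s &, forall x y, x != y -> r x y}.
Proof.
move=> sr; elim: s => [|a s IH] //= /andP[/allP h /IH {}IH] x y.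
rewrite !inE => /predU1P[->|xs] /predU1P[->|ys].
- by rewrite eqxx.
- by move=> _; apply: h.
- by move=> _; rewrite sr; apply: h.
- exact: IH.
Qed.

Let pairs l M b s : labels l -> fits l M -> all (gtn n) s -> pairwise (says M b) s ->
  pairwise (fun x y => edge x y == b) [seq nth x0 l i | i <- s].
Proof.
move=> ll fl sn; rewrite pairwise_map; apply: (sub_in_pairwise (P := gtn n)) sn.
by move=> i j /= ni nj /saysP lo; apply/eqP; apply: fl lo.
Qed.

Let in_B l s : labels l -> all (gtn n) s -> [set x in [seq nth x0 l i | i <- s]] \subset B.
Proof.
case=> sl _ lB _ /allP sn; apply/subsetP => x; rewrite inE => /mapP[i /sn /= ni ->].
by apply: lB; apply: mem_nth; rewrite sl.
Qed.

Let clique_pairs l M s : labels l -> fits l M -> all (gtn n) s ->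
  pairwise (says M true) s ->
  clique [set x in [seq nth x0 l i | i <- s]] /\ #|[set x in [seq nth x0 l i | i <- s]]| = size s.
Proof.
move=> ll fl sn ps; have pp := pairs ll fl sn ps; split.
  apply/cliqueP => x y; rewrite !inE => xs ys nxy.
  by apply/eqP; apply: (sym_pairwise _ pp) => // a b; rewrite edgeC.
rewrite cardsE -[RHS](size_map (nth x0 l)); apply/card_uniqP; rewrite uniq_pairwise.
by move: pp; apply: sub_pairwise => x y /= /eqP /edge_neq.
Qed.

(** At the first pair that differs a digit rises from 0 to 1, and [code_ub] outweighs all later
    digits. *)
Let code_increases l M p : fits l M -> all (gtn n) p -> size p = n -> forall L',
  all (fun ij => (ij.1 < n) && (ij.2 < n)) L' -> increases M p L' ->
  code L' (ed l) < code L' (fun i j => ed l (nth 0 p i) (nth 0 p j)).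
Proof.
move=> fl /allP pn sp; elim=> [|[i j] L' IH] //= /andP[/andP[ni nj] /IH {}IH].
have pin k : k < n -> nth 0 p k < n by move=> kn; apply: pn; apply: mem_nth; rewrite sp.
have su b i' j' : i' < n -> j' < n -> says M b i' j' -> ed l i' j' = b.
  by move=> h1 h2 /saysP; apply: fl.
have ub1 := code_ub L' (ed l).
have ub2 := code_ub L' (fun i j => ed l (nth 0 p i) (nth 0 p j)).
case: ifP => [/orP[]/andP[/eqP -> /eqP ->] /IH|_]; first lia.
  have -> : ed l j i = ed l i j by rewrite /ed edgeC.
  lia.
have h b := su b _ _ ni nj; have h' b := su b _ _ (pin _ ni) (pin _ nj).
case: ifP => [/h ->|_].
  case: ifP => [/h' -> /IH|_ /andP[-> /h' ->]]; lia.
case: ifP => [/h ->|//].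
case: ifP => [/h' -> /IH|_ /andP[/negPf -> /h' ->]]; lia.
Qed.

Let nth_relabel l p i : size p = n -> i < n ->
  nth x0 [seq nth x0 l k | k <- p] i = nth x0 l (nth 0 p i).
Proof. by move=> sp ni; rewrite (nth_map 0) ?sp. Qed.

Let relabel l p : labels l -> fits l M0 -> symmetry p ->
  labels [seq nth x0 l k | k <- p] /\ fits [seq nth x0 l k | k <- p] M0.
Proof.
move=> [sl ul lB lF] fl /and5P[/eqP sp up pn pm /allP pM].
have pin k : k < n -> nth 0 p k < n.
  by move=> kn; apply: (allP pn); apply: mem_nth; rewrite sp.
split; first split.
- by rewrite size_map.
- rewrite map_inj_in_uniq // => i j /(allP pn) /= ni /(allP pn) /= nj /eqP.
  by rewrite nth_uniq ?sl // => /eqP.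
- by move=> x /mapP[i /(allP pn) /= ni ->]; apply: lB; apply: mem_nth; rewrite sl.
- move=> x; rewrite -map_drop => /mapP[i /(nthP 0)[k]].
  rewrite size_drop sp => kn; rewrite nth_drop => <- ->.
  have mk : m + k < n by lia.
  have /allP/(_ (m + k)) := pm; rewrite mem_iota mk leq_addr => /(_ isT) /= mp.
  apply: lF; rewrite -(subnKC mp) -nth_drop; apply: mem_nth.
  by rewrite size_drop sl; have := pin _ mk; lia.
move=> i j b ni nj lo; rewrite /ed !nth_relabel //.
have := pM i; rewrite mem_iota => /(_ ni)/allP/(_ j); rewrite mem_iota => /(_ nj).
by rewrite lo => /saysP; apply: fl; apply: pin.
Qed.

Lemma check_sound l M t : labels l -> fits l M ->
  (forall p, symmetry p ->
    code L (ed [seq nth x0 l k | k <- p]) <= code L (ed l)) ->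
  check M t -> False.
Proof.
move=> ll fl mx; elim: t M fl => [i j t1 IH1 t0 IH0|s|s|s|c|p] M fl /=.
- case/andP=> c1 c0; case E: (ed l i j); [apply: (IH1 _ _ c1)|apply: (IH0 _ _ c0)];
    move=> i' j' b ni nj /look_put2[[-> -> ->]|[-> -> ->]|]; rewrite ?E //; try exact: fl;
    by rewrite /ed edgeC.
- case/and3P=> /eqP sz sn ps; have [cl cd] := clique_pairs ll fl sn ps.
  by apply: kB; exists [set x in [seq nth x0 l i | i <- s]]; rewrite ?in_B // cd sz.
- case/and4P=> /eqP sz us sn ps; have pp := pairs ll fl sn ps.
  have [sl ul _ _] := ll.
  have: #|[set x in [seq nth x0 l i | i <- s]]| <= al B.
    apply: al_ge; first exact: in_B.
    apply/stableP => x y; rewrite !inE => xs ys.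
    have [->|nxy] := eqVneq x y; first by rewrite edge_irr.
    by rewrite -eqbF_neg; apply: (sym_pairwise _ pp) => // a b; rewrite edgeC.
  rewrite cardsE; suff /card_uniqP -> : uniq [seq nth x0 l i | i <- s].
    by rewrite size_map sz; lia.
  rewrite map_inj_in_uniq // => i j /(allP sn) /= ni /(allP sn) /= nj /eqP.
  by rewrite nth_uniq ?sl // => /eqP.
- case/and4P=> /eqP sz sn sm ps; have [cl cd] := clique_pairs ll fl sn ps.
  apply: kF; exists [set x in [seq nth x0 l i | i <- s]]; rewrite ?cd ?sz //.
  case: ll => sl _ _ lF; apply/subsetP => x; rewrite inE => /mapP[i is_ ->].
  have /= mi := allP sm _ is_; have /= ni := allP sn _ is_.
  apply: lF; rewrite -(subnKC mi) -nth_drop; apply: mem_nth.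
  by rewrite size_drop sl; lia.
- case/and4P=> sz cv cn cp.
  have [sl ul lB _] := ll.
  have lE : {subset B <= l}.
    move=> x xB; have /subset_cardP : #|[set y in l]| = #|B|.
      by rewrite cardsE cB -sl; apply/card_uniqP.
    move=> /(_ _)/(_ x); rewrite inE => -> //; apply/subsetP => y; rewrite inE; exact: lB.
  suff: th B <= size c by lia.
  have: B \subset \bigcup_(s <- c) [set x in [seq nth x0 l i | i <- s]].
    apply/subsetP => x /lE xl; have := cv => /allP/(_ (index x l)).
    rewrite mem_iota -sl index_mem xl => /(_ isT)/hasP[s sc xs].
    have {xs}xs : x \in [set y in [seq nth x0 l i | i <- s]].
      by rewrite inE -{1}(nth_index x0 xl); apply: map_f.
    elim: c sc {sz cv cn cp} => [|a c IH] //; rewrite big_cons !inE => /predU1P[<-|/IH ->].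
      by move: xs; rewrite inE => ->.
    by rewrite orbT.
  move/th_sub => h; apply: leq_trans h _.
  elim: c cn cp {sz cv} => [|s c IH] /=; first by rewrite big_nil th0.
  case/andP=> sn cn /andP[ps cp]; rewrite big_cons.
  have [cl _] := clique_pairs ll fl sn ps.
  by apply: leq_trans (th_clique_cover cl (subxx _)) _; rewrite ltnS; apply: IH.
- case/andP=> sp inc; have := mx _ sp; rewrite leqNgt => /negP; apply.
  have /and5P[/eqP szp _ pn _ _] := sp.
  have := code_increases fl pn szp Ln inc.
  suff -> : code L (ed [seq nth x0 l k | k <- p]) =
    code L (fun i j => ed l (nth 0 p i) (nth 0 p j)) by [].
  elim: (L) Ln => [|[i j] L' IH] //= /andP[/andP[ni nj] /IH ->].
  by rewrite /ed !nth_relabel.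
Qed.

(** Among all labellings that fit [M0] take one of maximal code; a symmetry leaf would produce a
    better one. *)
Theorem search l t : labels l -> fits l M0 -> check M0 t -> False.
Proof.
move=> ll fl ct.
pose Q k := `[< exists l, [/\ labels l, fits l M0 & code L (ed l) = k] >].
have exQ : exists k, Q k by exists (code L (ed l)); apply/asboolP; exists l.
have ubQ k : Q k -> k <= 2 ^ size L.
  by move=> /asboolP[l' [_ _ <-]]; apply: ltnW; apply: code_ub.
case: (ex_maxnP exQ ubQ) => k /asboolP[l' [ll' fl' <-]] mx.
apply: (check_sound ll' fl' _ ct) => p sp; apply: mx; apply/asboolP.
by have [h1 h2] := relabel ll' fl' sp; exists [seq nth x0 l' k | k <- p].
Qed.

End Search.

(* The refutation trees were found by computer. [two_triangles_tree] starts from the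
   triangles 012 and 345 and the stable set 678. The [hub] trees start from a triangle
   012 such that the labels from 2 on are triangle-free, where 2 has neighbours
   3, 4, 5 resp. 3, 4 among these labels. *)
Definition two_triangles_order : seq (nat * nat) :=
  [:: (0, 6); (0, 7); (0, 8); (1, 6); (1, 7); (1, 8); (2, 6); (2, 7); (2, 8); (3, 6); (3, 7);
   (3, 8); (4, 6); (4, 7); (4, 8); (5, 6); (5, 7); (5, 8); (6, 9); (7, 9); (8, 9); (0,
   9); (1, 9); (2, 9); (3, 9); (4, 9); (5, 9); (0, 3); (0, 4); (0, 5); (1, 3); (1, 4);
   (1, 5); (2, 3); (2, 4); (2, 5)].

Definition two_triangles_tree : tree :=
  Br 0 6 (Br 1 6 (Br 2 6 (Kl [::0;1;2;6]) (Sy [::0;2;1;3;4;5;6;7;8;9])) (Sy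
  [::1;0;2;3;4;5;6;7;8;9])) (Br 0 7 (Br 1 7 (Br 2 7 (Kl [::0;1;2;7]) (Br 2 6 (Br 8 9 (Cv
  [::[::0;1;7];[::2;6];[::3;4;5];[::8;9]]) (Br 0 8 (Br 2 8 (Br 6 9 (Cv
  [::[::0;2;8];[::1;7];[::3;4;5];[::6;9]]) (Br 7 9 (Br 1 8 (Cv
  [::[::0;1;8];[::2;6];[::3;4;5];[::7;9]]) (Br 1 6 (Cv [::[::0;8];[::1;2;6];[::3;4;5];[::7;9]])
  (Br 1 9 (Cv [::[::0;8];[::1;7;9];[::2;6];[::3;4;5]]) (St [::1;6;8;9])))) (St [::6;7;8;9]))) (Sy
  [::2;0;1;3;4;5;7;8;6;9])) (Sy [::0;1;2;3;4;5;6;8;7;9]))) (Sy [::2;0;1;3;4;5;6;7;8;9]))) (Br 1 6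
  (Br 0 8 (Br 2 6 (Br 7 9 (Cv [::[::0;8];[::1;2;6];[::3;4;5];[::7;9]]) (Br 8 9 (Cv
  [::[::0;7];[::1;2;6];[::3;4;5];[::8;9]]) (Br 6 9 (Br 1 8 (Br 2 7 (Cv
  [::[::0;1;8];[::2;7];[::3;4;5];[::6;9]]) (Br 2 9 (Cv [::[::0;1;8];[::2;6;9];[::3;4;5];[::7]])
  (Br 2 8 (Cv [::[::0;7];[::1;2;8];[::3;4;5];[::6;9]]) (St [::2;7;8;9])))) (Br 1 9 (Br 2 7 (Cv
  [::[::0;2;7];[::1;6;9];[::3;4;5];[::8]]) (Br 2 9 (Kl [::1;2;6;9]) (Br 2 8 (Cv
  [::[::0;7];[::1;6;9];[::2;8];[::3;4;5]]) (St [::2;7;8;9])))) (St [::1;7;8;9]))) (St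
  [::6;7;8;9])))) (Sy [::0;2;1;3;4;5;6;7;8;9])) (Sy [::0;1;2;3;4;5;6;8;7;9])) (Sy
  [::1;0;2;3;4;5;6;7;8;9]))) (Br 0 8 (Br 1 6 (Br 2 6 (Br 7 9 (Cv
  [::[::0;8];[::1;2;6];[::3;4;5];[::7;9]]) (Br 1 7 (Br 2 7 (Br 6 9 (Cv
  [::[::0;8];[::1;2;7];[::3;4;5];[::6;9]]) (Br 8 9 (Br 0 9 (Cv
  [::[::0;8;9];[::1;2;7];[::3;4;5];[::6]]) (St [::0;6;7;9])) (St [::6;7;8;9]))) (Sy
  [::0;2;1;3;4;5;6;7;8;9])) (Sy [::0;1;2;3;4;5;7;6;8;9]))) (Sy [::0;2;1;3;4;5;6;7;8;9])) (Br 1 8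
  (Br 2 8 (Kl [::0;1;2;8]) (Br 2 6 (Br 7 9 (Cv [::[::0;1;8];[::2;6];[::3;4;5];[::7;9]]) (Br 1 7
  (Br 2 7 (Br 6 9 (Cv [::[::0;1;8];[::2;7];[::3;4;5];[::6;9]]) (Br 8 9 (Br 0 9 (Cv
  [::[::0;8;9];[::1;2;7];[::3;4;5];[::6]]) (St [::0;6;7;9])) (St [::6;7;8;9]))) (Sy
  [::0;2;1;3;4;5;7;6;8;9])) (Br 6 9 (Br 2 7 (Cv [::[::0;1;8];[::2;7];[::3;4;5];[::6;9]]) (Sy
  [::0;1;2;3;4;5;7;6;8;9])) (Br 8 9 (Br 1 9 (Br 0 9 (Kl [::0;1;8;9]) (St [::0;6;7;9])) (St
  [::1;6;7;9])) (St [::6;7;8;9]))))) (Br 2 7 (Br 6 9 (Cv [::[::0;1;8];[::2;7];[::3;4;5];[::6;9]])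
  (Br 3 6 (Br 4 6 (Br 5 6 (Kl [::3;4;5;6]) (Sy [::0;1;2;3;5;4;6;7;8;9])) (Sy
  [::0;1;2;4;3;5;6;7;8;9])) (Br 3 7 (Br 4 6 (Br 5 6 (Br 2 9 (Cv
  [::[::0;1;8];[::2;9];[::3;7];[::4;5;6]]) (Br 8 9 (Cv [::[::0;1;2];[::3;7];[::4;5;6];[::8;9]])
  (St [::2;6;8;9]))) (Sy [::0;1;2;3;5;4;6;7;8;9])) (Br 4 7 (Br 5 7 (Kl [::3;4;5;7]) (Br 5 6 (Br 8
  9 (Cv [::[::0;1;2];[::3;4;7];[::5;6];[::8;9]]) (Br 2 9 (Cv
  [::[::0;1;8];[::2;9];[::3;4;7];[::5;6]]) (St [::2;6;8;9]))) (Sy [::0;1;2;3;5;4;6;7;8;9]))) (Sy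
  [::0;1;2;4;3;5;6;7;8;9]))) (Br 0 3 (Br 3 8 (Br 1 3 (Kl [::0;1;3;8]) (Br 1 7 (Sy
  [::0;2;1;3;4;5;6;7;8;9]) (St [::1;3;6;7]))) (St [::3;6;7;8])) (St [::0;3;6;7]))))) (St
  [::2;6;7;8])))) (Br 1 7 (Br 3 6 (Br 4 6 (Br 5 6 (Kl [::3;4;5;6]) (Sy [::0;1;2;3;5;4;6;7;8;9]))
  (Sy [::0;1;2;4;3;5;6;7;8;9])) (Br 3 7 (Br 2 8 (Br 6 9 (Cv
  [::[::0;2;8];[::1;7];[::3;4;5];[::6;9]]) (Br 4 6 (Br 5 6 (Br 8 9 (Cv
  [::[::0;1;2];[::3;7];[::4;5;6];[::8;9]]) (Br 1 9 (Cv [::[::0;2;8];[::1;9];[::3;7];[::4;5;6]])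
  (St [::1;6;8;9]))) (Sy [::0;1;2;3;5;4;6;7;8;9])) (Br 4 7 (Br 5 7 (Kl [::3;4;5;7]) (Br 5 6 (Br 8
  9 (Cv [::[::0;1;2];[::3;4;7];[::5;6];[::8;9]]) (Br 1 9 (Cv
  [::[::0;2;8];[::1;9];[::3;4;7];[::5;6]]) (St [::1;6;8;9]))) (Sy [::0;1;2;3;5;4;6;7;8;9]))) (Sy
  [::0;1;2;4;3;5;6;7;8;9])))) (Br 2 6 (Br 3 8 (Br 4 6 (Br 5 6 (Br 8 9 (Cv
  [::[::0;1;2];[::3;7];[::4;5;6];[::8;9]]) (Br 7 9 (Cv [::[::0;1;2];[::3;8];[::4;5;6];[::7;9]])
  (Br 6 9 (Br 2 9 (Cv [::[::0;8];[::1;7];[::2;6;9];[::3;4;5]]) (Br 2 7 (Cv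
  [::[::0;8];[::1;2;7];[::3;4;5];[::6;9]]) (St [::2;7;8;9]))) (St [::6;7;8;9])))) (Sy
  [::0;1;2;3;5;4;6;7;8;9])) (Br 4 7 (Br 5 7 (Kl [::3;4;5;7]) (Br 5 6 (Br 8 9 (Cv
  [::[::0;1;2];[::3;4;7];[::5;6];[::8;9]]) (Br 6 9 (Br 5 8 (Cv
  [::[::0;1;2];[::3;5;8];[::4;7];[::6;9]]) (Br 2 9 (Cv [::[::0;8];[::1;7];[::2;6;9];[::3;4;5]])
  (Br 5 9 (Cv [::[::0;1;2];[::3;4;7];[::5;6;9];[::8]]) (Br 2 5 (Br 1 5 (Cv
  [::[::0;8];[::1;2;5];[::3;4;7];[::6;9]]) (Br 1 9 (Cv [::[::0;8];[::1;9];[::2;5;6];[::3;4;7]])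
  (St [::1;5;8;9]))) (St [::2;5;8;9]))))) (Br 1 9 (Br 7 9 (Cv
  [::[::0;8];[::1;7;9];[::2;6];[::3;4;5]]) (St [::6;7;8;9])) (St [::1;6;8;9])))) (Br 5 8 (Br 0 5
  (Br 6 9 (Cv [::[::0;1;2];[::3;5;8];[::4;7];[::6;9]]) (Br 4 8 (Kl [::3;4;5;8]) (Br 1 4 (Br 3 9
  (Cv [::[::0;5;8];[::1;4;7];[::2;6];[::3;9]]) (Br 1 3 (Kl [::1;3;4;7]) (Br 1 9 (Cv
  [::[::0;5;8];[::1;9];[::2;6];[::3;4;7]]) (St [::1;3;6;9])))) (St [::1;4;6;8])))) (St
  [::0;5;6;7])) (St [::5;6;7;8])))) (Sy [::0;1;2;4;3;5;6;7;8;9]))) (Br 1 3 (Br 4 6 (Br 5 6 (Br 2 9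
  (Cv [::[::0;8];[::1;3;7];[::2;9];[::4;5;6]]) (Br 8 9 (Cv
  [::[::0;1;2];[::3;7];[::4;5;6];[::8;9]]) (Br 2 7 (Br 2 3 (Kl [::1;2;3;7]) (Br 3 9 (Cv
  [::[::0;8];[::1;2;7];[::3;9];[::4;5;6]]) (St [::2;3;8;9]))) (Br 7 9 (Br 2 3 (Cv
  [::[::0;8];[::1;2;3];[::4;5;6];[::7;9]]) (Br 3 9 (Cv [::[::0;8];[::1;2];[::3;7;9];[::4;5;6]])
  (St [::2;3;8;9]))) (St [::2;7;8;9]))))) (Sy [::0;1;2;3;5;4;6;7;8;9])) (Br 4 7 (Br 1 4 (Kl
  [::1;3;4;7]) (Br 4 8 (Br 5 7 (Kl [::3;4;5;7]) (Br 5 6 (Br 8 9 (Cv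
  [::[::0;1;2];[::3;4;7];[::5;6];[::8;9]]) (Br 6 9 (Br 5 8 (Cv
  [::[::0;2];[::1;3;7];[::4;5;8];[::6;9]]) (Br 2 9 (Cv [::[::0;8];[::1;7];[::2;6;9];[::3;4;5]])
  (Br 5 9 (Cv [::[::0;1;2];[::3;4;7];[::5;6;9];[::8]]) (Br 7 9 (Br 2 5 (Br 3 9 (Cv
  [::[::0;1];[::2;5;6];[::3;7;9];[::4;8]]) (Br 2 3 (Br 1 5 (Kl [::1;2;3;5]) (Br 1 9 (Cv
  [::[::0;8];[::1;9];[::2;5;6];[::3;4;7]]) (St [::1;5;8;9]))) (St [::2;3;8;9]))) (St [::2;5;8;9]))
  (St [::5;7;8;9]))))) (Br 3 9 (Br 7 9 (Cv [::[::0;1;2];[::3;7;9];[::4;8];[::5;6]]) (St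
  [::6;7;8;9])) (St [::3;6;8;9])))) (Br 5 8 (Br 0 5 (Br 6 9 (Cv
  [::[::0;2];[::1;3;7];[::4;5;8];[::6;9]]) (Br 1 9 (Cv [::[::0;5;8];[::1;9];[::2;6];[::3;4;7]])
  (Br 4 9 (Cv [::[::0;5;8];[::1;3;7];[::2;6];[::4;9]]) (St [::1;4;6;9])))) (St [::0;5;6;7])) (St
  [::5;6;7;8])))) (St [::1;4;6;8]))) (Sy [::0;1;2;4;3;5;6;7;8;9]))) (St [::1;3;6;8]))) (Br 2 7 (Sy
  [::1;0;2;3;4;5;6;8;7;9]) (St [::2;6;7;8])))) (Br 0 3 (Br 3 8 (Br 2 7 (Br 6 9 (Cv
  [::[::0;3;8];[::1;2;7];[::4;5];[::6;9]]) (Br 4 6 (Br 5 6 (Cv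
  [::[::0;3;8];[::1;2;7];[::4;5;6];[::9]]) (Sy [::0;1;2;3;5;4;6;7;8;9])) (Br 4 8 (Br 5 8 (Kl
  [::3;4;5;8]) (Br 0 4 (Kl [::0;3;4;8]) (Br 4 7 (Br 5 6 (Br 7 9 (Cv
  [::[::0;1;2];[::3;4;8];[::5;6];[::7;9]]) (Br 3 9 (Br 8 9 (Cv
  [::[::0;1;2];[::3;8;9];[::4;7];[::5;6]]) (St [::6;7;8;9])) (St [::3;6;7;9]))) (Br 5 7 (Sy
  [::0;1;2;3;5;4;6;7;8;9]) (St [::5;6;7;8]))) (St [::0;4;6;7])))) (Br 4 7 (Br 1 4 (Br 2 4 (Kl
  [::1;2;4;7]) (Br 2 6 (Br 5 6 (Br 4 9 (Cv [::[::0;3;8];[::1;2;7];[::4;9];[::5;6]]) (Br 8 9 (Br 0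
  9 (Cv [::[::0;8;9];[::1;2;7];[::3;4;5];[::6]]) (Br 0 4 (Cv
  [::[::0;3;4];[::1;2;7];[::5;6];[::8;9]]) (St [::0;4;6;9]))) (St [::4;6;8;9]))) (Sy
  [::3;4;5;0;1;2;6;7;8;9])) (Br 2 8 (Br 5 6 (Br 2 9 (Cv [::[::0;3;8];[::1;4;7];[::2;9];[::5;6]])
  (Br 4 9 (Cv [::[::0;3;8];[::1;2;7];[::4;9];[::5;6]]) (St [::2;4;6;9]))) (Br 5 7 (Br 1 5 (Kl
  [::1;4;5;7]) (Br 5 8 (Br 7 9 (Br 1 9 (Cv [::[::0;2;8];[::1;7;9];[::3;4;5];[::6]]) (Br 5 9 (Br 8
  9 (Br 4 9 (Cv [::[::0;3;8];[::1;2;7];[::4;5;9];[::6]]) (Br 2 9 (Br 0 4 (Cv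
  [::[::0;1;4];[::2;7;9];[::3;5;8];[::6]]) (Br 0 9 (Cv [::[::0;8;9];[::1;2;7];[::3;4;5];[::6]])
  (St [::0;4;6;9]))) (St [::2;4;6;9]))) (St [::1;6;8;9])) (St [::1;5;6;9]))) (Br 3 9 (Br 8 9 (Cv
  [::[::0;1;2];[::3;8;9];[::4;5;7];[::6]]) (St [::6;7;8;9])) (St [::3;6;7;9]))) (St [::1;5;6;8])))
  (Br 5 8 (Br 0 5 (Kl [::0;3;5;8]) (St [::0;5;6;7])) (St [::5;6;7;8])))) (St [::2;4;6;8])))) (St
  [::1;4;6;8])) (St [::4;6;7;8]))))) (Br 2 6 (Br 4 6 (Br 5 6 (Br 7 9 (Cv
  [::[::0;3;8];[::1;2];[::4;5;6];[::7;9]]) (Br 2 9 (Cv [::[::0;3;8];[::1;7];[::2;9];[::4;5;6]])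
  (Br 2 8 (Br 6 9 (Cv [::[::0;2;8];[::1;7];[::3;4;5];[::6;9]]) (Br 3 9 (Cv
  [::[::0;2;8];[::1;7];[::3;9];[::4;5;6]]) (St [::3;6;7;9]))) (Br 8 9 (Br 3 9 (Cv
  [::[::0;2];[::1;7];[::3;8;9];[::4;5;6]]) (Br 2 3 (Cv [::[::0;2;3];[::1;7];[::4;5;6];[::8;9]])
  (St [::2;3;7;9]))) (St [::2;7;8;9]))))) (Sy [::0;1;2;3;5;4;6;7;8;9])) (Br 4 7 (Br 6 9 (Br 5 8
  (Cv [::[::0;1;2];[::3;5;8];[::4;7];[::6;9]]) (Br 5 7 (Cv
  [::[::0;3;8];[::1;2];[::4;5;7];[::6;9]]) (Br 5 6 (Br 2 8 (Cv
  [::[::0;2;8];[::1;7];[::3;4;5];[::6;9]]) (Br 2 5 (Br 5 9 (Cv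
  [::[::0;3;8];[::1;2];[::4;7];[::5;6;9]]) (Br 1 4 (Cv [::[::0;3;8];[::1;4;7];[::2;5];[::6;9]])
  (Br 4 8 (Br 7 9 (Cv [::[::0;1;2];[::3;4;8];[::5;6];[::7;9]]) (Br 8 9 (Br 0 9 (Cv
  [::[::0;8;9];[::1;7];[::2;6];[::3;4;5]]) (Br 0 5 (Cv [::[::0;2;5];[::1;7];[::3;4;8];[::6;9]])
  (St [::0;5;7;9]))) (St [::5;7;8;9]))) (St [::1;4;6;8])))) (St [::2;5;7;8]))) (St [::5;6;7;8]))))
  (Br 7 9 (Br 1 9 (Cv [::[::0;3;8];[::1;7;9];[::2;6];[::4;5]]) (Br 8 9 (Br 0 9 (Cv
  [::[::0;8;9];[::1;7];[::2;6];[::3;4;5]]) (Br 5 6 (Br 4 8 (Cv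
  [::[::0;1;2];[::3;4;8];[::5;6];[::7;9]]) (Br 1 4 (Br 4 9 (Cv
  [::[::0;1;2];[::3;8];[::4;7;9];[::5;6]]) (Br 0 4 (Br 3 9 (Cv
  [::[::0;1;2];[::3;8;9];[::4;7];[::5;6]]) (Br 1 3 (Kl [::0;1;3;4]) (St [::1;3;6;9]))) (St
  [::0;4;6;9]))) (St [::1;4;6;8]))) (Br 5 7 (Br 3 9 (Cv [::[::0;1;2];[::3;8;9];[::4;5;7];[::6]])
  (Br 1 3 (Cv [::[::0;1;3];[::2;6];[::4;5;7];[::8;9]]) (St [::1;3;6;9]))) (Br 5 8 (Br 0 5 (Kl
  [::0;3;5;8]) (St [::0;5;6;7])) (St [::5;6;7;8]))))) (St [::1;6;8;9]))) (Br 8 9 (Br 0 9 (Cv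
  [::[::0;8;9];[::1;7];[::2;6];[::3;4;5]]) (St [::0;6;7;9])) (St [::6;7;8;9])))) (Br 0 4 (Br 4 8
  (Kl [::0;3;4;8]) (St [::4;6;7;8])) (St [::0;4;6;7])))) (Br 2 8 (Br 2 3 (Kl [::0;2;3;8]) (St
  [::2;3;6;7])) (St [::2;6;7;8])))) (St [::3;6;7;8])) (St [::0;3;6;7])))) (St [::1;6;7;8])))) (St
  [::0;6;7;8]))).

Definition hub3_order : seq (nat * nat) :=
  [:: (3, 6); (3, 7); (3, 8); (3, 9); (4, 6); (4, 7); (4, 8); (4, 9); (5, 6); (5, 7); (5, 8);
   (5, 9); (6, 7); (6, 8); (6, 9); (7, 8); (7, 9); (8, 9); (0, 3); (0, 4); (0, 5); (1,
   3); (1, 4); (1, 5); (0, 6); (0, 7); (0, 8); (0, 9); (1, 6); (1, 7); (1, 8); (1, 9)].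

Definition hub3_tree : tree :=
  Br 3 6 (Br 3 7 (Br 6 7 (Tr [::3;6;7]) (Br 3 8 (Br 6 8 (Tr [::3;6;8]) (Br 7 8 (Tr [::3;7;8]) (St
  [::2;6;7;8]))) (Br 3 9 (Br 6 9 (Tr [::3;6;9]) (Br 7 9 (Tr [::3;7;9]) (St [::2;6;7;9]))) (Br 4 8
  (Br 4 9 (Br 8 9 (Tr [::4;8;9]) (Br 4 6 (Br 6 9 (Tr [::4;6;9]) (Br 6 8 (Tr [::4;6;8]) (St
  [::2;6;8;9]))) (Br 4 7 (Br 7 9 (Tr [::4;7;9]) (Br 7 8 (Tr [::4;7;8]) (St [::2;7;8;9]))) (Br 5 6
  (Sy [::0;1;2;3;5;4;6;7;8;9]) (Br 5 7 (Sy [::0;1;2;3;5;4;6;7;8;9]) (St [::4;5;6;7])))))) (Br 5 9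
  (Br 4 6 (Br 6 8 (Tr [::4;6;8]) (Br 7 8 (Br 4 7 (Cv [::[::0;1;2];[::3;6];[::4;7;8];[::5;9]]) (Br
  6 9 (Br 5 6 (Tr [::5;6;9]) (Br 5 7 (Br 7 9 (Cv [::[::0;1;2];[::3;6];[::4;8];[::5;7;9]]) (Br 5 8
  (Tr [::5;7;8]) (Br 0 3 (Br 1 3 (Kl [::0;1;2;3]) (Br 1 4 (Br 0 4 (Kl [::0;1;2;4]) (Br 1 8 (Cv
  [::[::0;2;3];[::1;4;8];[::5;7];[::6;9]]) (Br 1 5 (Br 0 5 (Kl [::0;1;2;5]) (Br 1 9 (Cv
  [::[::0;2;3];[::1;5;9];[::4;6];[::7;8]]) (Br 8 9 (Br 0 6 (Cv
  [::[::0;3;6];[::1;2;4];[::5;7];[::8;9]]) (Br 0 8 (Br 0 9 (Cv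
  [::[::0;8;9];[::1;2;4];[::3;6];[::5;7]]) (Br 0 7 (Cv [::[::0;3;7];[::1;2;5];[::4;8];[::6;9]])
  (St [::0;4;7;9]))) (St [::0;5;6;8]))) (St [::1;3;8;9])))) (St [::1;3;5;8])))) (Br 1 5 (Br 1 9
  (Cv [::[::0;2;3];[::1;5;9];[::4;6];[::7;8]]) (St [::1;3;4;9])) (St [::1;3;4;5])))) (Br 0 4 (Br 1
  4 (Kl [::0;1;2;4]) (Br 1 3 (Br 0 8 (Cv [::[::0;4;8];[::1;2;3];[::5;7];[::6;9]]) (Br 0 5 (Br 1 7
  (Cv [::[::0;2;5];[::1;3;7];[::4;8];[::6;9]]) (Br 1 9 (Br 1 5 (Cv
  [::[::0;2;4];[::1;5;9];[::3;6];[::7;8]]) (Br 1 6 (Cv [::[::0;2;5];[::1;6;9];[::3;7];[::4;8]])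
  (Br 1 8 (Br 8 9 (Cv [::[::0;2;4];[::1;8;9];[::3;6];[::5;7]]) (Br 0 9 (Cv
  [::[::0;5;9];[::1;2;3];[::4;6];[::7;8]]) (St [::0;3;8;9]))) (St [::1;5;6;8])))) (St
  [::1;4;7;9]))) (St [::0;3;5;8]))) (Br 1 5 (Br 1 9 (Cv [::[::0;2;4];[::1;5;9];[::3;6];[::7;8]])
  (St [::1;3;4;9])) (St [::1;3;4;5])))) (Br 0 9 (Br 0 5 (Br 1 4 (Cv
  [::[::0;5;9];[::1;2;4];[::3;6];[::7;8]]) (Br 1 5 (Kl [::0;1;2;5]) (Br 1 3 (Cv
  [::[::0;5;9];[::1;2;3];[::4;6];[::7;8]]) (St [::1;3;4;5])))) (St [::0;3;4;5])) (St
  [::0;3;4;9])))))) (Br 5 8 (Sy [::0;1;2;4;3;5;6;8;7;9]) (Br 0 3 (Br 1 3 (Kl [::0;1;2;3]) (Br 1 4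
  (Br 0 6 (Cv [::[::0;3;6];[::1;2;4];[::5;9];[::7;8]]) (Br 1 6 (Cv
  [::[::0;2;3];[::1;4;6];[::5;9];[::7;8]]) (Br 0 5 (Br 1 8 (Cv
  [::[::0;2;5];[::1;4;8];[::3;7];[::6;9]]) (Br 1 5 (Kl [::0;1;2;5]) (St [::1;5;6;8]))) (Br 0 7 (Br
  0 8 (Cv [::[::0;7;8];[::1;2;4];[::3;6];[::5;9]]) (St [::0;5;6;8])) (St [::0;5;6;7]))))) (Br 1 5
  (Br 1 9 (Cv [::[::0;2;3];[::1;5;9];[::4;6];[::7;8]]) (St [::1;3;4;9])) (St [::1;3;4;5])))) (Br 0
  4 (Br 1 4 (Kl [::0;1;2;4]) (Br 1 3 (Sy [::1;0;2;3;4;5;6;7;8;9]) (Br 1 5 (Br 1 9 (Cv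
  [::[::0;2;4];[::1;5;9];[::3;6];[::7;8]]) (St [::1;3;4;9])) (St [::1;3;4;5])))) (Br 0 9 (Br 0 5
  (Br 1 4 (Cv [::[::0;5;9];[::1;2;4];[::3;6];[::7;8]]) (Br 1 5 (Kl [::0;1;2;5]) (Br 1 7 (Br 1 3
  (Cv [::[::0;2;5];[::1;3;7];[::4;8];[::6;9]]) (St [::1;3;4;5])) (St [::1;4;5;7])))) (St
  [::0;3;4;5])) (St [::0;3;4;9]))))))) (Br 8 9 (Br 7 9 (Tr [::7;8;9]) (St [::2;6;7;9])) (St
  [::2;6;8;9])))) (St [::2;6;7;8]))) (Br 4 7 (Sy [::0;1;2;3;4;5;7;6;8;9]) (Br 5 6 (Sy
  [::0;1;2;3;5;4;6;7;8;9]) (Br 5 7 (Sy [::0;1;2;3;5;4;6;7;8;9]) (St [::4;5;6;7]))))) (St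
  [::3;4;5;9]))) (Br 5 8 (Br 4 9 (Sy [::0;1;2;3;4;5;6;7;9;8]) (Br 5 9 (Br 8 9 (Tr [::5;8;9]) (St
  [::3;4;8;9])) (St [::3;4;5;9]))) (St [::3;4;5;8])))))) (Br 3 8 (Sy [::0;1;2;3;4;5;6;8;7;9]) (Br
  4 7 (Br 3 9 (Sy [::0;1;2;3;4;5;6;7;9;8]) (Br 4 8 (Sy [::0;1;2;4;3;5;7;8;6;9]) (Br 5 8 (Br 4 9
  (Sy [::0;1;2;3;4;5;6;7;9;8]) (Br 5 9 (Br 8 9 (Cv [::[::0;1;2];[::3;6];[::4;7];[::5;8;9]]) (St
  [::3;4;8;9])) (St [::3;4;5;9]))) (St [::3;4;5;8])))) (Br 5 7 (Br 4 8 (Sy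
  [::0;1;2;3;4;5;6;8;7;9]) (Br 5 8 (Br 7 8 (Tr [::5;7;8]) (St [::3;4;7;8])) (St [::3;4;5;8]))) (St
  [::3;4;5;7]))))) (Br 4 6 (Sy [::0;1;2;4;3;5;6;7;8;9]) (Br 5 6 (Sy [::0;1;2;3;5;4;6;7;8;9]) (St
  [::3;4;5;6]))).

Definition hub2_order : seq (nat * nat) :=
  [:: (5, 6); (5, 7); (5, 8); (5, 9); (6, 7); (6, 8); (6, 9); (7, 8); (7, 9); (8, 9); (3, 5);
   (4, 5); (3, 6); (4, 6); (3, 7); (4, 7); (3, 8); (4, 8); (3, 9); (4, 9); (0, 3); (0,
   4); (1, 3); (1, 4); (0, 5); (0, 6); (0, 7); (0, 8); (0, 9); (1, 5); (1, 6); (1, 7);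
   (1, 8); (1, 9)].

Definition hub2_tree : tree :=
  Br 5 6 (Br 5 7 (Br 6 7 (Tr [::5;6;7]) (Sy [::0;1;2;3;4;6;5;7;8;9])) (Sy
  [::0;1;2;3;4;5;7;6;8;9])) (Br 5 7 (Br 5 8 (Br 7 8 (Tr [::5;7;8]) (Br 5 9 (Br 7 9 (Tr [::5;7;9])
  (Br 8 9 (Tr [::5;8;9]) (St [::2;7;8;9]))) (Sy [::0;1;2;3;4;5;6;7;9;8]))) (Sy
  [::0;1;2;3;4;5;6;8;7;9])) (Br 6 7 (Br 5 8 (Br 5 9 (Br 8 9 (Tr [::5;8;9]) (Br 6 8 (Br 7 8 (Tr
  [::6;7;8]) (Br 7 9 (Br 6 9 (Tr [::6;7;9]) (Sy [::0;1;2;3;4;5;6;7;9;8])) (St [::2;7;8;9]))) (Br 6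
  9 (Br 7 9 (Tr [::6;7;9]) (Br 7 8 (Br 3 5 (Br 3 8 (Tr [::3;5;8]) (Sy [::0;1;2;3;4;8;6;9;5;7]))
  (Br 4 5 (Br 4 8 (Tr [::4;5;8]) (Br 3 8 (Br 3 7 (Tr [::3;7;8]) (Br 4 7 (Br 4 6 (Tr [::4;6;7]) (Br
  3 6 (Sy [::0;1;2;3;4;5;7;6;9;8]) (Sy [::0;1;2;3;4;6;5;8;7;9]))) (Sy [::0;1;2;3;4;7;9;5;8;6])))
  (Sy [::0;1;2;3;4;8;6;9;5;7]))) (Br 3 6 (Br 3 7 (Tr [::3;6;7]) (Br 4 7 (Br 4 6 (Tr [::4;6;7]) (Sy
  [::0;1;2;4;3;5;6;7;8;9])) (St [::3;4;5;7]))) (Br 4 6 (Br 4 9 (Tr [::4;6;9]) (Br 4 7 (Tr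
  [::4;6;7]) (Br 3 7 (Br 3 8 (Tr [::3;7;8]) (Br 0 3 (Br 1 3 (Kl [::0;1;2;3]) (Sy
  [::1;0;2;3;4;5;6;7;8;9])) (Br 0 4 (Br 1 4 (Kl [::0;1;2;4]) (Br 1 3 (Br 0 6 (Cv
  [::[::0;4;6];[::1;2;3];[::5;9];[::7;8]]) (Br 0 8 (Br 0 5 (Br 4 8 (Cv
  [::[::0;4;8];[::1;2;3];[::5;9];[::6;7]]) (Br 3 9 (Br 1 9 (Cv
  [::[::0;5;8];[::1;3;9];[::2;4];[::6;7]]) (Br 1 7 (Cv [::[::0;5;8];[::1;3;7];[::2;4];[::6;9]])
  (St [::1;4;7;9]))) (St [::3;4;8;9]))) (St [::0;3;5;6])) (St [::0;3;6;8]))) (Br 1 5 (Br 1 8 (Cv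
  [::[::0;2;4];[::1;5;8];[::3;7];[::6;9]]) (Br 1 6 (Br 1 9 (Cv
  [::[::0;2;4];[::1;6;9];[::3;7];[::5;8]]) (Br 1 7 (Br 3 9 (Cv
  [::[::0;2;4];[::1;6;7];[::3;9];[::5;8]]) (St [::1;3;8;9])) (St [::1;4;7;9]))) (St [::1;3;6;8])))
  (St [::1;3;4;5])))) (Br 0 5 (Br 0 8 (Br 1 4 (Cv [::[::0;5;8];[::1;2;4];[::3;7];[::6;9]]) (Br 1 3
  (Br 0 7 (Cv [::[::0;7;8];[::1;2;3];[::4;6];[::5;9]]) (Br 0 9 (Cv
  [::[::0;5;9];[::1;2;3];[::4;6];[::7;8]]) (St [::0;4;7;9]))) (Br 1 5 (Br 1 8 (Kl [::0;1;5;8]) (Br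
  1 6 (Br 1 9 (Cv [::[::0;5;8];[::1;6;9];[::2;4];[::3;7]]) (Br 1 7 (Br 3 9 (Cv
  [::[::0;5;8];[::1;6;7];[::2;4];[::3;9]]) (St [::1;3;8;9])) (St [::1;4;7;9]))) (St [::1;3;6;8])))
  (St [::1;3;4;5])))) (Br 0 6 (Br 4 8 (Br 0 9 (Br 1 3 (Cv [::[::0;5;9];[::1;2;3];[::4;8];[::6;7]])
  (Br 1 4 (Cv [::[::0;6;9];[::1;2;4];[::3;7];[::5;8]]) (Br 1 5 (Br 1 9 (Kl [::0;1;5;9]) (Br 1 7
  (Br 1 8 (Cv [::[::0;5;9];[::1;7;8];[::2;3];[::4;6]]) (Br 1 6 (Cv
  [::[::0;5;9];[::1;6;7];[::2;3];[::4;8]]) (St [::1;3;6;8]))) (St [::1;4;7;9]))) (St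
  [::1;3;4;5])))) (Br 0 7 (Br 3 9 (Br 1 4 (Cv [::[::0;6;7];[::1;2;4];[::3;9];[::5;8]]) (Br 1 3 (Cv
  [::[::0;6;7];[::1;2;3];[::4;8];[::5;9]]) (Br 1 5 (Br 1 9 (Cv
  [::[::0;6;7];[::1;5;9];[::2;3];[::4;8]]) (Br 1 7 (Br 1 8 (Cv
  [::[::0;6;7];[::1;5;8];[::2;4];[::3;9]]) (Br 1 6 (Kl [::0;1;6;7]) (St [::1;3;6;8]))) (St
  [::1;4;7;9]))) (St [::1;3;4;5])))) (St [::0;3;8;9])) (St [::0;4;7;9]))) (St [::0;3;4;8])) (St
  [::0;3;6;8]))) (St [::0;3;4;5]))))) (St [::3;4;5;7])))) (St [::3;4;5;6]))))) (St [::2;7;8;9])))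
  (St [::2;6;8;9])))) (Br 7 9 (Br 6 9 (Tr [::6;7;9]) (St [::2;5;6;9])) (St [::2;5;7;9]))) (Br 7 8
  (Br 6 8 (Tr [::6;7;8]) (St [::2;5;6;8])) (St [::2;5;7;8]))) (St [::2;5;6;7]))).


Lemma fits_init n (G : sgraph) (x0 : G) (l : seq G) pos neg :
  all (fun p => edge (nth x0 l p.1) (nth x0 l p.2)) pos ->
  all (fun p => ~~ edge (nth x0 l p.1) (nth x0 l p.2)) neg ->
  fits n x0 l (init pos neg).
Proof.
move=> hp hn i j b _ _; rewrite /init.
elim: pos hp => [_|[i1 j1] pos IH /= /andP[e1 /IH {}IH]] /=; last first.
  by case/look_put2=> [[-> -> ->]|[-> -> ->]|//] //; rewrite edgeC.
elim: neg hn => [_|[i1 j1] neg IH /= /andP[e1 /IH {}IH]] /=.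
  by rewrite /look !nth_nil.
by case/look_put2=> [[-> -> ->]|[-> -> ->]|//]; apply/negbTE => //; rewrite edgeC.
Qed.

Section TenVertices.
Variables (G : sgraph) (B : {set G}).
Hypotheses (cB : #|B| = 10) (aB : al B <= 3) (kB : ~ hasK 4 B) (tB : 4 < th B).

Let labels10 m (F : {set G}) l : size l = 10 -> {subset l <= B} -> {subset B <= l} ->
  {subset drop m l <= F} -> labels 10 m B F l.
Proof.
move=> sl lB Bl lF; split=> //; apply: (leq_size_uniq (enum_uniq B)).
  by move=> x; rewrite mem_enum; apply: Bl.
by rewrite -cardE cB sl.
Qed.

Lemma no_two_triangles (T1 : {set G}) :
  T1 \subset B -> clique T1 -> #|T1| = 3 -> ~ hasK 3 (B :\: T1).
Proof.
move=> T1B kT1 cT1 [T2 T2B [kT2 cT2]].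
set R := (B :\: T1) :\: T2.
have cR : #|R| = 4 by rewrite /R !cardsDS // cB cT1 cT2.
(* Four vertices with [th >= 3] contain a stable triple by [th_al4]; this supplies the labels 6, 7,
   8. *)
have tR : 3 <= th R by have := th_D B kT1; have := th_D (B :\: T1) kT2; rewrite -/R; lia.
have [S' S'R [sS' cS']] := al_attained R.
have [|S SS' cS] := @exists_subset_card _ S' 3; first by rewrite cS'; have := @th_al4 G R; lia.
have SR : S \subset R by apply: subset_trans S'R.
have sS : stable S by apply: stable_sub sS'.
have [|j ER jS] := sub_card1 SR; first by rewrite cR cS.
have [a [b [c [nab nac nbc E1]]]] := card3_ex cT1.
have [d [e [f [nde ndf nef E2]]]] := card3_ex cT2.
have [g [h [i [ngh ngi nhi ES]]]] := card3_ex cS.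
have BE x : (x \in B) = [|| x \in T1, x \in T2, x \in S | x == j].
  have h1 := subsetP T1B x; have h2 := subsetP T2B x; rewrite inE in h2.
  have := erefl (x \in R); rewrite {2}ER /R !inE; move: h1 h2.
  case: (x \in T1) => [/(_ isT) -> //|_]; case: (x \in T2) => [/(_ isT) /= -> //|_] /=.
  by rewrite orbC => <-.
have kT (T : {set G}) x y z : clique T -> T = [set x; y; z] ->
    x != y -> x != z -> y != z -> [/\ edge x y, edge x z & edge y z].
  by move=> /cliqueP k E *; split; apply: k => //; rewrite E !inE eqxx ?orbT.
have [ab ac bc] := kT _ _ _ _ kT1 E1 nab nac nbc.
have [de df ef] := kT _ _ _ _ kT2 E2 nde ndf nef.
have [gh gi hi] : [/\ ~~ edge g h, ~~ edge g i & ~~ edge h i].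
  by move/stableP: sS => kS; split; apply: kS; rewrite ES !inE eqxx ?orbT.
(* With [m = 10] no label is subject to the triangle-free set, which is therefore empty. *)
apply: (@search 10 10 true two_triangles_order
  (init [:: (0, 1); (0, 2); (1, 2); (3, 4); (3, 5); (4, 5)] [:: (6, 7); (6, 8); (7, 8)])
  G B set0 a cB aB kB tB _ _ [:: a; b; c; d; e; f; g; h; i; j] two_triangles_tree).
- by case=> K; rewrite subset0 => /eqP -> [_]; rewrite cards0.
- by [].
- apply: labels10 => // x; rewrite BE E1 E2 ES !inE -?orbA //.
- by apply: fits_init; rewrite /= ?ab ?ac ?bc ?de ?df ?ef ?gh ?gi ?hi.
- by vm_compute.
Qed.

(** Otherwise deleting the other two vertices of [T] leaves a triangle-free set [F] of eight
    vertices, in which [x] has degree 2 or 3: one search for each degree. *)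
Lemma triangle_hub (T : {set G}) x : T \subset B -> clique T -> #|T| = 3 -> x \in T ->
  hasK 3 (B :\: (T :\ x)).
Proof.
move=> TB kT cT xT; apply: contrapT; set F := B :\: (T :\ x) => kF.
have c2 : #|T :\ x| = 2 by move: cT; rewrite (cardsD1 x) xT add1n => -[].
have sTB : T :\ x \subset B by apply: subset_trans TB; apply: subsetDl.
have cF : #|F| = 8 by rewrite cardsDS // cB c2.
have aF : al F <= 3 by apply: leq_trans aB; apply: al_sub; apply: subsetDl.
have xF : x \in F by rewrite !inE eqxx (subsetP TB).
have le3 := trifree_deg kF xF.
(* Six non-neighbours would contain a triangle by R(3,3), because their stability number is at most
   2. *)
have ge2 : 2 <= #|F :&: nb x|.
  have := card_nn xF; have [h|h] := leqP 6 #|nn x F|; last by rewrite cF; lia.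
  case: kF; apply: hasK_sub (subsetDl _ _) _; apply: ramsey33 h; exact: al_nn.
move: c2 => /eqP /cards2P[a [b [nab ET]]].
have [aT bT] : a \in T :\ x /\ b \in T :\ x by rewrite ET !inE !eqxx orbT.
have [[nax aT'] [nbx bT']] := (setD1P aT, setD1P bT).
move/cliqueP: kT => kT.
have eab : edge a b by apply: kT.
have eax : edge a x by apply: kT.
have ebx : edge b x by apply: kT.
set A := F :&: nb x in le3 ge2; set R := nn x F.
have BE y : (y \in B) = [|| y == a, y == b, y == x, y \in A | y \in R].
  have Eab : (y == a) || (y == b) = (y \in T :\ x) by rewrite ET !inE.
  rewrite orbA Eab /R /A /F inE !in_setD in_setI in_setU1 !inE.
  have := subsetP TB y; have [->|nyx] /= := eqVneq y x; first by rewrite (subsetP TB x xT).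
  by case: (y \in T) => [->//|_]; case: edge; case: (y \in B).
have FA y : y \in A -> y \in F /\ edge x y by rewrite !inE => /andP[].
have FR y : y \in R -> y \in F /\ ~~ edge x y.
  by rewrite /R /nn in_setD in_setU1 negb_or [y \in nb x]inE => /andP[/andP[_ ->] ->].
have sA : stable A by apply: trifree_stable.
have cR := card_nn xF; rewrite cF -/A -/R in cR.
have kA y z : y \in A -> z \in A -> ~~ edge y z by move/stableP: sA; apply.
have mA y : (y \in enum A) = (y \in A) by rewrite mem_enum.
have mR y : (y \in enum R) = (y \in R) by rewrite mem_enum.
have dF l : {subset l <= F} -> {subset drop 2 (a :: b :: l) <= F} by rewrite /= drop0.
have FB : {subset F <= B} by apply/subsetP; apply: subsetDl.
have le3' := leq_trans le3 aF.
have [c3|c3] : #|A| = 3 \/ #|A| = 2 by clear -le3' ge2; lia.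
- have: size (enum A) = 3 by rewrite -cardE.
  have: size (enum R) = 4 by rewrite -cardE; clear -cR c3; lia.
  case EA: (enum A) mA => [|d [|e [|f []]]] //.
  case ER: (enum R) mR => [|g [|h [|i [|j []]]]] // mR mA _ _.
  have inA y : y \in [:: d; e; f] -> y \in A by rewrite mA.
  have inR y : y \in [:: g; h; i; j] -> y \in R by rewrite mR.
  apply: (@search 10 2 false hub3_order
    (init [:: (0, 1); (0, 2); (1, 2); (2, 3); (2, 4); (2, 5)]
          [:: (2, 6); (2, 7); (2, 8); (2, 9); (3, 4); (3, 5); (4, 5)])
    G B F a cB aB kB tB kF _ [:: a; b; x; d; e; f; g; h; i; j] hub3_tree).
  + by [].
  + apply: labels10 => //.
    * by move=> y; rewrite BE -mA -mR !inE -!orbA.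
    * by move=> y; rewrite BE -mA -mR !inE -!orbA.
    * apply: dF => y.
      rewrite -[_ :: _]/([:: x] ++ [:: d; e; f] ++ [:: g; h; i; j]) !mem_cat inE mA mR.
      by case/or3P=> [/eqP ->//|/FA[]|/FR[]].
  + have [xd xe xf] : [/\ edge x d, edge x e & edge x f].
      by split; apply: (FA _ _).2; apply: inA; rewrite !inE eqxx ?orbT.
    have [de df ef] : [/\ ~~ edge d e, ~~ edge d f & ~~ edge e f].
      by split; apply: kA; apply: inA; rewrite !inE eqxx ?orbT.
    have xR y : y \in [:: g; h; i; j] -> ~~ edge x y by move=> /inR/FR[].
    apply: fits_init; rewrite /= ?eab ?eax ?ebx ?xd ?xe ?xf ?de ?df ?ef //.
    by rewrite !xR // !inE eqxx ?orbT.
  + by vm_compute.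
- have: size (enum A) = 2 by rewrite -cardE.
  have: size (enum R) = 5 by rewrite -cardE; clear -cR c3; lia.
  case EA: (enum A) mA => [|d [|e []]] //.
  case ER: (enum R) mR => [|f [|g [|h [|i [|j []]]]]] // mR mA _ _.
  have inA y : y \in [:: d; e] -> y \in A by rewrite mA.
  have inR y : y \in [:: f; g; h; i; j] -> y \in R by rewrite mR.
  apply: (@search 10 2 true hub2_order
    (init [:: (0, 1); (0, 2); (1, 2); (2, 3); (2, 4)]
          [:: (2, 5); (2, 6); (2, 7); (2, 8); (2, 9); (3, 4)])
    G B F a cB aB kB tB kF _ [:: a; b; x; d; e; f; g; h; i; j] hub2_tree).
  + by [].
  + apply: labels10 => //.
    * by move=> y; rewrite BE -mA -mR !inE -!orbA.
    * by move=> y; rewrite BE -mA -mR !inE -!orbA.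
    * apply: dF => y.
      rewrite -[_ :: _]/([:: x] ++ [:: d; e] ++ [:: f; g; h; i; j]) !mem_cat inE mA mR.
      by case/or3P=> [/eqP ->//|/FA[]|/FR[]].
  + have [xd xe] : [/\ edge x d & edge x e].
      by split; apply: (FA _ _).2; apply: inA; rewrite !inE eqxx ?orbT.
    have de : ~~ edge d e by apply: kA; apply: inA; rewrite !inE eqxx ?orbT.
    have xR y : y \in [:: f; g; h; i; j] -> ~~ edge x y by move=> /inR/FR[].
    apply: fits_init; rewrite /= ?eab ?eax ?ebx ?xd ?xe ?de //.
    by rewrite !xR // !inE eqxx ?orbT.
  + by vm_compute.
Qed.

End TenVertices.

(** A counterexample is critical of gap two, since nine vertices have gap at most one. It has no K4
    by [crit_six], and the two searches contradict [triangles_meet]. *)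
Lemma th_10_3 (G : sgraph) (B : {set G}) :
  #|B| = 10 -> al B <= 3 -> th B <= 4.
Proof.
move=> cB aB; rewrite leqNgt; apply/negP => tB.
have crB : crit 2 B.
  split; first lia.
  by move=> B' /proper_card; rewrite cB ltnS => /th_al9; lia.
have kB : ~ hasK 4 B.
  case/peel=> K [KB kK cK cD [tD aD]].
  by apply: (crit_six crB KB kK); have := @th_al9 G (B :\: K); lia.
have [|T [TB kT cT _ _]] := @peel G 3 B; first by apply: ramsey34; lia.
have [x xT []] := triangles_meet kB (no_two_triangles cB aB kB tB) TB kT cT.
exact: triangle_hub.
Qed.

(** * Seventeen vertices without stable set of size four *)

Section Transversal.
Variable T : finType.
Implicit Types (P : {set T}) (x : T).

Let other P x : 2 <= #|P| -> exists2 y, y \in P & y != x.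
Proof.
move=> cP; have : 0 < #|P :\ x| by rewrite (cardsD1 x) in cP; case: (x \in P) cP; lia.
by case/card_gt0P=> y /setD1P[n yP]; exists y.
Qed.

Let sdr3 P1 P2 P3 : 2 <= #|P1| -> 2 <= #|P2| -> 2 <= #|P3| ->
  (forall x, ~ [/\ x \in P1, x \in P2 & x \in P3]) ->
  exists x1 x2 x3, [/\ x1 \in P1, x2 \in P2 & x3 \in P3] /\ [/\ x1 != x2, x1 != x3 & x2 != x3].
Proof.
move=> c1 c2 c3 h3.
have [x1 x1P] : exists x, x \in P1 by apply/card_gt0P; lia.
have [x2 x2P n21] := other x1 c2.
have [[x3 [x3P n31 n32]]|h] := EM (exists x, [/\ x \in P3, x != x1 & x != x2]).
  by exists x1, x2, x3; rewrite eq_sym n21 eq_sym n31 eq_sym n32.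
have in3 x : x \in P3 -> x = x1 \/ x = x2.
  move=> xP; apply: contrapT => /not_orP[/eqP n1 /eqP n2]; apply: h.
  by exists x.
have x1P3 : x1 \in P3.
  by have [y yP n] := other x2 c3; case: (in3 y yP) => e; rewrite e ?eqxx // in yP n.
have x2P3 : x2 \in P3.
  by have [y yP n] := other x1 c3; case: (in3 y yP) => e; rewrite e ?eqxx // in yP n.
have [y yP n] := other x1 c1.
have ny2 : y != x2 by apply/eqP => e; apply: (h3 x2); rewrite -{1}e.
by exists y, x2, x1.
Qed.

(** Hall's condition holds: k of the sets have at least 2k incidences, and no element lies in three
    sets. The transversal is built by direct exchange. *)
Lemma sdr4 P1 P2 P3 P4 :
  2 <= #|P1| -> 2 <= #|P2| -> 2 <= #|P3| -> 2 <= #|P4| ->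
  (forall x, ~ [/\ x \in P1, x \in P2 & x \in P3]) ->
  (forall x, ~ [/\ x \in P1, x \in P2 & x \in P4]) ->
  (forall x, ~ [/\ x \in P1, x \in P3 & x \in P4]) ->
  (forall x, ~ [/\ x \in P2, x \in P3 & x \in P4]) ->
  exists x1 x2 x3 x4, [/\ x1 \in P1, x2 \in P2, x3 \in P3 & x4 \in P4] /\
    uniq [:: x1; x2; x3; x4].
Proof.
move=> c1 c2 c3 c4 h123 h124 h134 h234.
have [x1 [x2 [x3 [[p1 p2 p3] [n12 n13 n23]]]]] := sdr3 c1 c2 c3 h123.
have [[x4 [p4 n1 n2 n3]]|h] := EM (exists x, [/\ x \in P4, x != x1, x != x2 & x != x3]).
  exists x1, x2, x3, x4; split=> //=; rewrite !inE !negb_or n12 n13 n23.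
  by rewrite ![_ == x4]eq_sym n1 n2 n3.
have in4 x : x \in P4 -> [\/ x = x1, x = x2 | x = x3].
  move=> xP; apply: contrapT => k; apply: h; exists x; split=> //; apply/eqP => e; apply: k.
  - by constructor 1.
  - by constructor 2.
  - by constructor 3.
(* [P4] meets the transversal of the other sets in [y1] and [y2]: exchange one of
   these for another element of its set. *)
have key (Q1 Q2 Q3 : {set T}) y1 y2 y3 : 2 <= #|Q1| -> 2 <= #|Q2| ->
    (forall x, ~ [/\ x \in Q1, x \in Q2 & x \in Q3]) ->
    (forall x, ~ [/\ x \in Q1, x \in Q2 & x \in P4]) ->
    y1 \in Q1 -> y2 \in Q2 -> y3 \in Q3 -> y1 \in P4 -> y2 \in P4 ->
    y1 != y2 -> y1 != y3 -> y2 != y3 ->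
    exists z1 z2 z3 z4, [/\ z1 \in Q1, z2 \in Q2, z3 \in Q3 & z4 \in P4] /\
      uniq [:: z1; z2; z3; z4].
  move=> d1 d2 k123 k124 q1 q2 q3 r1 r2 m12 m13 m23.
  have [c cQ nc] := other y1 d1.
  have nc2 : c != y2 by apply/eqP => e; apply: (k124 y2); rewrite -{1}e.
  have [e|nc3] := eqVneq c y3.
    have [d dQ nd] := other y2 d2.
    have nd1 : d != y1 by apply/eqP => e'; apply: (k124 y1); rewrite -{2}e'.
    have nd3 : d != y3.
      by apply/eqP => e'; apply: (k123 y3); split=> //; [rewrite -e|rewrite -e'].
    exists y1, d, y3, y2; split=> //=; rewrite !inE !negb_or m12 m13 nd nd3.
    by rewrite eq_sym nd1 eq_sym m23.
  exists c, y2, y3, y1; split=> //=; rewrite !inE !negb_or nc nc2 nc3 m23.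
  by rewrite eq_sym m12 eq_sym m13.
have [y yP _] := other x1 c4.
have [z zP nz] := other y c4.
have in2 : [\/ (x1 \in P4) && (x2 \in P4), (x1 \in P4) && (x3 \in P4) | (x2 \in P4) && (x3 \in P4)].
  case: (in4 y yP) (in4 z zP) => ey [] ez; move: nz yP zP; rewrite ey ez ?eqxx // => _ -> ->;
    by [constructor 1|constructor 2|constructor 3].
have perm4 (a b c d : T) : uniq [:: a; b; c; d] -> uniq [:: a; c; b; d] /\ uniq [:: c; a; b; d].
  rewrite /= !inE !negb_or => /and4P[/and3P[h1 h2 h3] /andP[h4 h5] h6 _].
  by rewrite (eq_sym c b) (eq_sym c a) h1 h2 h3 h4 h5 h6.
case: in2 => /andP[r1 r2].
- exact: (key P1 P2 P3 x1 x2 x3).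
- have [||||z1 [z2 [z3 [z4 [[q1 q2 q3 q4] /perm4[u _]]]]]] :=
    key P1 P3 P2 x1 x3 x2 c1 c3 _ h134 p1 p3 p2 r1 r2; try by rewrite // eq_sym.
    by move=> x [? ? ?]; apply: (h123 x).
  by exists z1, z3, z2, z4.
- have [||||z1 [z2 [z3 [z4 [[q1 q2 q3 q4] /perm4[_ u]]]]]] :=
    key P2 P3 P1 x2 x3 x1 c2 c3 _ h234 p2 p3 p1 r1 r2; try by rewrite // eq_sym.
    by move=> x [? ? ?]; apply: (h123 x).
  by exists z3, z1, z2, z4.
Qed.

End Transversal.

Section Seventeen.
Variable G : sgraph.
Implicit Types (x y z u v w : G) (A B C S K T N W : {set G}) (t : nat).

Lemma th_peel A : 0 < th A -> exists K, [/\ K \subset A, clique K & th (A :\: K) < th A].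
Proof.
move=> t0; have [c vc cc] := th_attained A; move: t0; rewrite -cc.
case/card_gt0P=> s sA; exists [set x in A | c x == s]; split.
- by apply/subsetP => x; rewrite inE => /andP[].
- apply/cliqueP => x y; rewrite !inE => /andP[xA /eqP ex] /andP[yA /eqP ey].
  by apply: vc => //; rewrite ex ey.
apply: (@leq_ltn_trans #|c @: (A :\: [set x in A | c x == s])|).
  by apply: th_le => x y /setDP[xA _] /setDP[yA _]; apply: vc.
rewrite [X in _ < X](cardsD1 s) sA add1n ltnS; apply: subset_leq_card.
apply/subsetP => _ /imsetP[x xA ->]; move: xA; rewrite !inE => /andP[h xA].
by rewrite imset_f // andbT; move: h; rewrite xA.
Qed.

(** Cliques have at most two vertices here, so a cover with half as many cliques as vertices is a
    perfect matching; one of its edges is peeled off. *)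
Lemma matching_peel A k : ~ hasK 3 A -> #|A| = 2 * k.+1 -> th A <= k.+1 ->
  exists y z, [/\ y \in A, z \in A, edge y z, #|A :\: [set y; z]| = 2 * k &
    th (A :\: [set y; z]) <= k].
Proof.
move=> ntr cA tA.
have sm A' : A' \subset A -> #|A'| <= 2 * th A'.
  move=> A'A; apply: card_le_th => K KA' kK; rewrite leqNgt; apply/negP => h.
  by apply: ntr; apply: clique_hasK kK h; apply: subset_trans A'A.
have [|K [KA kK lt]] := @th_peel A; first by have := sm A (subxx _); lia.
have cK2 : #|K| <= 2.
  by rewrite leqNgt; apply/negP => h; apply: ntr; apply: clique_hasK kK h.
have cD : #|A :\: K| = #|A| - #|K| by rewrite cardsDS.
have := sm _ (subsetDl A K) => cD2.
have /eqP/cards2P[y [z [nyz EK]]] : #|K| = 2 by lia.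
have [yK zK] : y \in K /\ z \in K by rewrite EK !inE !eqxx orbT.
exists y, z; rewrite -EK; split; [exact: (subsetP KA)|exact: (subsetP KA)| |lia|lia].
by move/cliqueP: kK; apply.
Qed.

Lemma exchange_card N W :
  \sum_(y in N) #|W :&: nb y| = \sum_(w in W) #|N :&: nb w|.
Proof.
have E A y : #|A :&: nb y| = \sum_(w in A) (edge y w : nat).
  rewrite -sum1_card big_mkcond [RHS]big_mkcond /=.
  by apply: eq_bigr => w _; rewrite !inE; case: (w \in A); case: edge.
rewrite (eq_bigr _ (fun y _ => E W y)) (eq_bigr _ (fun y _ => E N y)) exchange_big.
by apply: eq_bigr => w _; apply: eq_bigr => y _; rewrite edgeC.
Qed.

Lemma sum_le_eq (A : {set G}) (f : G -> nat) c :
  (forall x, x \in A -> f x <= c) -> c * #|A| <= \sum_(x in A) f x ->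
  forall x, x \in A -> f x = c.
Proof.
move=> h s x xA; apply/eqP; rewrite eqn_leq h // leqNgt; apply/negP => lt.
move: s; rewrite leqNgt => /negP; apply.
rewrite mulnC -sum_nat_const (bigD1 x) //= [X in _ < X](bigD1 x) //=.
by rewrite -addSn; apply: leq_add => //; apply: leq_sum => y /andP[yA _]; apply: h.
Qed.

Lemma sum_ge_eq (A : {set G}) (f : G -> nat) c :
  (forall x, x \in A -> c <= f x) -> \sum_(x in A) f x <= c * #|A| ->
  forall x, x \in A -> f x = c.
Proof.
move=> h s x xA; apply/eqP; rewrite eqn_leq h // andbT leqNgt; apply/negP => lt.
move: s; rewrite leqNgt => /negP; apply.
rewrite mulnC -sum_nat_const (bigD1 x) //= [X in _ < X](bigD1 x) //=.
by rewrite -addSn; apply: leq_add => //; apply: leq_sum => y /andP[yA _]; apply: h.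
Qed.

Lemma crit1_5_deg C v : crit 1 C -> #|C| = 5 -> v \in C -> #|C :&: nb v| = 2.
Proof.
move=> cC c5 vC; have [_ tC _] := crit1_5 cC c5.
have := crit_nn (ltn0Sn _) cC vC; have := card_nn vC; rewrite c5 tC => h1 h2.
have [h|h] := leqP #|C :&: nb v| 1; last by lia.
case: (@crit_simplicial _ _ _ v cC vC); apply: al_le1; apply/al_leP => S SN _.
exact: leq_trans (subset_leq_card SN) h.
Qed.

(** * K4-free sets of seventeen vertices with stability number at most three *)

Section Regular.
Variable B : {set G}.
Hypotheses (cB : #|B| = 17) (aB : al B <= 3) (kB : ~ hasK 4 B).

(** R(3,4) bounds the neighbours by 8 and R(4,3) the non-neighbours; together they number 16. *)
Let nN x : x \in B -> #|B :&: nb x| = 8 /\ #|nn x B| = 8.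
Proof.
move=> xB; have := card_nn xB; rewrite cB => e.
have h1 : #|B :&: nb x| <= 8.
  rewrite leqNgt; apply/negP => h; apply: kB; apply: (hasK_nb xB); apply: ramsey34 h.
  by apply: leq_trans aB; apply: al_sub; apply: subsetIl.
have h2 : #|nn x B| <= 8.
  apply: ramsey43; first exact: al_nn.
  by apply: contra_not kB; apply: hasK_sub; apply: subsetDl.
by move: e h1 h2; clear; lia.
Qed.

(** Strong regularity with parameters (17, 8, 3, 4), those of the Paley graph. A vertex of [N] has
    at most 3 neighbours in [N], hence at least 4 in [W]; a vertex of [W] has at most 3
    non-neighbours in [W], hence at most 4 neighbours in [N]. Double counting forces equality. *)
Let local x : x \in B ->
  (forall y, y \in B :&: nb x -> #|(B :&: nb x) :&: nb y| = 3 /\ #|nn x B :&: nb y| = 4) /\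
  (forall w, w \in nn x B -> #|(B :&: nb x) :&: nb w| = 4 /\ #|nn x B :&: nb w| = 4).
Proof.
move=> xB; have [cN cW] := nN xB.
set N := B :&: nb x in cN *; set W := nn x B in cW *.
have NB : N \subset B by apply: subsetIl.
have WB : W \subset B by apply: subsetDl.
have tN : ~ hasK 3 N by apply: contra_not kB; apply: hasK_nb.
have aN : al N <= 3 by apply: leq_trans aB; apply: al_sub.
have hN y : y \in N -> 4 <= #|W :&: nb y| /\ 8 = (#|N :&: nb y| + #|W :&: nb y|).+1.
  move=> yN; have yB := subsetP NB _ yN; have exy : edge x y by move: yN; rewrite !inE => /andP[].
  have := card_nb_split y xB; rewrite (nN yB).1 exy -/N -/W.
  by have := leq_trans (trifree_deg tN yN) aN; clear; lia.
have hW w : w \in W -> #|N :&: nb w| <= 4 /\ 8 = #|N :&: nb w| + #|W :&: nb w|.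
  move=> wW; have wB := subsetP WB _ wW.
  have exw : edge x w = false by move: wW; rewrite !inE negb_or => /andP[/andP[_ /negPf]].
  have kn : clique (nn w W) by apply: al_le1; apply: al_nn => //; apply: al_nn.
  have c3 : #|nn w W| <= 3.
    rewrite leqNgt; apply/negP => h; apply: kB; apply: clique_hasK kn h.
    by apply: subset_trans WB; apply: subsetDl.
  have := card_nb_split w xB; rewrite (nN wB).1 exw -/N -/W.
  by have := card_nn wW; rewrite cW; move: c3; clear; lia.
have ex := exchange_card N W.
have sN : \sum_(y in N) #|W :&: nb y| <= 4 * #|N|.
  rewrite ex cN -cW mulnC -sum_nat_const; apply: leq_sum => w wW; exact: (hW w wW).1.
have sW : 4 * #|W| <= \sum_(w in W) #|N :&: nb w|.
  rewrite -ex cW -cN mulnC -sum_nat_const; apply: leq_sum => y yN; exact: (hN y yN).1.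
split=> y yN.
  have := sum_ge_eq (fun y yN => (hN y yN).1) sN yN; have := (hN y yN).2; clear; lia.
have := sum_le_eq (fun y yN => (hW y yN).1) sW yN; have := (hW y yN).2; clear; lia.
Qed.

(* Four disjoint edges of [N] with distinct common neighbours in [W]: one edge is
   completed by [x] and the others by their common neighbours. *)
Let cover6 x (U : {set G}) a1 b1 a2 b2 a3 b3 a4 b4 w1 w2 w3 w4 :
  [/\ edge a1 b1, edge a2 b2, edge a3 b3 & edge a4 b4] ->
  [/\ edge x a1 & edge x b1] ->
  [/\ edge w2 a2, edge w2 b2, edge w3 a3 & edge w3 b3] -> [/\ edge w4 a4 & edge w4 b4] ->
  (forall y, y \in B :&: nb x -> y \in [:: a1; b1; a2; b2; a3; b3; a4; b4]) ->
  (forall w, w \in nn x B -> w \notin U -> w \in [:: w1; w2; w3; w4]) ->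
  th (w1 |: U) <= 2 -> th B <= 6.
Proof.
move=> [e1 e2 e3 e4] [x1 x1'] [w22 w22' w33 w33'] [w44 w44'] hN hW t2.
have k1 := clique3 x1 x1' e1; have k2 := clique3 w22 w22' e2.
have k3 := clique3 w33 w33' e3; have k4 := clique3 w44 w44' e4.
suff /th_sub h : B \subset [set x; a1; b1] :|: ([set w2; a2; b2] :|: ([set w3; a3; b3] :|:
    ([set w4; a4; b4] :|: (w1 |: U)))).
  have h1 := th_clique_cover k1 (subxx ([set x; a1; b1] :|: ([set w2; a2; b2] :|:
    ([set w3; a3; b3] :|: ([set w4; a4; b4] :|: (w1 |: U)))))).
  have h2 := th_clique_cover k2 (subxx ([set w2; a2; b2] :|:
    ([set w3; a3; b3] :|: ([set w4; a4; b4] :|: (w1 |: U))))).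
  have h3 := th_clique_cover k3 (subxx ([set w3; a3; b3] :|: ([set w4; a4; b4] :|: (w1 |: U)))).
  have h4 := th_clique_cover k4 (subxx ([set w4; a4; b4] :|: (w1 |: U))).
  by move: h h1 h2 h3 h4 t2; clear; lia.
apply/subsetP => v vB; rewrite !in_setU !in_set1.
have [//|nvx] := eqVneq v x; have [exv|nxv] := boolP (edge x v).
  have: v \in B :&: nb x by rewrite !inE vB exv.
  by move/hN; rewrite !inE; do !case: (v == _) => //=.
have vW : v \in nn x B by rewrite !inE negb_or nvx nxv vB.
have [vU|vU] := boolP (v \in U); first by do 5!(apply/orP; right).
by have := hW v vW vU; rewrite !inE; do !case: (v == _) => //=.
Qed.

(** Of the three common neighbours of [y] and [z] one is [x]; another in the neighbourhood of [x]
    would complete a K4. *)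
Let common y z x : x \in B -> y \in B :&: nb x -> z \in B :&: nb x -> edge y z ->
  #|nn x B :&: nb y :&: nb z| = 2.
Proof.
move=> xB yN zN eyz; have yB : y \in B by case/setIP: yN.
have [exy exz] : edge x y /\ edge x z.
  by move: yN zN; rewrite !inE => /andP[_ ->] /andP[_ ->].
have zy : z \in B :&: nb y by rewrite !inE eyz andbT; case/setIP: zN.
have [h _] := local yB; have := (h z zy).1.
have -> : B :&: nb y :&: nb z = x |: (nn x B :&: nb y :&: nb z).
  apply/setP => v; rewrite !inE; have [->|nvx] /= := eqVneq v x.
    by rewrite xB edgeC exy edgeC exz.
  case vB: (v \in B); rewrite ?andbF //= andbT; case yv: (edge y v); rewrite ?andbF //=.
  case zv: (edge z v); rewrite ?andbF //=.
  suff -> : edge x v = false by [].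
  apply/negP => xv; have vN : v \in B :&: nb x by rewrite !inE vB xv.
  by apply: kB; apply: (hasK_nb xB); apply: (hasK3 yN zN vN).
by rewrite cardsU1 !inE eqxx => -[].
Qed.

Lemma th_17_3 : th B <= 6.
Proof.
have [x xB] : exists x, x \in B by apply/card_gt0P; rewrite cB.
have [hN hW] := local xB; have [cN cW] := nN xB.
set N := B :&: nb x in hN hW cN; set W := nn x B in hN hW cW.
have NB : N \subset B by apply: subsetIl.
have WB : W \subset B by apply: subsetDl.
have tN : ~ hasK 3 N by apply: contra_not kB; apply: hasK_nb.
have aN : al N <= 3 by apply: leq_trans aB; apply: al_sub.
have aW : al W <= 2 by apply: al_nn.
(* Four cliques for eight vertices without a triangle: the cover is a perfect matching. *)
have thN : th N <= 4 by have := @th_al9 G N; rewrite cN; move: aN; clear; lia.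
have [y1 [z1 [y1N z1N e1 c1 t1]]] := matching_peel (k := 3) tN cN thN.
set N1 := N :\: _ in c1 t1; have s1 : N1 \subset N by apply: subsetDl.
have [|y2 [z2 [y2N z2N e2 c2 t2]]] := matching_peel (k := 2) _ c1 t1.
  by apply: contra_not tN; apply: hasK_sub.
set N2 := N1 :\: _ in c2 t2; have s2 : N2 \subset N by apply: subset_trans s1; apply: subsetDl.
have [|y3 [z3 [y3N z3N e3 c3 t3]]] := matching_peel (k := 1) _ c2 t2.
  by apply: contra_not tN; apply: hasK_sub.
set N3 := N2 :\: _ in c3 t3; have s3 : N3 \subset N by apply: subset_trans s2; apply: subsetDl.
have [|y4 [z4 [y4N z4N e4 c4 _]]] := matching_peel (k := 0) _ c3 t3.
  by apply: contra_not tN; apply: hasK_sub.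
have NE y : y \in N -> y \in [:: y1; z1; y2; z2; y3; z3; y4; z4].
  move=> yN; apply/negPn/negP; rewrite !inE !negb_or => /and5P[h1 h2 h3 h4 /and4P[h5 h6 h7 h8]].
  have: y \in N3 :\: [set y4; z4].
    by rewrite /N3 /N2 /N1 !in_setD !in_set2 !negb_or h1 h2 h3 h4 h5 h6 h7 h8.
  by have /eqP := c4; rewrite cards_eq0 => /eqP ->; rewrite inE.
have {}y2N' := subsetP s1 _ y2N; have {}z2N' := subsetP s1 _ z2N.
have {}y3N' := subsetP s2 _ y3N; have {}z3N' := subsetP s2 _ z3N.
have {}y4N' := subsetP s3 _ y4N; have {}z4N' := subsetP s3 _ z4N.
have uN : uniq [:: y1; z1; y2; z2; y3; z3; y4; z4].
  apply: (leq_size_uniq (enum_uniq N)); last by rewrite -cardE cN.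
  by move=> y; rewrite mem_enum; apply: NE.
pose P y z := W :&: nb y :&: nb z.
have cP y z : y \in N -> z \in N -> edge y z -> 2 <= #|P y z|.
  by move=> yN zN e; rewrite /P (common xB).
have PE y z w : w \in P y z -> [/\ w \in W, edge w y & edge w z].
  by rewrite /P 2!in_setI => /andP[/andP[-> h1] h2]; move: h1 h2; rewrite !inE ![edge w _]edgeC.
(* A vertex serving three matching edges would have six neighbours in [N], but it has four. *)
have mult a b c d e f : uniq [:: a; b; c; d; e; f] -> {subset [:: a; b; c; d; e; f] <= N} ->
    forall w, ~ [/\ w \in P a b, w \in P c d & w \in P e f].
  move=> u sN w [/PE[wW wa wb] /PE[_ wc wd] /PE[_ we wf]].
  have : [set v in [:: a; b; c; d; e; f]] \subset N :&: nb w.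
    apply/subsetP => v; rewrite in_set => vs; rewrite in_setI sN //=.
    by move: vs; rewrite !inE => /or4P[/eqP->|/eqP->|/eqP->|/or3P[]/eqP->].
  by move/subset_leq_card; rewrite (hW w wW).1 cardsE; move/card_uniqP: u => ->.
have sub ms : uniq (mask ms [:: y1; z1; y2; z2; y3; z3; y4; z4]) /\
    {subset mask ms [:: y1; z1; y2; z2; y3; z3; y4; z4] <= N}.
  split; first exact: mask_uniq.
  by move=> v /mem_mask; rewrite !in_cons in_nil orbF; do 7!(case/predU1P=> [->//|]); move/eqP ->.
have m123 := sub [:: true; true; true; true; true; true].
have m124 := sub [:: true; true; true; true; false; false; true; true].
have m134 := sub [:: true; true; false; false; true; true; true; true].
have m234 := sub [:: false; false; true; true; true; true; true; true].
have [w1 [w2 [w3 [w4 [[p1 p2 p3 p4] uw]]]]] := sdr4 (cP _ _ y1N z1N e1) (cP _ _ y2N' z2N' e2)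
  (cP _ _ y3N' z3N' e3) (cP _ _ y4N' z4N' e4) (mult _ _ _ _ _ _ m123.1 m123.2)
  (mult _ _ _ _ _ _ m124.1 m124.2) (mult _ _ _ _ _ _ m134.1 m134.2)
  (mult _ _ _ _ _ _ m234.1 m234.2).
have [w1W w1y w1z] := PE _ _ _ p1; have [w2W w2y w2z] := PE _ _ _ p2.
have [w3W w3y w3z] := PE _ _ _ p3; have [w4W w4y w4z] := PE _ _ _ p4.
pose Q := [set w in [:: w1; w2; w3; w4]].
have QW : Q \subset W.
  by apply/subsetP => w; rewrite inE !in_cons in_nil orbF => /or4P[] /eqP ->.
have cQ : #|Q| = 4 by rewrite cardsE; apply/card_uniqP.
pose U := W :\: Q.
have cU : #|U| = 4 by rewrite cardsDS // cW cQ.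
have UW : U \subset W by apply: subsetDl.
have [w wQ tw] : exists2 w, w \in Q & th (w |: U) <= 2.
  apply: contrapT => nw.
  have cC w : w \in Q -> #|w |: U| = 5 by move=> wQ; rewrite cardsU1 cU inE wQ.
  have cr w : w \in Q -> crit 1 (w |: U).
    move=> wQ; apply: crit_5; first exact: cC.
    have : al (w |: U) <= al W by apply: al_sub; rewrite subUset sub1set UW (subsetP QW).
    have : 2 < th (w |: U) by rewrite ltnNge; apply/negP => h; apply: nw; exists w.
    by move: aW; clear; lia.
  have dg w u : w \in Q -> u \in U -> edge u w + #|U :&: nb u| = 2.
    move=> wQ uU; rewrite -(crit1_5_deg (cr w wQ) (cC w wQ) (setU1r w uU)).
    rewrite [RHS](cardsD1 w) in_setI setU11 [w \in nb u]inE /=; congr (_ + _).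
    apply: eq_card => v; rewrite in_setD1 2!in_setI in_setU1.
    by have [->|//] := eqVneq v w; rewrite in_setD wQ.
  (* A vertex [u] with two neighbours in [U] would miss all four of [Q], but it has only three
     non-neighbours in [W]. Without such [u], [w1] has degree 4 in its pentagon. *)
  have [[u uU du]|h] := EM (exists2 u, u \in U & #|U :&: nb u| = 2).
    have uW := subsetP UW _ uU.
    have : Q \subset nn u W.
      apply/subsetP => w wQ; rewrite /nn in_setD in_setU1 (subsetP QW) // andbT negb_or.
      have := dg w u wQ uU; rewrite du [w \in nb u]inE; case: edge => // _; rewrite andbT.
      by apply: contraTneq wQ => ->; case/setDP: uU.
    move/subset_leq_card; have := card_nn uW; rewrite cQ cW (hW u uW).2; clear; lia.
  have w1Q : w1 \in Q by rewrite !inE eqxx.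
  have ed u : u \in U -> edge w1 u.
    move=> uU; rewrite edgeC; have := dg w1 u w1Q uU; case: edge => // e.
    by case: h; exists u.
  have := crit1_5_deg (cr w1 w1Q) (cC w1 w1Q) (setU11 w1 U).
  have -> : (w1 |: U) :&: nb w1 = U.
    apply/setP => v; rewrite in_setI in_setU1 [v \in nb w1]inE.
    have [->|_] := eqVneq v w1; first by rewrite edge_irr andbF in_setD w1Q.
    by case vU: (v \in U) => //=; apply: ed.
  by rewrite cU.
have NxE y : y \in N -> edge x y by rewrite !inE => /andP[].
have UE v : v \in W -> v \notin U -> v \in [:: w1; w2; w3; w4].
  by move=> vW; rewrite in_setD vW andbT negbK inE.
move: wQ; rewrite inE !in_cons in_nil orbF => /or4P[] /eqP ew; rewrite ew in tw.
- apply: (@cover6 x U y1 z1 y2 z2 y3 z3 y4 z4 w1 w2 w3 w4) => //.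
  by split; apply: NxE.
- apply: (@cover6 x U y2 z2 y1 z1 y3 z3 y4 z4 w2 w1 w3 w4) => //.
  + by split; apply: NxE.
  + by move=> v /NE; rewrite !inE; do !case: (v == _) => //=.
  + by move=> v vW /(UE v vW); rewrite !inE; do !case: (v == _) => //=.
- apply: (@cover6 x U y3 z3 y1 z1 y2 z2 y4 z4 w3 w1 w2 w4) => //.
  + by split; apply: NxE.
  + by move=> v /NE; rewrite !inE; do !case: (v == _) => //=.
  + by move=> v vW /(UE v vW); rewrite !inE; do !case: (v == _) => //=.
- apply: (@cover6 x U y4 z4 y1 z1 y2 z2 y3 z3 w4 w1 w2 w3) => //.
  + by split; apply: NxE.
  + by move=> v /NE; rewrite !inE; do !case: (v == _) => //=.
  + by move=> v vW /(UE v vW); rewrite !inE; do !case: (v == _) => //=.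
Qed.

End Regular.
End Seventeen.

(** * Gaps three and four *)

Section GapThreeFour.
Variable G : sgraph.
Implicit Types (x y z u v w : G) (A B C S K T : {set G}) (t : nat).

(** If [al B = 2], a vertex has at least [t + 4] non-neighbours, so its neighbourhood has at most
    [8 + 3 * t] vertices and needs at most [t + 3] cliques, while [th_al2] demands [t + 4]. *)
Lemma crit_al3 t B : crit t.+3 B -> #|B| <= 13 + 4 * t -> t <= 1 ->
  (forall A, #|A| <= 8 + 4 * t -> th A <= al A + t.+1) -> 3 <= al B.
Proof.
move=> cB c t1 h; have a2 := crit_al (ltn0Sn _) cB; rewrite ltnNge; apply/negP => a3.
have [e m] := crit_th (ltn0Sn _) cB.
have [x xB] : exists x, x \in B.
  by apply/set0Pn; apply/negP => /eqP e0; move: a2; rewrite e0 al0.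
have := crit_nn (ltn0Sn _) cB xB; have := card_nn xB; have := th_al2 a3 xB => h2 h3 h4.
have := h (B :&: nb x); have := al_sub (subsetIl B (nb x)); lia.
Qed.

(** Gallai's bound leaves [al = 3], [th = 6]. Deleting a triangle, present by R(3,4), leaves at most
    nine vertices with [th >= 5], against [th_al9]. *)
Lemma th_al12 A : #|A| <= 12 -> th A <= (al A).+2.
Proof.
move=> cA; rewrite leqNgt; apply/negP => h.
have [|B BA cB] := @crit_exists G 3 A; first lia.
have [e m] := crit_th (ltn0Sn _) cB.
have cBA := subset_leq_card BA.
have a3 : 3 <= al B.
  apply: (crit_al3 (t := 0) cB) => //; first lia.
  by move=> A' c'; have := @th_al9 G A'; lia.
case: (crit_cases (ltn0Sn _) cB) => [c|]; last first.
  case=> B1 [B2 [t1 [t2 [[E d _ e1] [t10 t20 h1 h2]]]]].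
  have := gap1_card t10 h1; have := gap1_card t20 h2.
  have [t2'|t1'] : 1 < t2 \/ 1 < t1 by lia.
    by have := gap2_card t2' h2; move: cBA; rewrite E card_disjU //; lia.
  by have := gap2_card t1' h1; move: cBA; rewrite E card_disjU //; lia.
have [|T [TB kT cT cD [tD aD]]] := @peel G 3 B; first by apply: ramsey34; lia.
have := @th_al9 G (B :\: T); lia.
Qed.

Lemma gap3_card A t : 2 < t -> th A = al A + t -> 13 <= #|A|.
Proof. by move=> t0 e; rewrite leqNgt; apply/negP; rewrite ltnS => /th_al12; lia. Qed.

Lemma th_13_3 A : #|A| <= 13 -> al A <= 3 -> th A <= 5.
Proof.
move=> cA aA; have [c12|c12] := leqP #|A| 12; first by have := th_al12 c12; lia.
have [|T [TB kT cT cD [tD aD]]] := @peel G 3 A; first by apply: ramsey34; lia.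
have := @th_10_3 G (A :\: T); lia.
Qed.

(** Parts of gaps one and two would need 5 + 10 vertices. *)
Lemma crit3_conn B : crit 3 B -> #|B| <= 14 -> 2 * th B <= #|B|.+1.
Proof.
move=> cB c; case: (crit_cases (ltn0Sn _) cB) => //.
case=> B1 [B2 [t1 [t2 [[E d _ e1] [t10 t20 h1 h2]]]]].
have := gap1_card t10 h1; have := gap1_card t20 h2.
have [t2'|t1'] : 1 < t2 \/ 1 < t1 by lia.
  by have := gap2_card t2' h2; move: c; rewrite E card_disjU //; lia.
by have := gap2_card t1' h1; move: c; rewrite E card_disjU //; lia.
Qed.

(** Equivalently, no stable pair of [C] avoids the neighbourhood of [x]. *)
Definition dominates x C := clique (C :\: nb x).

(** Each dominating vertex misses at most two vertices of the pentagon, so [x] and [y] share a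
    neighbour [p] there; the triangle on [x], [y], [p] leaves a path covered by two cliques. *)
Lemma dominates_common C x y : crit 1 C -> #|C| = 5 ->
  dominates x C -> dominates y C -> edge x y -> th (x |: (y |: C)) <= 3.
Proof.
move=> cC c5 dx dy exy; have [aC tC ntr] := crit1_5 cC c5.
have h z : dominates z C -> #|C :\: nb z| <= 2.
  move=> dz; rewrite leqNgt; apply/negP => hz; apply: ntr.
  by apply: (clique_hasK _ dz hz); apply: subsetDl.
have [p pC] : exists p, p \in C :\: ((C :\: nb x) :|: (C :\: nb y)).
  apply/card_gt0P; rewrite cardsDS; last by rewrite subUset !subsetDl.
  have := (leq_card_setU (C :\: nb x) (C :\: nb y)).1; have := h _ dx; have := h _ dy.
  lia.
case/setDP: pC => pC; rewrite !inE pC !andbT negb_or !negbK => /andP[px py].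
have [_ /(_ p pC)] := crit_th (ltn0Sn _) cC.
suff: th (x |: (y |: C)) <= (th (C :\ p)).+1 by lia.
apply: (th_clique_cover (clique3 exy px py)).
apply/subsetP => u; rewrite !inE; case: (u == x) => //=; case: (u == y) => //=.
by case: (u == p).
Qed.

(** The edge from [x] to [y] is one clique, and deleting [y] saves one. *)
Lemma adjacent_absorb t C x y : 0 < t -> crit t C -> y \in C -> edge x y ->
  th (x |: C) <= th C.
Proof.
move=> t0 cC yC exy; have [_ /(_ y yC)] := crit_th t0 cC.
suff: th (x |: C) <= (th (C :\ y)).+1 by lia.
apply: (th_clique_cover (clique2 exy)); apply/subsetP => u.
by rewrite !inE; case: (u == x); case: (u == y).
Qed.

(** Deleting a triangle [T] leaves two pentagons. Each vertex of [T] dominates one of them, and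
    these choices cut a pentagon off from the rest of [B], leaving too small a gap. *)
Lemma crit_13_4_7 B : crit 3 B -> #|B| = 13 -> al B = 4 -> ~ hasK 3 B.
Proof.
move=> cB c13 a4 /peel[T [TB kT cT cD [tD aD]]].
have [e m] := crit_th (ltn0Sn _) cB.
have := cB.2 _ (proper_D TB _); rewrite cT => /(_ isT) lt.
have [|B' B'D cB'] := @crit_exists G 2 (B :\: T); first lia.
have [e' _] := crit_th (ltn0Sn _) cB'.
have EB : B' = B :\: T.
  by apply/eqP; rewrite eqEcard B'D; have := gap2_card (ltnSn 1) e'; lia.
rewrite {B'}EB in cB' e' {B'D}.
(* Ten vertices with [th = 6] violate Gallai's bound, so the remainder splits into two sets of gap
   one with five vertices each. *)
case: (crit_cases (ltn0Sn _) cB') => [|]; first lia.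
case=> B1 [B2 [t1 [t2 [[E d ne e1] [t10 t20 h1 h2]]]]].
have c1 := gap1_card t10 h1; have c2 := gap1_card t20 h2.
move: cD; rewrite E card_disjU // => cD.
have c15 : #|B1| = 5 by lia.
have c25 : #|B2| = 5 by lia.
have crit1 : crit 1 B1 by apply: crit_5; lia.
have crit2 : crit 1 B2 by apply: crit_5; lia.
have [al1 th1 _] := crit1_5 crit1 c15; have [al2 th2 _] := crit1_5 crit2 c25.
have B1B : B1 \subset B by apply: subset_trans (subsetDl B T); rewrite E subsetUl.
have B2B : B2 \subset B by apply: subset_trans (subsetDl B T); rewrite E subsetUr.
have T1 x : x \in T -> x \notin B1.
  by move=> xT; apply/negP => xB; have: x \in B :\: T by [rewrite E inE xB]; rewrite inE xT.
have T2 x : x \in T -> x \notin B2.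
  by move=> xT; apply/negP => xB; have: x \in B :\: T by [rewrite E inE xB orbT]; rewrite inE xT.
(* Otherwise [x] and a stable pair of non-neighbours from each pentagon form a stable set of size
   5. *)
have dom x : x \in T -> dominates x B1 \/ dominates x B2.
  move=> xT; apply: contrapT => /not_orP[n1 n2].
  have ex C : ~ dominates x C -> exists S : {set G}, [/\ S \subset C :\: nb x, stable S & #|S| = 2].
    move=> nC; have: 2 <= al (C :\: nb x).
      by rewrite ltnNge; apply/negP => /al_le1.
    have [S SC [sS <-]] := al_attained (C :\: nb x) => /exists_subset_card[S' S'S cS'].
    by exists S'; split=> //; [exact: subset_trans SC|exact: stable_sub sS].
  have [S1 [S1s s1 cS1]] := ex _ n1; have [S2 [S2s s2 cS2]] := ex _ n2.
  have nS z S C : S \subset C :\: nb x -> z \in S -> z \in C /\ ~~ edge x z.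
    by move=> /subsetP h /h; rewrite !inE => /andP[].
  have sS : stable (S1 :|: S2).
    apply/stableP => a b /setUP[] ha /setUP[] hb.
    - by move/stableP: s1; apply.
    - by apply: ne; [case: (nS _ _ _ S1s ha)|case: (nS _ _ _ S2s hb)].
    - by rewrite edgeC; apply: ne; [case: (nS _ _ _ S1s hb)|case: (nS _ _ _ S2s ha)].
    - by move/stableP: s2; apply.
  have dS : [disjoint S1 & S2].
    apply: disjointWl (subset_trans S1s (subsetDl _ _)) _.
    by apply: disjointWr (subset_trans S2s (subsetDl _ _)) _.
  have xS : x \notin S1 :|: S2.
    rewrite inE negb_or; apply/andP; split; apply/negP => hx.
      by have [hB _] := nS _ _ _ S1s hx; have := T1 _ xT; rewrite hB.
    by have [hB _] := nS _ _ _ S2s hx; have := T2 _ xT; rewrite hB.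
  suff: #|x |: (S1 :|: S2)| <= al B by rewrite cardsU1 xS card_disjU // cS1 cS2 a4.
  apply: al_ge.
    rewrite subUset sub1set (subsetP TB) // subUset.
    rewrite (subset_trans (subset_trans S1s (subsetDl _ _)) B1B).
    by rewrite (subset_trans (subset_trans S2s (subsetDl _ _)) B2B).
  apply: stableU1 => // y /setUP[] hy; first by case: (nS _ _ _ S1s hy).
  by case: (nS _ _ _ S2s hy).
(* Two vertices of [T] dominating the same pentagon [C] keep the third one away
   from the other pentagon [C']. *)
have key C C' a b c : crit 1 C -> #|C| = 5 -> crit 1 C' -> #|C'| = 5 ->
    B = T :|: (C :|: C') -> T = [set a; b; c] -> edge a b ->
    dominates a C -> dominates b C -> {in C', forall y, ~~ edge c y}.
  move=> cC cC5 cC' cC5' EB ET eab da db y yC'; apply/negP => ecy.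
  have h3 := dominates_common cC cC5 da db eab.
  have h4 := adjacent_absorb (ltn0Sn _) cC' yC' ecy.
  have [_ tC' _] := crit1_5 cC' cC5'.
  suff: th B <= th (a |: (b |: C)) + th (c |: C') by lia.
  apply: th_cover; rewrite EB ET; apply/subsetP => u; rewrite !inE.
  by case: (u == a); case: (u == b); case: (u == c); case: (u \in C); case: (u \in C').
have BE : B = T :|: (B1 :|: B2).
  by rewrite -E; apply/setP => x; rewrite !inE; case: (boolP (x \in T)) => //= /(subsetP TB) ->.
have BE' : B = T :|: (B2 :|: B1) by rewrite setUC [B2 :|: _]setUC setUC.
have nodom C' x : crit 1 C' -> #|C'| = 5 -> {in C', forall y, ~~ edge x y} -> ~ dominates x C'.
  move=> cC' c5' nx dx; have [aC' _ _] := crit1_5 cC' c5'.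
  have EC : C' :\: nb x = C'.
    apply/setP => y; rewrite !inE; case yC: (y \in C'); rewrite ?andbF // nx //.
  move: dx; rewrite /dominates EC => /th_clique.
  by have [_] := crit1_5 cC' c5'; lia.
(* If no vertex of [T] is adjacent to [C'], gaps add: at most one on the eight vertices of [T :|: C]
   and one on [C'], short of three. *)
have contra C C' : crit 1 C -> #|C| = 5 -> crit 1 C' -> #|C'| = 5 ->
    B = T :|: (C :|: C') -> noedge C C' -> [disjoint C & C'] ->
    {in T & C', forall x y, ~~ edge x y} -> (forall x, x \in T -> x \notin C') -> False.
  move=> cC cC5 cC' cC5' EB nCC' dCC' nT TC'.
  have dj : [disjoint T :|: C & C'].
    rewrite -setI_eq0; apply/eqP/setP => u; rewrite !inE; apply/negP => /andP[/orP[uT|uC] uC'].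
      by have := TC' _ uT; rewrite uC'.
    by rewrite (disjointFr dCC' uC) in uC'.
  have nj : noedge (T :|: C) C'.
    by move=> u y /setUP[uT|uC] yC'; [apply: nT|apply: nCC'].
  have := th_noedge dj nj; have := al_noedge dj nj; rewrite -setUA -EB.
  have [aC' tC' _] := crit1_5 cC' cC5' => ea et.
  have := @th_al9 G (T :|: C); have := (leq_card_setU T C).1; lia.
have main C C' a b c : crit 1 C -> #|C| = 5 -> crit 1 C' -> #|C'| = 5 ->
    B = T :|: (C :|: C') -> noedge C C' -> [disjoint C & C'] ->
    (forall x, x \in T -> x \notin C') ->
    (forall x, x \in T -> dominates x C \/ dominates x C') ->
    T = [set a; b; c] -> a != b -> a != c -> b != c ->
    dominates a C -> dominates b C -> False.
  move=> cC cC5 cC' cC5' EB nCC' dCC' TC' dm ET nab nac nbc da db.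
  have aT : a \in T by rewrite ET !inE eqxx.
  have bT : b \in T by rewrite ET !inE eqxx orbT.
  have cT' : c \in T by rewrite ET !inE eqxx orbT.
  move/cliqueP: kT => kT.
  have nc : {in C', forall y, ~~ edge c y}.
    by apply: (key C C' a b c) => //; apply: kT.
  have dc : dominates c C.
    by case: (dm _ cT') => // /(nodom C' _ cC' cC5' nc).
  have na : {in C', forall y, ~~ edge a y}.
    apply: (key C C' b c a) => //; last by apply: kT.
    by rewrite ET; apply/setP => u; rewrite !inE; case: (u == a); case: (u == b); case: (u == c).
  have nb' : {in C', forall y, ~~ edge b y}.
    apply: (key C C' a c b) => //; last by apply: kT.
    by rewrite ET; apply/setP => u; rewrite !inE; case: (u == a); case: (u == b); case: (u == c).
  apply: (contra C C') => // x y; rewrite ET !inE => /orP[/orP[]|] /eqP -> yC'; auto.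
have [a [b [c [nab nac nbc ET]]]] := card3_ex cT.
have aT : a \in T by rewrite ET !inE eqxx.
have bT : b \in T by rewrite ET !inE eqxx orbT.
have cT' : c \in T by rewrite ET !inE eqxx orbT.
have ET1 : T = [set a; c; b] by rewrite ET setUAC.
have ET2 : T = [set b; c; a] by rewrite ET -setUA setUC.
have main1 := main B1 B2 _ _ _ crit1 c15 crit2 c25 BE ne d T2 dom.
have main2 : forall x y z, T = [set x; y; z] -> x != y -> x != z -> y != z ->
    dominates x B2 -> dominates y B2 -> False.
  move=> x y z; apply: (main B2 B1) => //.
  - by move=> u w hu hw; rewrite edgeC; apply: ne.
  - by rewrite disjoint_sym.
  - by move=> u /dom[]; [right|left].
have ncb : c != b by rewrite eq_sym.
have nba : b != a by rewrite eq_sym.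
have nca : c != a by rewrite eq_sym.
case: (dom a aT) => da; case: (dom b bT) => db.
- exact: (main1 a b c).
- case: (dom c cT') => dc; first exact: (main1 a c b).
  exact: (main2 b c a).
- case: (dom c cT') => dc; last exact: (main2 a c b).
  exact: (main1 b c a).
- exact: (main2 a b c).
Qed.

(** The parts would need 5 + 13 or 10 + 10 vertices. *)
Lemma crit4_conn B : crit 4 B -> #|B| <= 17 -> 2 * th B <= #|B|.+1.
Proof.
move=> cB c; case: (crit_cases (ltn0Sn _) cB) => //.
case=> B1 [B2 [t1 [t2 [[E d _ e1] [t10 t20 h1 h2]]]]].
have := gap1_card t10 h1; have := gap1_card t20 h2; move: c; rewrite E card_disjU // => c c1 c2.
have [t2'|[t1'|t12]] : 2 < t2 \/ (2 < t1 \/ t1 = 2 /\ t2 = 2) by lia.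
- by have := gap3_card t2' h2; lia.
- by have := gap3_card t1' h1; lia.
case: t12 => e2 e3; have := @gap2_card G B1 2; have := @gap2_card G B2 2; lia.
Qed.

Lemma crit4_al B : crit 4 B -> #|B| <= 17 -> 3 <= al B.
Proof.
move=> cB c; apply: (crit_al3 (t := 1) cB) => // A cA.
by have := @th_al12 A; lia.
Qed.

(** Gallai's bound leaves [al = 3], where a triangle leads to [th_13_3], and [al = 4] with exactly
    16 vertices, since from 15 a triangle leads to [th_al12]. *)
Lemma th_al16 A : #|A| <= 16 -> th A <= al A + 3.
Proof.
move=> cA; rewrite leqNgt; apply/negP => h.
have [|B BA cB] := @crit_exists G 4 A; first lia.
have [e m] := crit_th (ltn0Sn _) cB.
have cBA := subset_leq_card BA.
have a3 : 3 <= al B by apply: crit4_al => //; lia.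
have c : 2 * th B <= #|B|.+1 by apply: crit4_conn => //; lia.
have [a|a] : al B = 3 \/ al B = 4 by lia.
  have [|T [TB kT cT cD [tD aD]]] := @peel G 3 B; first by apply: ramsey34; lia.
  by have := @th_13_3 (B :\: T); lia.
have c16 : #|B| = 16.
  have [|T [TB kT cT cD [tD aD]]] := @peel G 3 B; first by apply: ramsey35; lia.
  by have := @th_al12 (B :\: T); lia.
have noK4 : ~ hasK 4 B.
  by case/peel=> K [KB kK cK cD [tD aD]]; have := @th_al12 (B :\: K); lia.
(* The 13 remaining vertices have gap three, hence form a critical set, which [crit_13_4_7] shows to
   be triangle-free. *)
have tf T : T \subset B -> clique T -> #|T| = 3 -> ~ hasK 3 (B :\: T).
  move=> TB kT cT.
  have := cB.2 _ (proper_D TB _); rewrite cT => /(_ isT) lt.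
  have tD := th_D B kT; have aD := al_sub (subsetDl B T).
  have [|C CD cC] := @crit_exists G 3 (B :\: T); first lia.
  have [eC _] := crit_th (ltn0Sn _) cC.
  have cD : #|B :\: T| = 13 by rewrite cardsDS // c16 cT.
  have EC : C = B :\: T.
    by apply/eqP; rewrite eqEcard CD; have := gap3_card (ltnSn 2) eC; lia.
  rewrite EC in cC; apply: crit_13_4_7 => //; lia.
have [|T [TB kT cT _ _]] := @peel G 3 B; first by apply: ramsey35; lia.
have tfT := tf _ TB kT cT.
(* Two vertices of [T] meet every triangle; the other 14 vertices contradict R(3,5). *)
have [x xT []] := triangles_meet noK4 tf TB kT cT.
apply: ramsey35; first by have := al_sub (subsetDl B (T :\ x)); lia.
rewrite cardsDS; last by apply: subset_trans TB; apply: subsetDl.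
by have := cardsD1 x T; rewrite xT cT c16; lia.
Qed.

(** For [al = 5], deleting a triangle leaves 14 vertices with [th >= 8]. A critical subset of gap
    three has 13 vertices by Gallai's bound, so one vertex is left over, against [crit_leftover]. *)
Lemma crit_17 B : crit 4 B -> #|B| = 17 -> al B = 4 \/ al B = 5 /\ ~ hasK 3 B.
Proof.
move=> cB c17; have [e m] := crit_th (ltn0Sn _) cB.
have a3 : 3 <= al B by apply: crit4_al => //; lia.
have c : 2 * th B <= #|B|.+1 by apply: crit4_conn => //; lia.
have [a|[a|a]] : al B = 3 \/ (al B = 4 \/ al B = 5) by lia.
- have [|nK] := EM (hasK 4 B); last by have := @th_17_3 G B c17 _ nK; lia.
  by case/peel=> K [KB kK cK cD [tD aD]]; have := @th_13_3 (B :\: K); lia.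
- by left.
- right; split=> // /peel[T [TB kT cT cD [tD aD]]].
  have cD' : #|B :\: T| = 14 by rewrite cD c17.
  have le := @th_al16 (B :\: T).
  have [|C CD cC] := @crit_exists G 3 (B :\: T); first lia.
  have [eC _] := crit_th (ltn0Sn _) cC; have c13 := gap3_card (ltnSn 2) eC.
  have cCD := subset_leq_card CD.
  have c2 : 2 * th C <= #|C|.+1 by apply: crit3_conn => //; lia.
  have nC : C != B :\: T by apply/eqP => E; move: c2; rewrite E cD'; lia.
  have cC13 : #|C| < #|B :\: T|.
    by rewrite ltnNge; apply: contra nC; rewrite eqEcard CD.
  have [|v E vC] := sub_card1 CD; first lia.
  by apply: (crit_leftover cB TB kT (ltn0Sn _) cC E vC); lia.
Qed.

End GapThreeFour.

(** * The Ramsey number R(3,6) *)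

Section Ramsey36.
Variable G : sgraph.
Implicit Types (x y z u v w a b : G) (A B C S K T N H X Y : {set G}).

Section Eighteen.
Variable B : {set G}.
Hypotheses (cB : #|B| = 18) (aB : al B <= 5) (ntr : ~ hasK 3 B).

Let deg45 x : x \in B -> 4 <= #|B :&: nb x| <= 5.
Proof.
move=> xB; have := leq_trans (trifree_deg ntr xB) aB; have := card_nn xB; rewrite cB.
have [h|h] := leqP 14 #|nn x B|; last by move: h; clear; lia.
case: ntr; apply: hasK_sub (subsetDl _ _) _; apply: ramsey35 h; exact: al_nn.
Qed.

(** [X] is stable by itself, lying in a neighbourhood. The contradictions below come from sets [X]
    and [Y] with six vertices together. *)
Let NH_noedge x X Y : x \in B -> X \subset B :&: nb x -> Y \subset nn x B ->
  stable Y -> noedge X Y -> #|X| + #|Y| <= 5.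
Proof.
move=> xB XN YH sY ne; apply: leq_trans aB.
have d : [disjoint X & Y].
  rewrite -setI_eq0; apply/eqP/setP => u; rewrite in_setI in_set0; apply/negP => /andP[uX uY].
  have := subsetP XN _ uX; have := subsetP YH _ uY.
  by rewrite !inE => /andP[/norP[_ /negPf ->]]; rewrite andbF.
rewrite -(card_disjU d); apply: al_ge.
  rewrite subUset (subset_trans XN (subsetIl _ _)).
  exact: subset_trans YH (subsetDl _ _).
by apply: stableU => //; apply: stable_sub XN _; apply: trifree_stable.
Qed.

Let nbB_stable a Y : a \in B -> Y \subset B -> {in Y, forall w, edge a w} -> stable Y.
Proof.
move=> aB' YB h; apply: stable_sub (trifree_stable ntr aB').
by apply/subsetP => w wY; rewrite !inE (subsetP YB) // h.
Qed.

Let NN0 x a : x \in B -> a \in B :&: nb x -> #|B :&: nb x :&: nb a| = 0.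
Proof.
move=> xB aN; apply/eqP; rewrite cards_eq0; apply/eqP/setP => b; rewrite inE in_set0.
apply/negP => /andP[bN]; rewrite inE; apply/negP.
by move/stableP: (trifree_stable ntr xB); apply.
Qed.

(** The non-neighbours of [x] have stability number at most 4, so R(3,4) allows [w] at most 8
    non-neighbours among them. *)
Let Hdeg x w : x \in B -> w \in nn x B ->
  #|nn x B| <= (#|nn x B :&: nb w| + 8).+1 /\ #|nn x B :&: nb w| <= 4.
Proof.
move=> xB wH; have aH : al (nn x B) <= 4 by apply: al_nn.
have nH : ~ hasK 3 (nn x B) by apply: contra_not ntr; apply: hasK_sub; apply: subsetDl.
split; last exact: leq_trans (trifree_deg nH wH) aH.
have := card_nn wH; have [h|h] := leqP 9 #|nn w (nn x B)|; last by move: h; clear; lia.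
case: nH; apply: hasK_sub (subsetDl _ _) _; apply: ramsey34 h; exact: al_nn.
Qed.

(** If [x] had degree 4, each of its 13 non-neighbours would have at most one neighbour in [N]. Then
    at least three neighbours of [a] in [H] and the three other vertices of [N] would be stable. *)
Let deg5 x : x \in B -> #|B :&: nb x| = 5.
Proof.
move=> xB; apply/eqP; rewrite eqn_leq; case/andP: (deg45 xB) => d4 -> /=.
rewrite leqNgt; apply/negP => d5; have cN : #|B :&: nb x| = 4 by move: d4 d5; clear; lia.
set N := B :&: nb x in cN; set H := nn x B.
have cH : #|H| = 13 by have := card_nn xB; rewrite cB -/N cN -/H; clear; lia.
have tH w : w \in H -> #|N :&: nb w| <= 1.
  move=> wH; have [] := Hdeg xB wH; rewrite -/H cH => h1 h2.
  have wB : w \in B by apply: (subsetP (subsetDl B (x |: nb x))).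
  have := card_nb_split w xB; have := deg45 wB; rewrite -/N -/H; move: h1; clear; lia.
have [a aN] : exists a, a \in N by apply/card_gt0P; rewrite cN.
have aB' : a \in B by case/setIP: aN.
have cA : 3 <= #|H :&: nb a|.
  have := card_nb_split a xB; rewrite (NN0 xB aN) -/H; have := deg45 aB'.
  by case: edge; clear; lia.
have := @NH_noedge x (N :\ a) (H :&: nb a) xB (subsetDl _ _) (subsetIl _ _).
have := cardsD1 a N; rewrite aN cN => cNa h.
suff: #|N :\ a| + #|H :&: nb a| <= 5 by move: cNa cA; clear; lia.
apply: h.
  apply: (nbB_stable aB'); last by move=> w; rewrite !inE => /andP[].
  by apply: subset_trans (subsetIl _ _) (subsetDl _ _).
move=> b w /setD1P[nba bN] /setIP[wH aw]; apply/negP => bw.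
have := tH w wH; rewrite leqNgt => /negP; apply; apply/card_gt1P; exists a, b.
rewrite ![_ \in N :&: _]in_setI aN bN !in_nb ![edge w _]edgeC bw eq_sym nba.
by move: aw; rewrite in_nb => ->.
Qed.

(** * Traces of the non-neighbours of a vertex on its neighbourhood *)

Section Star.
Variable x : G.
Hypothesis xB : x \in B.
Let N := B :&: nb x.
Let H := nn x B.
Let tau w := N :&: nb w.

Let cN : #|N| = 5. Proof. exact: deg5. Qed.
Let cH : #|H| = 12. Proof. by have := card_nn xB; rewrite cB -/N cN -/H; clear; lia. Qed.
Let HB : H \subset B. Proof. exact: subsetDl. Qed.

Let in_tau a w : (a \in tau w) = (a \in N) && edge a w.
Proof. by rewrite in_setI in_nb edgeC. Qed.

Let tau12 w : w \in H -> #|tau w| = 1 \/ #|tau w| = 2.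
Proof.
move=> wH; have [] := Hdeg xB wH; rewrite -/H cH => h1 h2.
have := card_nb_split w xB; rewrite (deg5 (subsetP HB _ wH)) -/N -/H -/(tau w).
have -> : edge x w = false.
  by move: wH; rewrite /H /nn !inE negb_or => /andP[/andP[_ /negPf]].
by move: h1 h2; clear; lia.
Qed.

Let HA a : a \in N -> #|H :&: nb a| = 4.
Proof.
move=> aN; have aB' : a \in B by case/setIP: aN.
have := card_nb_split a xB; rewrite (NN0 xB aN) -/H deg5 //.
by have -> : edge x a; [case/setIP: aN; rewrite inE|clear; lia].
Qed.

Let H1 := [set w in H | #|tau w| == 1].

(** Five vertices of [N] send 20 edges to the 12 vertices of [H], each of which receives one or
    two. *)
Let cH1 : #|H1| = 4.
Proof.
have : \sum_(w in H) #|tau w| = 20.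
  rewrite /tau -exchange_card (eq_bigr (fun=> 4)) //.
  by rewrite sum_nat_const cN.
have : \sum_(w in H) (#|tau w| + (#|tau w| == 1)) = \sum_(w in H) 2.
  by apply: eq_bigr => w /tau12[] ->.
rewrite big_split /= sum_nat_const cH => e1 e2.
have : \sum_(w in H) (#|tau w| == 1 : nat) = #|H1|.
  rewrite -sum1_card big_mkcond [RHS]big_mkcond /=; apply: eq_bigr => w _.
  by rewrite [w \in H1]in_set; case: (w \in H) => //=; case: eqP.
by move: e1 e2; clear; lia.
Qed.

(** Two private neighbours of [a] would be stable together with the four other vertices of [N]. *)
Let priv_le1 a u v : a \in N -> u \in H -> v \in H ->
  tau u = [set a] -> tau v = [set a] -> u = v.
Proof.
move=> aN uH vH tu tv; apply/eqP/negPn/negP => nuv.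
have aB' : a \in B by case/setIP: aN.
have au : edge a u by have : a \in tau u; [rewrite tu set11|rewrite in_tau => /andP[]].
have av : edge a v by have : a \in tau v; [rewrite tv set11|rewrite in_tau => /andP[]].
have := @NH_noedge x (N :\ a) [set u; v] xB (subsetDl _ _).
rewrite cards2 nuv; have := cardsD1 a N; rewrite aN cN => e h.
suff: #|N :\ a| + 2 <= 5 by move: e; clear; lia.
apply: h.
- by rewrite subUset !sub1set uH vH.
- apply: (nbB_stable aB'); first by rewrite subUset !sub1set !(subsetP HB).
  by move=> w /set2P[] ->.
move=> b w /setD1P[nba bN] wuv; apply/negP => bw.
have : b \in tau w by rewrite in_tau bN.
by case/set2P: wuv => ->; rewrite ?tu ?tv inE (negPf nba).
Qed.

(** [p], [u], [v] are neighbours of [a], hence stable, and see none of the three vertices of [N]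
    other than [a] and [b]. *)
Let D_le1 a b p u v : a \in N -> b \in N -> a != b -> p \in H -> u \in H -> v \in H ->
  tau p = [set a] -> tau u = [set a; b] -> tau v = [set a; b] -> u = v.
Proof.
move=> aN bN nab pH uH vH tp tu tv; apply/eqP/negPn/negP => nuv.
have aB' : a \in B by case/setIP: aN.
have ea w : a \in tau w -> edge a w by rewrite in_tau => /andP[].
have ap : edge a p by apply: ea; rewrite tp set11.
have au : edge a u by apply: ea; rewrite tu !inE eqxx.
have av : edge a v by apply: ea; rewrite tv !inE eqxx.
have np w : tau w = [set a; b] -> p != w.
  move=> tw; apply: contraNneq nab => e; have : b \in tau p by rewrite e tw !inE eqxx orbT.
  by rewrite tp inE eq_sym.
have := @NH_noedge x (N :\ a :\ b) (p |: [set u; v]) xB.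
have -> : #|p |: [set u; v]| = 3.
  by rewrite cardsU1 cards2 nuv !inE negb_or !np.
have e : #|N :\ a :\ b| = 3.
  have := cardsD1 b (N :\ a); have := cardsD1 a N; rewrite aN cN in_setD1 bN eq_sym nab.
  by clear; lia.
rewrite e => h; suff: 3 + 3 <= 5 by []; apply: h.
- by apply: subset_trans (subsetDl _ _) (subsetDl _ _).
- by rewrite !subUset !sub1set uH vH pH.
- apply: (nbB_stable aB'); first by rewrite !subUset !sub1set !(subsetP HB).
  by move=> w; rewrite !inE => /or3P[] /eqP ->.
move=> c w /setD1P[ncb /setD1P[nca cN']] ww; apply/negP => cw.
have : c \in tau w by rewrite in_tau cN'.
by case/setU1P: ww => [->|/set2P[] ->]; rewrite ?tp ?tu ?tv !inE ?(negPf nca) ?(negPf ncb).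
Qed.

Let the w := odflt x [pick a in tau w].

Let theP w : w \in H1 -> tau w = [set the w] /\ the w \in N.
Proof.
rewrite inE => /andP[wH /cards1P[a e]]; rewrite /the; case: pickP => [b|/(_ a)].
  by rewrite e inE => /eqP ->; split=> //; have : a \in tau w; [rewrite e set11|case/setIP].
by rewrite e inE eqxx.
Qed.

Let img := the @: H1.

Let cimg : #|img| = 4.
Proof.
rewrite card_in_imset ?cH1 // => u v uH vH e.
have [tu uN] := theP uH; have [tv vN] := theP vH.
apply: (priv_le1 uN) => //; last by rewrite e.
  by move: uH; rewrite inE => /andP[].
by move: vH; rewrite inE => /andP[].
Qed.

Let special : exists e, [/\ e \in N, (forall p, p \in H -> tau p <> [set e]) &
  forall a, a \in N -> a != e -> exists2 p, p \in H & tau p = [set a]].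
Proof.
have sub : img \subset N by apply/subsetP => _ /imsetP[w /theP[_ ?] ->].
have : #|N :\: img| == 1 by rewrite cardsDS // cN cimg.
case/cards1P=> e E; have : e \in N :\: img by rewrite E set11.
case/setDP=> eN ei; exists e; split=> //.
  move=> p pH tp; have pH1 : p \in H1 by rewrite in_set pH tp cards1.
  have [tp' _] := theP pH1; have : e \in tau p by rewrite tp set11.
  by rewrite tp' in_set1 => /eqP e'; rewrite e' imset_f in ei.
move=> a aN nae; have : a \in img.
  apply/negPn/negP => ai; have : a \in N :\: img by rewrite in_setD ai.
  by rewrite E in_set1 (negPf nae).
by case/imsetP=> w wH ->; exists w; [move: wH; rewrite in_set => /andP[]|case: (theP wH)].
Qed.

Let oth a w := odflt x [pick b in tau w :\ a].

Let othP a w : w \in H -> a \in tau w -> tau w != [set a] ->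
  [/\ tau w = [set a; oth a w], oth a w \in N & oth a w != a].
Proof.
move=> wH aw nw; case: (tau12 wH) => c.
  by move/eqP/cards1P: c => [b e]; move: aw nw; rewrite e inE => /eqP ->; rewrite eqxx.
have /cards1P[b E] : #|tau w :\ a| == 1 by move: c; rewrite (cardsD1 a) aw add1n => -[->].
have -> : oth a w = b.
  rewrite /oth; case: pickP => [d|/(_ b)]; last by rewrite E inE eqxx.
  by rewrite E inE => /eqP ->.
have : b \in tau w :\ a by rewrite E set11.
case/setD1P=> nba /setIP[bN _]; split=> //.
by rewrite -(setD1K aw) E.
Qed.

(* Every neighbour of [x] other than the exceptional one [e] has a private
   neighbour, hence shares at most one vertex of [H] with each other neighbour. *)
Let partners e a : (forall p, p \in H -> tau p <> [set e]) ->
  (forall a, a \in N -> a != e -> exists2 p, p \in H & tau p = [set a]) -> a \in N ->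
  exists Q : {set G}, [/\ Q \subset N :\ a, 3 + (a == e) <= #|Q| &
    forall b, b \in Q -> exists2 w, w \in H & tau w = [set a; b]].
Proof.
move=> nopriv priv aN.
pose A := [set w in H :&: nb a | tau w != [set a]].
have AP w : w \in A -> [/\ w \in H, a \in tau w & tau w != [set a]].
  rewrite in_set => /andP[/setIP[wH aw] nw]; split=> //.
  by rewrite in_tau aN; rewrite in_nb in aw.
exists (oth a @: A); split.
- apply/subsetP => _ /imsetP[w /AP[wH aw nw] ->].
  by have [_ oN no] := othP wH aw nw; rewrite in_setD1 no.
- rewrite card_in_imset; last first.
    move=> u v /AP[uH au nu] /AP[vH av nv] E.
    have [tu oN no] := othP uH au nu; have [tv _ _] := othP vH av nv.
    have [ea|nae] := eqVneq a e.
      have [|p pH tp] := priv _ oN; first by rewrite -ea.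
      apply: (D_le1 oN aN no pH uH vH tp); first by rewrite {1}tu setUC.
      by rewrite E {1}tv setUC.
    have [p pH tp] := priv a aN nae.
    by apply: (D_le1 aN oN _ pH uH vH tp tu); rewrite 1?eq_sym // E.
  have := cardsID [set w | tau w != [set a]] (H :&: nb a); rewrite (HA aN).
  have -> : H :&: nb a :&: [set w | tau w != [set a]] = A.
    by apply/setP => w; rewrite in_setI ![_ \in [set _ | _]]in_set.
  set Z := _ :\: _ => c.
  have ZP w : w \in Z -> w \in H /\ tau w = [set a].
    by rewrite in_setD in_set negbK in_setI => /andP[/eqP tw /andP[wH _]].
  have cZ : #|Z| <= 1.
    rewrite leqNgt; apply/negP => /card_gt1P[u [v [/ZP[uH tu] /ZP[vH tv]]]].
    by rewrite (priv_le1 aN uH vH tu tv) eqxx.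
  have [ea|nae] := eqVneq a e; last by move: c cZ; clear; lia.
  have : #|Z| = 0.
    apply/eqP; rewrite cards_eq0 -subset0; apply/subsetP => w /ZP[wH tw].
    by case: (nopriv w wH); rewrite -ea.
  by move: c; clear; lia.
by move=> _ /imsetP[w /AP[wH aw nw] ->]; exists w => //; have [] := othP wH aw nw.
Qed.

(** Distinctness of the [ys] is read off from their traces on [zs], so no separate comparison of
    these vertices is called for. *)
Let key (xs ys zs : seq G) : uniq xs -> {subset xs <= N} -> {subset ys <= H} ->
  uniq [seq [seq a \in tau w | a <- zs] | w <- ys] ->
  pairwise (fun u v => ~~ edge u v) ys ->
  all (fun y => all (fun a => a \notin tau y) xs) ys -> size xs + size ys <= 5.
Proof.
move=> ux xN yH /map_uniq uy pw /allP nt.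
have := @NH_noedge x [set a in xs] [set w in ys] xB.
rewrite !cardsE; move/card_uniqP: ux => ->; move/card_uniqP: (uy) => ->; apply.
- by apply/subsetP => a; rewrite in_set; apply: xN.
- by apply/subsetP => w; rewrite in_set; apply: yH.
- apply/stableP => u v; rewrite !in_set => uy' vy.
  elim: ys pw uy' vy {yH uy nt} => [|w ys IH] //= /andP[/allP h /IH {}IH].
  rewrite !in_cons => /predU1P[->|uy] /predU1P[->|vy].
  + by rewrite edge_irr.
  + exact: h.
  + by rewrite edgeC; apply: h.
  + exact: IH.
move=> a w; rewrite !in_set => ax wy; have /allP/(_ a ax) := nt w wy.
by rewrite in_tau xN.
Qed.

(** The traces of size two form a wheel with hub [e] and a rim of length four. Around the rim vertex
    [a2], stable sets of size 6 can be avoided only if [p2] is adjacent to [p1], [p3], [d1] and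
    [d3]; these are then stable, also together with [a2] and [a4]. *)
Lemma star_false : False.
Proof.
have [e [eN nopriv priv]] := special.
have [a2 a2N n2e] : exists2 a, a \in N & a != e.
  have : 0 < #|N :\ e| by have := cardsD1 e N; rewrite eN cN; clear; lia.
  by case/card_gt0P=> a /setD1P[? ?]; exists a.
have [Qe [QeN cQe dQe]] := partners nopriv priv eN; rewrite eqxx in cQe.
have QeE : Qe = N :\ e.
  by apply/eqP; rewrite eqEcard QeN; have := cardsD1 e N; rewrite eN cN; move: cQe; clear; lia.
have De a : a \in N -> a != e -> exists2 w, w \in H & tau w = [set e; a].
  by move=> aN nae; apply: dQe; rewrite QeE in_setD1 nae.
have [Q [QN cQ dQ]] := partners nopriv priv a2N; rewrite (negPf n2e) in cQ.
have : 1 < #|Q :\ e|.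
  by have := cardsD1 e Q; case: (e \in Q); move: cQ; clear; lia.
case/card_gt1P=> a1 [a3 [/setD1P[n1e a1Q] /setD1P[n3e a3Q] n13]].
have /setD1P[n12 a1N] := subsetP QN _ a1Q; have /setD1P[n32 a3N] := subsetP QN _ a3Q.
have [a4 a4N] : exists a, a \in N :\: [set e; a1; a2; a3].
  apply/card_gt0P; rewrite cardsDS; last by rewrite !subUset !sub1set eN a1N a2N a3N.
  rewrite cN subn_gt0; apply: leq_ltn_trans (leq_card_setU _ _) _; rewrite cards1.
  rewrite addn1 !ltnS; apply: leq_trans (leq_card_setU _ _) _.
  by rewrite cards1 cards2; case: (_ != _).
move: a4N; rewrite in_setD !in_setU !in_set1 !negb_or -!andbA => /and5P[n4e n41 n42 n43 a4N].
have [p1 p1H tp1] := priv _ a1N n1e; have [p2 p2H tp2] := priv _ a2N n2e.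
have [p3 p3H tp3] := priv _ a3N n3e.
have [d12 d12H td12] := dQ _ a1Q; have [d23 d23H td23] := dQ _ a3Q.
have [d1 d1H td1] := De _ a1N n1e; have [d2 d2H td2] := De _ a2N n2e.
have [d3 d3H td3] := De _ a3N n3e.
have taus := (tp1, tp2, tp3, td12, td23, td1, td2, td3).
have neq u v : u != v -> ((u == v) = false) * ((v == u) = false).
  by move=> n; split; [|rewrite eq_sym]; apply: negbTE.
have neqs := (neq _ _ n1e, neq _ _ n2e, neq _ _ n3e, neq _ _ n4e, neq _ _ n12,
  neq _ _ n13, neq _ _ n32, neq _ _ n41, neq _ _ n42, neq _ _ n43).
have share a u v : u \in H -> v \in H -> a \in tau u -> a \in tau v -> ~~ edge u v.
  move=> uH vH; rewrite !in_tau => /andP[aN au] /andP[_ av]; apply/negP => uv.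
  by apply: ntr; apply: (hasK3 _ (subsetP HB _ uH) (subsetP HB _ vH) au av uv); case/setIP: aN.
have tri u v w : u \in H -> v \in H -> w \in H -> edge u v -> edge v w -> ~~ edge u w.
  move=> uH vH wH uv vw; apply/negP => uw; apply: ntr.
  by apply: (hasK3 (subsetP HB _ uH) (subsetP HB _ vH) (subsetP HB _ wH) uv uw vw).
pose zs := [:: a1; a2; a3; a4; e].
have inN s : all (fun a => a \in zs) s -> {subset s <= N}.
  move=> /allP h a /h; rewrite !in_cons in_nil orbF.
  by do 4!(case/predU1P=> [->//|]); move/eqP ->.
have inH s : all (fun w => w \in [:: p1; p2; p3; d12; d23; d1; d2; d3]) s -> {subset s <= H}.
  move=> /allP h a /h; rewrite !in_cons in_nil orbF.
  by do 7!(case/predU1P=> [->//|]); move/eqP ->.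
have n_p1_d12 : ~~ edge p1 d12 by apply: (share a1); rewrite // taus !inE ?eqxx ?orbT.
have n_p2_d12 : ~~ edge p2 d12 by apply: (share a2); rewrite // taus !inE ?eqxx ?orbT.
have n_p2_d23 : ~~ edge p2 d23 by apply: (share a2); rewrite // taus !inE ?eqxx ?orbT.
have n_p3_d23 : ~~ edge p3 d23 by apply: (share a3); rewrite // taus !inE ?eqxx ?orbT.
have n_p2_d2 : ~~ edge p2 d2 by apply: (share a2); rewrite // taus !inE ?eqxx ?orbT.
have n_d12_d1 : ~~ edge d12 d1 by apply: (share a1); rewrite // taus !inE ?eqxx ?orbT.
have n_d12_d2 : ~~ edge d12 d2 by apply: (share a2); rewrite // taus !inE ?eqxx ?orbT.
have n_d1_d2 : ~~ edge d1 d2 by apply: (share e); rewrite // taus !inE ?eqxx ?orbT.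
have n_d23_d2 : ~~ edge d23 d2 by apply: (share a2); rewrite // taus !inE ?eqxx ?orbT.
have n_d23_d3 : ~~ edge d23 d3 by apply: (share a3); rewrite // taus !inE ?eqxx ?orbT.
have n_d2_d3 : ~~ edge d2 d3 by apply: (share e); rewrite // taus !inE ?eqxx ?orbT.
have n_p1_d1 : ~~ edge p1 d1 by apply: (share a1); rewrite // taus !inE ?eqxx ?orbT.
have n_p3_d3 : ~~ edge p3 d3 by apply: (share a3); rewrite // taus !inE ?eqxx ?orbT.
have n_d1_d3 : ~~ edge d1 d3 by apply: (share e); rewrite // taus !inE ?eqxx ?orbT.
(* Otherwise [p1], [p2], [d12] and [a3], [a4], [e] are stable. The next three edges arise in the
   same way. *)
have e12 : edge p1 p2.
  apply/negPn/negP => n; suff: 3 + 3 <= 5 by [].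
  apply: (key (xs := [:: a3; a4; e]) (ys := [:: p1; p2; d12]) (zs := zs)).
  - by rewrite /= !inE ?neqs.
  - by apply: inN; rewrite /= !inE ?eqxx ?orbT.
  - by apply: inH; rewrite /= !inE ?eqxx ?orbT.
  - by rewrite /= !taus !inE ?eqxx ?neqs.
  - by rewrite /= n n_p1_d12 n_p2_d12.
  - by rewrite /= !taus !inE ?eqxx ?neqs.
have e23 : edge p2 p3.
  apply/negPn/negP => n; suff: 3 + 3 <= 5 by [].
  apply: (key (xs := [:: a1; a4; e]) (ys := [:: p2; p3; d23]) (zs := zs)).
  - by rewrite /= !inE ?neqs.
  - by apply: inN; rewrite /= !inE ?eqxx ?orbT.
  - by apply: inH; rewrite /= !inE ?eqxx ?orbT.
  - by rewrite /= !taus !inE ?eqxx ?neqs.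
  - by rewrite /= n n_p2_d23 n_p3_d23.
  - by rewrite /= !taus !inE ?eqxx ?neqs.
have e21 : edge p2 d1.
  apply/negPn/negP => n; suff: 2 + 4 <= 5 by [].
  apply: (key (xs := [:: a3; a4]) (ys := [:: p2; d12; d1; d2]) (zs := zs)).
  - by rewrite /= !inE ?neqs.
  - by apply: inN; rewrite /= !inE ?eqxx ?orbT.
  - by apply: inH; rewrite /= !inE ?eqxx ?orbT.
  - by rewrite /= !taus !inE ?eqxx ?neqs.
  - by rewrite /= n_p2_d12 n n_p2_d2 n_d12_d1 n_d12_d2 n_d1_d2.
  - by rewrite /= !taus !inE ?eqxx ?neqs.
have e2d3 : edge p2 d3.
  apply/negPn/negP => n; suff: 2 + 4 <= 5 by [].
  apply: (key (xs := [:: a1; a4]) (ys := [:: p2; d23; d2; d3]) (zs := zs)).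
  - by rewrite /= !inE ?neqs.
  - by apply: inN; rewrite /= !inE ?eqxx ?orbT.
  - by apply: inH; rewrite /= !inE ?eqxx ?orbT.
  - by rewrite /= !taus !inE ?eqxx ?neqs.
  - by rewrite /= n_p2_d23 n_p2_d2 n n_d23_d2 n_d23_d3 n_d2_d3.
  - by rewrite /= !taus !inE ?eqxx ?neqs.
have e32 : edge p3 p2 by rewrite edgeC.
have n_p1_p3 := tri _ _ _ p1H p2H p3H e12 e23.
have n_p1_d3 := tri _ _ _ p1H p2H d3H e12 e2d3.
have n_p3_d1 := tri _ _ _ p3H p2H d1H e32 e21.
suff: 2 + 4 <= 5 by [].
apply: (key (xs := [:: a2; a4]) (ys := [:: p1; p3; d1; d3]) (zs := zs)).
- by rewrite /= !inE ?neqs.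
- by apply: inN; rewrite /= !inE ?eqxx ?orbT.
- by apply: inH; rewrite /= !inE ?eqxx ?orbT.
- by rewrite /= !taus !inE ?eqxx ?neqs.
- by rewrite /= n_p1_p3 n_p1_d1 n_p1_d3 n_p3_d1 n_p3_d3 n_d1_d3.
- by rewrite /= !taus !inE ?eqxx ?neqs.
Qed.

End Star.
End Eighteen.

Lemma ramsey36 A : al A <= 5 -> 18 <= #|A| -> hasK 3 A.
Proof.
move=> aA /exists_subset_card[B BA cB]; apply: (hasK_sub BA); apply: contrapT => ntr.
have aB : al B <= 5 by apply: leq_trans aA; apply: al_sub.
have [x xB] : exists x, x \in B by apply/card_gt0P; rewrite cB.
exact: (star_false cB aB ntr xB).
Qed.

End Ramsey36.

(** * A Ramsey graph on seventeen vertices *)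

(* Found by a computer search among the graphs invariant under the permutation
   (0 1 2 3)(4 5 6 7)(8 9 10 11)(12 13 14 15). *)
Definition witness_nbrs : seq (seq nat) :=
  [:: [:: 7; 11; 12; 14; 15]; [:: 4; 8; 12; 13; 15]; [:: 5; 9; 12; 13; 14];
      [:: 6; 10; 13; 14; 15]; [:: 1; 6; 9; 10; 14]; [:: 2; 7; 10; 11; 15];
      [:: 3; 4; 8; 11; 12]; [:: 0; 5; 8; 9; 13]; [:: 1; 6; 7; 14; 16];
      [:: 2; 4; 7; 15; 16]; [:: 3; 4; 5; 12; 16]; [:: 0; 5; 6; 13; 16];
      [:: 0; 1; 2; 6; 10]; [:: 1; 2; 3; 7; 11]; [:: 0; 2; 3; 4; 8];
      [:: 0; 1; 3; 5; 9]; [:: 8; 9; 10; 11]].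

Definition witness_adj : rel nat := fun i j => j \in nth [::] witness_nbrs i.

Definition witness_edge : rel 'I_17 := fun i j => witness_adj i j.

Lemma forall_ord n (p : pred nat) : all p (iota 0 n) -> forall i : 'I_n, p i.
Proof. by move=> /allP h i; apply: h; rewrite mem_iota ltn_ord. Qed.

Lemma witness_sym : symmetric witness_edge.
Proof.
move=> i j; apply/eqP; have : all (fun i => all (fun j =>
  witness_adj i j == witness_adj j i) (iota 0 17)) (iota 0 17) by vm_compute.
by move/forall_ord/(_ i)/forall_ord/(_ j).
Qed.

Lemma witness_irr : irreflexive witness_edge.
Proof.
move=> i; apply/negbTE; have : all (fun i => ~~ witness_adj i i) (iota 0 17) by vm_compute.
by move/forall_ord/(_ i).
Qed.

Definition witness : sgraph := SGraph witness_sym witness_irr.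

(** A pruned search, filtering the candidates after each choice, keeps the verification within reach
    of computation. *)
Fixpoint has_pairwise (r : rel nat) k (s : seq nat) : bool :=
  if k is k'.+1 then
    (fix go s := if s is i :: s' then
       has_pairwise r k' (filter (r i) s') || go s' else false) s
  else true.

Lemma has_pairwiseP r k s t :
  subseq t s -> size t = k -> pairwise r t -> has_pairwise r k s.
Proof.
elim: k s t => [|k IH] s t //; elim: s t => [|i s IHs] [|j t] //= ts [st] /andP[rj pt].
case: (eqVneq j i) ts => [ji|_] ts; last first.
  by apply/orP; right; apply: (IHs (j :: t)); rewrite //= ?st ?rj.
by rewrite (IH _ t) // subseq_filter ts andbT -ji.
Qed.

Lemma witness_pairwise (r : rel nat) k (A : {set 'I_17}) : #|A| = k ->
  {in A &, forall i j : 'I_17, i < j -> r i j} -> has_pairwise r k (iota 0 17).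
Proof.
move=> cA rA; have sA : subseq (enum A) (enum 'I_17).
  by rewrite (enumT 'I_17); apply: filter_subseq.
apply: (has_pairwiseP (t := [seq val i | i <- enum A])).
- by rewrite -val_enum_ord; apply: map_subseq.
- by rewrite size_map -cardE.
have : pairwise (fun i j : 'I_17 => i < j) (enum A).
  apply: subseq_pairwise sA _.
  rewrite -(pairwise_map val (fun i j => i < j)) val_enum_ord -sorted_pairwise.
    exact: iota_ltn_sorted.
  exact: ltn_trans.
rewrite pairwise_map; apply: (sub_in_pairwise (P := mem A)).
  by move=> i j iA jA; apply: rA.
by apply/allP => i; rewrite mem_enum.
Qed.

Lemma witness_card : #|witness| = 17.
Proof. exact: card_ord. Qed.

Lemma witness_triangle_free : triangle_free witness.
Proof.
move=> A /cliqueP kA cA; suff : has_pairwise witness_adj 3 (iota 0 17) by vm_compute.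
apply: (witness_pairwise cA) => i j iA jA lt; apply: kA => //.
by apply: contraTneq lt => ->; rewrite ltnn.
Qed.

Lemma witness_stable_free : stable_free 6 witness.
Proof.
move=> A /stableP sA cA.
suff : has_pairwise (fun i j => ~~ witness_adj i j) 6 (iota 0 17) by vm_compute.
by apply: (witness_pairwise cA) => i j iA jA _; apply: sA.
Qed.

(** * Graphs of gap four on seventeen vertices *)

Section Gap.
Variable G : sgraph.

Lemma triangle_freeE : triangle_free G <-> ~ hasK 3 [set: G].
Proof.
split=> [h [K _ [kK cK]]|h K kK cK]; first exact: h kK cK.
by apply: h; exists K => //; apply: subsetT.
Qed.

Lemma stable_free_al l : stable_free l.+1 G <-> al [set: G] <= l.
Proof.
split=> [h|/al_leP h S sS cS].
  apply/al_leP => S _ sS; rewrite leqNgt; apply/negP => /exists_subset_card[S' S'S].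
  by apply: h; apply: stable_sub sS.
by have := h S (subsetT _) sS; rewrite cS ltnn.
Qed.

Lemma gapE t : 0 < t -> gap G = t <-> th [set: G] = al [set: G] + t.
Proof. by move=> t0; rewrite /gap thetaE alphaE; lia. Qed.

Lemma gap4_order : gap G = 4 -> 17 <= #|G|.
Proof.
move=> /gapE -/(_ isT) e; rewrite -cardsT leqNgt; apply/negP; rewrite ltnS => /th_al16; lia.
Qed.

Lemma triangle_free_stable_free_order :
  triangle_free G -> stable_free 6 G -> #|G| <= 17.
Proof.
move=> /triangle_freeE t /stable_free_al a; rewrite leqNgt -cardsT; apply/negP => h.
exact: t (ramsey36 a h).
Qed.

(** Cliques of size at most two give [th >= 9], so the gap is at least 4. It is at most 4 because
    deleting a vertex leaves 16 vertices, of gap at most 3. *)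
Lemma ramsey_gap : triangle_free G -> stable_free 6 G -> #|G| = 17 -> gap G = 4.
Proof.
move=> /triangle_freeE t /stable_free_al a; rewrite -cardsT => c.
have : #|[set: G]| <= 2 * th [set: G].
  apply: card_le_th => K KT kK; rewrite leqNgt; apply/negP => h.
  by apply: t; apply: clique_hasK kK h.
rewrite c => c2; apply/gapE => //.
have [x _] : exists x, x \in [set: G] by apply/card_gt0P; rewrite c.
have := th_D1 [set: G] x; have := al_sub (subsetDl [set: G] [set x]).
have := @th_al16 G ([set: G] :\ x); have := cardsD1 x [set: G]; rewrite c in_setT; lia.
Qed.

(** The whole vertex set is critical, as proper subsets have at most 16 vertices. *)
Lemma gap4_17 : gap G = 4 -> #|G| = 17 ->
  al [set: G] = 4 /\ th [set: G] = 8 \/ al [set: G] = 5 /\ triangle_free G.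
Proof.
move=> /gapE -/(_ isT) e; rewrite -cardsT => c.
have cr : crit 4 [set: G].
  split=> [|B /proper_card]; first by rewrite e.
  by rewrite c ltnS => /th_al16; lia.
have [a|[a t]] := crit_17 cr c; [left|right]; first by rewrite e a.
by split=> //; apply/triangle_freeE.
Qed.

End Gap.

Lemma s4 : s 4 = 17.
Proof.
rewrite /s; case: ex_minnP => m /asboolP[G [g <-]] min.
apply/eqP; rewrite eqn_leq gap4_order // andbT min //; apply/asboolP; exists witness.
split; last exact: witness_card.
exact: ramsey_gap witness_triangle_free witness_stable_free witness_card.
Qed.

Lemma s24 : s2 4 = 17.
Proof.
rewrite /s2; case: ex_minnP => m /asboolP[G [_ g <-]] min.
apply/eqP; rewrite eqn_leq gap4_order // andbT min //; apply/asboolP; exists witness.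
split; [exact: witness_triangle_free| |exact: witness_card].
exact: ramsey_gap witness_triangle_free witness_stable_free witness_card.
Qed.

(** The witness forces a graph of maximum order to reach 17 vertices. *)
Lemma ramsey_graphP (G : sgraph) :
  ramsey_graph 3 6 G <-> [/\ triangle_free G, stable_free 6 G & #|G| = 17].
Proof.
split=> [[t st mx]|[t st c]]; split=> //; last first.
  by move=> H tH sH; rewrite c triangle_free_stable_free_order.
apply/eqP; rewrite eqn_leq triangle_free_stable_free_order //=.
by have := mx _ witness_triangle_free witness_stable_free; rewrite witness_card.
Qed.

Theorem theorem5p5 :
  (forall G : sgraph, ramsey_graph 3 6 G -> extremal 4 G) /\
  (s 4 = 17 /\ s2 4 = 17) /\
  (forall G : sgraph, extremal 4 G /\ triangle_free G <-> ramsey_graph 3 6 G) /\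
  (forall G : sgraph, extremal 4 G -> ~ ramsey_graph 3 6 G ->
     alpha G = 4 /\ theta G = 8).
Proof.
have ext (G : sgraph) : ramsey_graph 3 6 G -> extremal 4 G.
  by move=> /ramsey_graphP[t st c]; split; [exact: ramsey_gap|rewrite s4].
have tri (G : sgraph) : extremal 4 G -> triangle_free G -> ramsey_graph 3 6 G.
  move=> [g]; rewrite s4 => c t; apply/ramsey_graphP; split=> //.
  (* Both alternatives bound the stability number by 5. *)
  by apply/stable_free_al; case: (gap4_17 g c) => -[->].
split=> //; split; first by rewrite s4 s24.
split=> [G|G eG nr].
  by split=> [[]|r]; [exact: tri|split; [exact: ext|case: r]].
have [g] := eG; rewrite s4 => c; rewrite alphaE thetaE.
by case: (gap4_17 g c) => // -[_ t]; case: nr; apply: tri.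
Qed.
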